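(* Let $x_1,\dots,x_n$, $a_1,\dots,a_n$, and $c_1,\dots,c_{n}$ be indeterminates. For each $j=1,\dots,n$, let $P_j$ be an $A_{j-1}$ theta function of norm $-(c_1\cdots c_{n}a_{j+1}\cdots a_n)^{-1}$. Then $$\det_{1\leq i,j\leq n}\left(x_i^{-n}\prod_{k=1}^{n}\theta(c_kx_i)\,P_j(x_i)\prod_{k=j+1}^n\theta(a_kx_i)-x_i^{n}\prod_{k=1}^{n}\theta(c_kx_i^{-1})\,P_j(x_i^{-1})\prod_{k=j+1}^n\theta(a_kx_i^{-1})\right)$$ $$=\frac{a_1\cdots a_n\,c_1\cdots c_n\,\theta(-1)}{\theta(-c_1\cdots c_{n}a_1\cdots a_n)}\prod_{i=1}^nP_i(1/a_i)\prod_{i=1}^n\theta(pc_i^2;p^2)\prod_{1\leq i<j\leq n}\theta(c_ic_j)\prod_{i=1}^nx_i^{-1}\theta(x_i^2;p^2)\prod_{1\le i<j\le n}a_jx_i^{-1}\,\theta(x_ix_j^{\pm}).$$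
   Context: Fix $p\in\mathbb C$ with $0<|p|<1$. Put $(a;q)_\infty=\prod_{j\ge0}(1-aq^j)$, $\theta(x;q)=(x;q)_\infty(q/x;q)_\infty$ for $x\ne0$, $\theta(x)=\theta(x;p)$, and $\theta(xy^{\pm})=\theta(xy)\theta(x/y)$. A function $f$ holomorphic on $\mathbb C\setminus\{0\}$ is called an $A_{m-1}$ theta function of norm $s$ (with $m\ge1$ and $s\in\mathbb C\setminus\{0\}$) if $f(px)=\frac{(-1)^m}{s x^m}f(x)$ for all $x\neq0$. ''Indeterminates'' are understood as nonzero complex numbers, assumed generic so that no denominators vanish. *)

(* Defs.v *)
From HB Require Import structures.
From mathcomp Require Import all_boot all_order all_algebra.
From mathcomp Require Import complex.
From mathcomp Require Import all_classical all_reals all_analysis.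
From mathcomp Require Import Rstruct.

Set Implicit Arguments.
Unset Strict Implicit.
Unset Printing Implicit Defensive.

Import Order.TTheory GRing.Theory Num.Theory.
Import numFieldNormedType.Exports.

Local Open Scope classical_set_scope.
Local Open Scope ring_scope.

Definition CC : numClosedFieldType := Rdefinitions.R[i].

(* The limit is taken in the norm topology of the complex plane; it exists
   whenever `|q| < 1. *)
Definition qpoch (a q : CC) : CC :=
  limn (fun N : nat => \prod_(0 <= j < N) (1 - a * q ^+ j) : CC).

Definition theta (q x : CC) : CC := qpoch x q * qpoch (q / x) q.

Definition theta_pm (q x y : CC) : CC := theta q (x * y) * theta q (x / y).

(* Derivability in direction 1 over the scalar field CC itself is complex
   differentiability. The value of f at 0 is irrelevant. *)
Definition holomorphic_punctured (f : CC -> CC) : Prop :=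
  forall x : CC, x != 0 -> derivable f x 1.

(* f is an A_{m-1} theta function of norm s, with respect to the nome p. *)
Definition A_theta (p : CC) (m : nat) (s : CC) (f : CC -> CC) : Prop :=
  [/\ (0 < m)%N, s != 0, holomorphic_punctured f &
      forall x : CC, x != 0 -> f (p * x) = (- 1) ^+ m / (s * x ^+ m) * f x].

(* Main.v *)
Require Import Defs.
From mathcomp Require Import all_boot all_order all_algebra.
From mathcomp Require Import complex.
From mathcomp Require Import all_classical all_reals all_analysis.
From mathcomp Require Import Rstruct.
From mathcomp Require Import perm ring lra.

(** Call a holomorphic function on the punctured plane a theta function of degree
    [n] and norm [s] if it is multiplied by [(-1) ^+ n / (s * x ^+ n)] when [x] is
    replaced by [p * x]. For fixed [n] and [s] such functions form a vector space,
    and the proof rests on one fact about it: a function of the space that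
    vanishes at [n] points, distinct modulo [p], whose product is not [s^-1]
    modulo [p], vanishes everywhere ([theta_space_vanish]). Indeed, divide it by a
    product of theta functions with the same zeros; an additional quotient of
    theta functions with a single pole, at an arbitrary point [y], makes the
    result invariant under [x -> p * x]. Its integrals over the two boundary
    circles of a fundamental annulus then agree, so its residue at [y] is 0,
    which means that the given function vanishes at [y]. This uses Cauchy's
    formula in an annulus, obtained from Goursat's theorem for rectangles and the
    exponential map. Consequently a function of the space with [n - 1] known zeros
    is determined by its value at one further point ([theta_space_unique]).

    The entries of the matrix are the values at [x i] of antisymmetrizations,
    under [y -> y^-1], of
    [y ^- n * \prod_k theta p (c k * y) * F j y], where
    [F j y = P j y * \prod_(k > j) theta p (a k * y)]. All the [F j] belong to the
    space of degree [n] and norm [- (\prod_i c i)^-1], and interpolation at the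
    points [c l] ([theta_interpolation]) expresses them by functions [node l]
    that vanish at the other points [c k]. So the matrix is the product of the
    matrix of antisymmetrized nodes and the matrix of the values [F j (c l)], up
    to the factors [node l (c l)].

    The antisymmetrization of a node splits into factors, by the three-term
    relation [theta_three_term]: besides factors that depend on [x i] alone or on
    [c l] alone, there remains the product over [k != l] of
    [psi x y = x^-1 * theta p (x * y) * theta p (x / y)] at [x i] and [c k]. By
    another three-term relation [psi_pluecker], [psi x y] is a difference
    [t x - t y] up to factors, so the determinant of these products is that of
    the Lagrange polynomials ([det_lagrange], [det_psi]). The determinant of the
    values [F j (c l)] is found by induction on [n], by comparing its values as a
    function of the last point ([det_flag]).

    The interpolation and the induction need some theta functions of the [c i]
    and [a i] not to vanish. Both sides of the formula are holomorphic in the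
    [c i], so the general case follows by moving the [c i], with their product
    fixed, along a curve on which these conditions hold near the given point
    ([antisym_det]). *)

Set Implicit Arguments.
Unset Strict Implicit.
Unset Printing Implicit Defensive.

Import Order.TTheory GRing.Theory Num.Theory.
Import numFieldNormedType.Exports.
Local Open Scope ring_scope.

(** * Complex differentiability *)

Notation R := Rdefinitions.R.

(** Complex differentiability at a point, with the error term made explicit:
    this is the form in which the estimates below produce and consume it. *)
Definition hol (f : CC -> CC) (x : CC) : Prop :=
  exists D : CC, forall e : CC, 0 < e -> exists2 d : CC, 0 < d &
    forall h, `|h| < d -> `|f (x + h) - f x - D * h| <= e * `|h|.

Lemma holP (f : CC -> CC) (x : CC) : hol f x <-> derivable f x 1.
Proof.
split.
  move=> [D H]; apply/cvg_ex; exists D; apply/cvgrPdist_le => e e0.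
  have [d d0 dP] := H e e0; rewrite near_withinE.
  apply/nbhs_ballP; exists d => //= h; rewrite -ball_normE /ball_ /= sub0r normrN => hd h0.
  rewrite [_%:A](mulr1 h).
  have nh : 0 < `|h| by rewrite normr_gt0.
  have := dP h hd.
  rewrite -ler_pdivrMr // -normfV -normrM.
  rewrite (_ : _ / _ = - (D - h^-1 * (f (h + x) - f x))) ?normrN //.
  by rewrite [x + h]addrC; field.
move=> /cvg_ex[D fD]; exists D => e e0.
move/cvgrPdist_le : fD => /(_ e e0); rewrite near_withinE.
move=> /nbhs_ballP[d /= d0 dP]; exists d => // h hd.
have [->|h0] := eqVneq h 0; first by rewrite addr0 mulr0 !subr0 subrr normr0 mulr0.
have := dP h; rewrite -ball_normE /ball_ /= sub0r normrN => /(_ hd h0).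
rewrite [_%:A](mulr1 h) => dP'.
have nh : 0 < `|h| by rewrite normr_gt0.
rewrite -ler_pdivrMr // -normfV -normrM.
rewrite (_ : _ * _ = - (D - h^-1 * (f (h + x) - f x))) ?normrN //.
by rewrite [x + h]addrC; field.
Qed.

Lemma hol_cont (f : CC -> CC) (x : CC) : hol f x -> {for x, continuous f}.
Proof. by move=> /holP /derivable1_diffP; exact: differentiable_continuous. Qed.

Lemma hol_comp (f g : CC -> CC) (x : CC) :
  hol g x -> hol f (g x) -> hol (fun z => f (g z)) x.
Proof.
move=> /holP /derivable1_diffP dg /holP /derivable1_diffP df.
apply/holP; apply/derivable1_diffP.
exact: (differentiable_comp dg df).
Qed.

Lemma hol_cst (k x : CC) : hol (fun _ => k) x.
Proof. by apply/holP; exact: derivable_cst. Qed.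

Lemma hol_id (x : CC) : hol (fun z => z) x.
Proof. by apply/holP; exact: derivable_id. Qed.

Lemma holD (f g : CC -> CC) (x : CC) :
  hol f x -> hol g x -> hol (fun z => f z + g z) x.
Proof. by move=> /holP fx /holP gx; apply/holP; exact: (derivableD fx gx). Qed.

Lemma holB (f g : CC -> CC) (x : CC) :
  hol f x -> hol g x -> hol (fun z => f z - g z) x.
Proof. by move=> /holP fx /holP gx; apply/holP; exact: (derivableB fx gx). Qed.

Lemma holM (f g : CC -> CC) (x : CC) :
  hol f x -> hol g x -> hol (fun z => f z * g z) x.
Proof. by move=> /holP fx /holP gx; apply/holP; exact: (derivableM fx gx). Qed.

Lemma holV (f : CC -> CC) (x : CC) :
  f x != 0 -> hol f x -> hol (fun z => (f z)^-1) x.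
Proof. by move=> fx0 /holP fx; apply/holP; exact: (derivableV fx0 fx). Qed.

Lemma hol_prod (I : Type) (r : seq I) (Q : pred I) (F : I -> CC -> CC) (x : CC) :
  (forall i, Q i -> hol (F i) x) -> hol (fun z => \prod_(i <- r | Q i) F i z) x.
Proof.
move=> H; elim: r => [|i r IH].
  rewrite (_ : (fun z => _) = fun=> 1); first exact: hol_cst.
  by apply/funext => z; rewrite big_nil.
have E z : \prod_(j <- i :: r | Q j) F j z =
    (if Q i then F i z else 1) * \prod_(j <- r | Q j) F j z.
  by rewrite big_cons; case: ifP => // _; rewrite mul1r.
rewrite (funext E); apply: holM => //.
by case Qi: (Q i); [exact: H|exact: hol_cst].
Qed.

Lemma hol_near_neq0 (f : CC -> CC) (x : CC) :
  hol f x -> f x != 0 -> (\forall u \near x, f u != 0)%classic.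
Proof. by move=> /hol_cont c fx; apply: (cvgr_neq0 _ c). Qed.

(** * Convergence in the complex plane *)

Lemma normCE (z : CC) : `|z| = (complex.Re `|z|)%:C%C.
Proof. by rewrite RRe_real // normr_real. Qed.

Lemma normC_le_ReIm (z : CC) :
  `|z| <= (`|complex.Re z| + `|complex.Im z|)%:C%C.
Proof.
rewrite {1}(complexE z) (le_trans (ler_normD _ _)) // rmorphD /= normrM.
by rewrite !normc_def /= !expr0n /= addr0 add0r expr1n !addr0 sqrtr1 mul1r !sqrtr_sqr.
Qed.

Lemma normC_ge_Re (z : CC) : (`|complex.Re z|)%:C%C <= `|z|.
Proof. exact: normc_ge_Re. Qed.

Lemma normC_ge_Im (z : CC) : (`|complex.Im z|)%:C%C <= `|z|.
Proof.
have := normc_ge_Re (z * 'i%C).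
rewrite ReiNIm normrN => /le_trans; apply.
by rewrite normrM (normc_def 'i%C) /= expr0n /= add0r expr1n sqrtr1 mulr1.
Qed.

Lemma real_geometric_cvg (K : realType) (u : nat -> K) (C t : K) : 0 <= t < 1 ->
  (forall N, `|u N.+1 - u N| <= C * t ^+ N) ->
  exists l, forall e : K, 0 < e ->
    exists N0, forall N, (N0 <= N)%N -> `|l - u N| <= e.
Proof.
move=> /andP[t0 t1] H.
have nC : cvgn (series (fun n => `|u n.+1 - u n|)).
  refine (@series_le_cvg K _ (geometric C t) _ _ _ _).
  - by move=> n /=; apply: normr_ge0.
  - by move=> n; exact: le_trans (normr_ge0 _) (H n).
  - by move=> n; exact: H.
  - have nt : `|t| < 1 by rewrite ger0_norm.
    exact: is_cvg_geometric_series nt.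
have /cvg_ex[l lP] : cvgn (series (telescope u)) by exact: normed_cvg nC.
exists (u 0%N + l) => e e0.
have : ((((fun=> u 0%N) : nat -> K^o) + series (telescope u)) x @[x --> \oo] --> (u 0%N + l : K^o))%classic.
  by apply: cvgD; [exact: cvg_cst|exact: lP].
move=> /cvgrPdist_le /(_ e e0)[N0 _ N0P]; exists N0 => N hN; move: (N0P N hN) => h.
by rewrite (eq_sum_telescope u N).
Qed.

Definition tends (u : nat -> CC) (l : CC) : Prop :=
  forall e : CC, 0 < e -> exists N0, forall N, (N0 <= N)%N -> `|l - u N| <= e.

Lemma tends_lim (u : nat -> CC) (l : CC) : tends u l -> limn u = l.
Proof.
move=> H; apply: cvg_lim; first exact: norm_hausdorff.
apply/cvgrPdist_le => e e0; have [N0 N0P] := H e e0.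
by exists N0 => // N /= /N0P.
Qed.

(** Completeness is used for real sequences only, hence the passage to real and
    imaginary parts. *)
Lemma geometric_cvg (u : nat -> CC) (C t : CC) : 0 <= t < 1 ->
  (forall N, `|u N.+1 - u N| <= C * t ^+ N) -> exists l, tends u l.
Proof.
move=> /andP[t0 t1] H.
have [r tr] : exists r : R, t = r%:C%C by exists (complex.Re t); rewrite RRe_real // ger0_real.
have CE : C = (complex.Re C)%:C%C.
  rewrite RRe_real // ger0_real //.
  by have := H 0%N; rewrite expr0 mulr1; apply: le_trans.
subst t; rewrite CE in H; move: {CE} (complex.Re C) H => k H.
rewrite lecR in t0; rewrite ltcR in t1.
have [a aP] : exists l : R, forall e : R, 0 < e -> exists N0, forall N, (N0 <= N)%N -> `|l - complex.Re (u N)| <= e.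
  refine (@real_geometric_cvg _ _ k r _ _); first by rewrite t0.
  move=> N; rewrite -raddfB -lecR (le_trans (normC_ge_Re _)) // (le_trans (H N)) //.
  by rewrite rmorphM rmorphXn.
have [b bP] : exists l : R, forall e : R, 0 < e -> exists N0, forall N, (N0 <= N)%N -> `|l - complex.Im (u N)| <= e.
  refine (@real_geometric_cvg _ _ k r _ _); first by rewrite t0.
  move=> N; rewrite -raddfB -lecR (le_trans (normC_ge_Im _)) // (le_trans (H N)) //.
  by rewrite rmorphM rmorphXn.
exists (a +i* b)%C => e e0.
have eE : e = (complex.Re e)%:C%C by rewrite RRe_real // gtr0_real.
have e0' : 0 < complex.Re e / 2 by rewrite divr_gt0 // -ltcR -eE.
have {aP}[N1 aP] := aP _ e0'.
have {bP}[N2 bP] := bP _ e0'.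
exists (maxn N1 N2) => n; rewrite geq_max => /andP[n1 n2].
rewrite (le_trans (normC_le_ReIm _)) // eE lecR.
rewrite !raddfB /= [leRHS]splitr lerD //; [exact: aP|exact: bP].
Qed.

(** From [1 + x <= expR x], which turns the product into a geometric sum. *)
Lemma real_prod_bound (K : realType) (r t : K) (N : nat) : 0 <= r -> 0 <= t < 1 ->
  \prod_(0 <= j < N) (1 + r * t ^+ j) <= expR (r * ((1 - t ^+ N) / (1 - t))).
Proof.
move=> r0 /andP[t0 t1]; elim: N => [|N IH].
  by rewrite big_geq // expr0 subrr mul0r mulr0 exp.expR0.
rewrite big_nat_recr //=.
have -> : r * ((1 - t ^+ N.+1) / (1 - t)) =
    r * ((1 - t ^+ N) / (1 - t)) + r * t ^+ N.
  by rewrite exprS; field; rewrite subr_eq0 gt_eqF.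
rewrite exp.expRD ler_pM //; last exact: expR_ge1Dx.
  by apply: prodr_ge0 => j _; rewrite addr_ge0 // mulr_ge0 // exprn_ge0.
by rewrite addr_ge0 // mulr_ge0 // exprn_ge0.
Qed.

Lemma prod_bound (r t : CC) : 0 <= r -> 0 <= t < 1 ->
  exists2 B : CC, 0 < B &
    forall N, \prod_(0 <= j < N) (1 + r * t ^+ j) <= B.
Proof.
move=> r0 /andP[t0 t1].
have [r' rE] : exists x : R, r = x%:C%C.
  by exists (complex.Re r); rewrite RRe_real // ger0_real.
have [t' tE] : exists x : R, t = x%:C%C.
  by exists (complex.Re t); rewrite RRe_real // ger0_real.
subst r t; rewrite lecR in r0; rewrite lecR in t0; rewrite ltcR in t1.
exists (expR (r' / (1 - t')))%:C%C; first by rewrite ltcR expR_gt0.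
move=> N; rewrite (_ : \prod_(_ <= _ < _) _ =
    (\prod_(0 <= j < N) (1 + r' * t' ^+ j))%:C%C); last first.
  rewrite rmorph_prod; apply: eq_bigr => j _.
  by rewrite rmorphD rmorph1 rmorphM rmorphXn.
rewrite lecR (le_trans (real_prod_bound _ r0 _)) ?t0 //.
rewrite ler_expR ler_wpM2l // ler_piMl //; first by rewrite invr_ge0 subr_ge0 ltW.
by rewrite gerBl exprn_ge0.
Qed.

Lemma geometric_sum_le (t : CC) (N : nat) : 0 <= t < 1 ->
  \sum_(0 <= j < N) t ^+ j <= (1 - t)^-1.
Proof.
move=> /andP[t0 t1]; have t1' : 0 < 1 - t by rewrite subr_gt0.
suff -> : \sum_(0 <= j < N) t ^+ j = (1 - t ^+ N) / (1 - t).
  rewrite ler_piMl //; first by rewrite invr_ge0 ltW.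
  by rewrite gerBl exprn_ge0.
elim: N => [|N IH]; first by rewrite big_geq // expr0 subrr mul0r.
by rewrite big_nat_recr //= IH exprS; field; rewrite gt_eqF.
Qed.

Lemma tends_unique (u : nat -> CC) (a b : CC) : tends u a -> tends u b -> a = b.
Proof. by move=> /tends_lim <- /tends_lim. Qed.

Lemma tends_cst (a : CC) : tends (fun=> a) a.
Proof. by move=> e e0; exists 0%N => N _; rewrite subrr normr0 ltW. Qed.

Lemma tendsD (u v : nat -> CC) (a b : CC) :
  tends u a -> tends v b -> tends (fun N => u N + v N) (a + b).
Proof.
move=> ua vb e e0; have e2 : 0 < e / 2 by rewrite divr_gt0.
have [N1 N1P] := ua _ e2; have [N2 N2P] := vb _ e2.
exists (maxn N1 N2) => N; rewrite geq_max => /andP[n1 n2].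
rewrite opprD addrACA (le_trans (ler_normD _ _)) // [leRHS]splitr.
by rewrite lerD ?N1P ?N2P.
Qed.

Lemma tendsZ (u : nat -> CC) (a k : CC) :
  tends u a -> tends (fun N => k * u N) (k * a).
Proof.
move=> ua e e0.
have k0 : 0 < `|k| + 1 by rewrite ltr_wpDl.
have [N0 N0P] := ua _ (divr_gt0 e0 k0); exists N0 => N /N0P h.
rewrite -mulrBr normrM (le_trans (ler_wpM2l (normr_ge0 _) h)) //.
by rewrite mulrCA ler_piMr ?(ltW e0) // ler_pdivrMr // mul1r lerDl.
Qed.

Lemma tends_shift (u : nat -> CC) (a : CC) :
  tends u a -> tends (fun N => u N.+1) a.
Proof.
move=> ua e /ua[N0 N0P]; exists N0 => N h; apply: N0P.
exact: leqW.
Qed.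

Lemma tends_double (u : nat -> CC) (a : CC) :
  tends u a -> tends (fun N => u (N.*2)) a.
Proof.
move=> ua e /ua[N0 N0P]; exists N0 => N h; apply: N0P.
by rewrite (leq_trans h) // -addnn leq_addr.
Qed.

Lemma tends_bound (u : nat -> CC) (a b C : CC) :
  tends u a -> (forall N, `|u N - b| <= C) -> `|a - b| <= C.
Proof.
move=> ua uC; apply/ler_addgt0Pl => e e0.
have [N0 N0P] := ua e e0.
have h := N0P _ (leqnn N0).
rewrite (_ : a - b = (a - u N0) + (u N0 - b)); last by ring.
by rewrite (le_trans (ler_normD _ _)) // lerD.
Qed.

Lemma tendsM (u v : nat -> CC) (a b : CC) :
  tends u a -> tends v b -> tends (fun N => u N * v N) (a * b).
Proof.
move=> ua vb.
have d : tends (fun N => (u N - a) * (v N - b)) 0.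
  move=> e e0.
  have [N1 N1P] := ua 1 ltr01; have [N2 N2P] := vb _ e0.
  exists (maxn N1 N2) => N; rewrite geq_max => /andP[n1 n2].
  rewrite sub0r normrN normrM -[leRHS]mul1r ler_pM //.
    by rewrite distrC N1P.
  by rewrite distrC N2P.
have := tendsD (tendsD d (tendsZ a vb)) (tendsD (tendsZ b ua) (tends_cst (- (a * b)))).
rewrite (_ : 0 + a * b + (b * a + - (a * b)) = a * b); last by ring.
by congr tends; apply/funext => N; ring.
Qed.

(** * The infinite product *)

Definition qprod (q : CC) (N : nat) (a : CC) : CC :=
  \prod_(0 <= j < N) (1 - a * q ^+ j).

(** The derivative of [qprod q N] at [a], by the product rule. *)
Fixpoint qprod_deriv (q : CC) (N : nat) (a : CC) : CC :=
  if N is M.+1 then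
    qprod_deriv q M a * (1 - a * q ^+ M) - qprod q M a * q ^+ M
  else 0.

Lemma qprodS (q : CC) (N : nat) (a : CC) :
  qprod q N.+1 a = qprod q N a * (1 - a * q ^+ N).
Proof. by rewrite /qprod big_nat_recr. Qed.

Section QProduct.
Variables (q : CC).
Hypothesis q1 : `|q| < 1.

Let major (r : CC) (N : nat) : CC := \prod_(0 <= j < N) (1 + r * `|q| ^+ j).
Let geom (N : nat) : CC := \sum_(0 <= j < N) `|q| ^+ j.

Let majorS r N : major r N.+1 = major r N * (1 + r * `|q| ^+ N).
Proof. by rewrite /major big_nat_recr. Qed.

Let geomS N : geom N.+1 = geom N + `|q| ^+ N.
Proof. by rewrite /geom big_nat_recr. Qed.

Let major_ge0 r N : 0 <= r -> 0 <= major r N.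
Proof.
by move=> r0; apply: prodr_ge0 => j _; rewrite addr_ge0 // mulr_ge0.
Qed.

Let major_mono r N : 0 <= r -> major r N <= major r N.+1.
Proof. by move=> r0; rewrite majorS ler_peMr ?major_ge0 // lerDl mulr_ge0. Qed.

Let geom_ge0 N : 0 <= geom N.
Proof. by apply: sumr_ge0. Qed.

Let factor_le r a N : `|a| <= r -> `|1 - a * q ^+ N| <= 1 + r * `|q| ^+ N.
Proof.
move=> ar; rewrite (le_trans (ler_normB _ _)) // normr1 lerD2l.
by rewrite normrM normrX ler_wpM2r.
Qed.

Let qprod_le r a N : `|a| <= r -> `|qprod q N a| <= major r N.
Proof.
move=> ar; rewrite /qprod normr_prod; apply: ler_prod => j _.
by rewrite normr_ge0 factor_le.
Qed.

Let deriv_le r a N : `|a| <= r -> `|qprod_deriv q N a| <= major r N * geom N.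
Proof.
move=> ar; have r0 : 0 <= r by apply: le_trans ar.
elim: N => [|N IH] /=; first by rewrite normr0 mulr_ge0 ?major_ge0.
rewrite (le_trans (ler_normB _ _)) // geomS (mulrDr (major r _)) lerD //.
  rewrite normrM majorS mulrAC ler_pM //.
  exact: factor_le.
by rewrite normrM normrX ler_wpM2r // (le_trans (qprod_le _ ar)) ?major_mono.
Qed.

Let delta_le r a h N : `|a| <= r -> `|a + h| <= r ->
  `|qprod q N (a + h) - qprod q N a| <= `|h| * (major r N * geom N).
Proof.
move=> ar ahr; have r0 : 0 <= r by apply: le_trans ar.
elim: N => [|N IH].
  by rewrite /qprod !big_geq // subrr normr0 !mulr_ge0 ?major_ge0.
rewrite !qprodS (_ : _ - _ = (qprod q N (a + h) - qprod q N a) *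
  (1 - a * q ^+ N) - h * (qprod q N (a + h) * q ^+ N)); last by ring.
rewrite (le_trans (ler_normB _ _)) // geomS (mulrDr (major r _)) (mulrDr `|h|) lerD //.
  rewrite normrM majorS (mulrAC (major r N)) mulrA ler_pM //.
  exact: factor_le.
rewrite !normrM normrX ler_wpM2l // ler_wpM2r //.
by rewrite (le_trans (qprod_le _ ahr)) ?major_mono.
Qed.

(** The error of the first-order expansion of a partial product is quadratic in
    [h] with a constant that stays bounded as [N] grows: this is what lets
    differentiability pass to the infinite product. *)
Let remainder_le r a h N : `|a| <= r -> `|a + h| <= r ->
  `|qprod q N (a + h) - qprod q N a - qprod_deriv q N a * h| <=
    `|h| ^+ 2 * (major r N * geom N ^+ 2).
Proof.
move=> ar ahr; have r0 : 0 <= r by apply: le_trans ar.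
elim: N => [|N IH].
  rewrite /qprod !big_geq //= subrr mul0r subr0 normr0.
  by rewrite !mulr_ge0 ?exprn_ge0 ?major_ge0.
rewrite !qprodS /= (_ : _ - _ =
  (qprod q N (a + h) - qprod q N a - qprod_deriv q N a * h) *
  (1 - a * q ^+ N) - h * ((qprod q N (a + h) - qprod q N a) * q ^+ N)); last by ring.
have -> : `|h| ^+ 2 * (major r N.+1 * geom N.+1 ^+ 2) =
    `|h| ^+ 2 * (major r N.+1 * geom N ^+ 2) +
    (`|h| * ((`|h| * (major r N.+1 * geom N)) * `|q| ^+ N)
     + `|h| ^+ 2 * major r N.+1 * `|q| ^+ N * geom N.+1).
  by rewrite geomS; ring.
rewrite (le_trans (ler_normB _ _)) // lerD //.
  rewrite normrM majorS (mulrAC (major r N)) mulrA ler_pM //.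
  exact: factor_le.
rewrite ler_wpDr //; first by rewrite !mulr_ge0 ?exprn_ge0 ?major_ge0.
rewrite !normrM normrX ler_wpM2l // ler_wpM2r //.
rewrite (le_trans (delta_le _ ar ahr)) // ler_wpM2l // ler_wpM2r //.
exact: major_mono.
Qed.

Let q01 : 0 <= `|q| < 1. Proof. by rewrite normr_ge0. Qed.

Lemma qpoch_tends (a : CC) : tends (fun N => qprod q N a) (qpoch a q).
Proof.
have [B B0 BP] := prod_bound (normr_ge0 a) q01.
suff [l lP] : exists l, tends (fun N => qprod q N a) l.
  by rewrite /qpoch (tends_lim lP).
apply: (@geometric_cvg _ (B * `|a|) `|q|) => // N.
rewrite qprodS (_ : _ - _ = - (qprod q N a * a * q ^+ N)); last by ring.
rewrite normrN !normrM normrX ler_wpM2r // ler_wpM2r //.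
exact: le_trans (qprod_le _ (lexx _)) (BP _).
Qed.

Lemma qpoch_rec (a : CC) : qpoch a q = (1 - a) * qpoch (a * q) q.
Proof.
apply: tends_unique (tends_shift (qpoch_tends a)) _.
have := tendsZ (1 - a) (qpoch_tends (a * q)).
congr tends; apply/funext => N; rewrite /qprod big_nat_recl //.
rewrite expr0 mulr1; congr (_ * _); apply: eq_bigr => j _.
by rewrite exprS mulrA.
Qed.

(** The derivative is the limit of the derivatives of the partial products; the
    uniform bound [remainder_le] survives the limit. *)
Lemma qpoch_hol (a : CC) : hol (fun z => qpoch z q) a.
Proof.
set r := `|a| + 1; have r0 : 0 <= r by rewrite addr_ge0.
have ar : `|a| <= r by rewrite lerDl.
have [B B0 BP] := prod_bound r0 q01.
set S := (1 - `|q|)^-1.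
have S0 : 0 <= S by rewrite invr_ge0 subr_ge0 ltW.
have geomP N : geom N <= S by exact: geometric_sum_le.
have [D DP] : exists D, tends (fun N => qprod_deriv q N a) D.
  apply: (@geometric_cvg _ (B * S * r + B) `|q|) => // N /=.
  rewrite (_ : _ - _ = - (qprod_deriv q N a * a + qprod q N a) * q ^+ N); last by ring.
  rewrite normrM normrN normrX ler_wpM2r // (le_trans (ler_normD _ _)) // lerD //.
    rewrite normrM ler_pM // (le_trans (deriv_le _ ar)) // ler_pM //.
      exact: major_ge0.
    exact: BP.
  exact: le_trans (qprod_le _ ar) (BP _).
exists D => e e0.
set K := B * S ^+ 2.
have K0 : 0 <= K by rewrite mulr_ge0 ?exprn_ge0 // ltW.
have eK : 0 < e + K by rewrite ltr_wpDr.
exists (e / (e + K)) => [|h]; first exact: divr_gt0.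
rewrite ltr_pdivlMr // => he.
have h1 : `|h| <= 1.
  rewrite -(ler_pM2r eK) mul1r (le_trans (ltW he)) // lerDl //.
have ahr : `|a + h| <= r by rewrite (le_trans (ler_normD _ _)) // lerD2l.
have T : tends (fun N => qprod q N (a + h) - qprod q N a - qprod_deriv q N a * h)
    (qpoch (a + h) q - qpoch a q - D * h).
  have := tendsD (tendsD (qpoch_tends (a + h)) (tendsZ (-1) (qpoch_tends a))) (tendsZ (- h) DP).
  rewrite (_ : qpoch (a + h) q + -1 * qpoch a q + - h * D = qpoch (a + h) q - qpoch a q - D * h); last by ring.
  by congr tends; apply/funext => N; ring.
have := @tends_bound _ _ 0 (`|h| ^+ 2 * K) T; rewrite subr0.
move=> H; apply: le_trans (H _) _ => [N|].
  rewrite subr0 (le_trans (remainder_le _ ar ahr)) // ler_wpM2l ?exprn_ge0 //.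
  rewrite ler_pM ?major_ge0 ?exprn_ge0 //; first exact: BP.
  by rewrite lerXn2r ?nnegrE ?geom_ge0 ?geomP.
rewrite expr2 -mulrA [leRHS]mulrC ler_wpM2l // (le_trans _ (ltW he)) //.
by rewrite ler_wpM2l // lerDr ltW.
Qed.

(** The partial products stay away from 0: multiplied by the bounded products of
    the factors [1 + k * `|q| ^+ j] with [k = r / (1 - r)] and [r = `|a|], they
    have modulus at least 1, since [(1 - r * t) * (1 + k * t) >= 1] for
    [0 <= t <= 1]. *)
Lemma qpoch_neq0 (a : CC) : `|a| < 1 -> qpoch a q != 0.
Proof.
move=> a1; set r := `|a|; have r1 : 0 < 1 - r by rewrite subr_gt0.
have k0 : 0 <= r / (1 - r) by rewrite divr_ge0 ?normr_ge0 // ltW.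
have [B B0 BP] := prod_bound k0 q01.
have low N : 1 <= `|qprod q N a| * B.
  apply: (@le_trans _ _ (`|qprod q N a| * major (r / (1 - r)) N)); last first.
    by rewrite ler_wpM2l //; exact: BP.
  rewrite /qprod normr_prod /major -big_split /=.
  apply: (@le_trans _ _ (\prod_(0 <= j < N) 1)); first by rewrite big1.
  apply: ler_prod => j _; rewrite ler01 /=.
  have tj : r * `|q| ^+ j <= r.
    by rewrite ler_piMr ?normr_ge0 // exprn_ile1 // ltW.
  apply: (@le_trans _ _ ((1 - r * `|q| ^+ j) * (1 + r / (1 - r) * `|q| ^+ j))).
    have -> : (1 - r * `|q| ^+ j) * (1 + r / (1 - r) * `|q| ^+ j) =
        1 + r * `|q| ^+ j * (r * (1 - `|q| ^+ j)) / (1 - r).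
      by field; rewrite gt_eqF.
    rewrite lerDl divr_ge0 ?(ltW r1) // !mulr_ge0 ?normr_ge0 //.
    by rewrite subr_ge0 exprn_ile1 // ltW.
  apply: ler_wpM2r.
    by rewrite addr_ge0 // mulr_ge0.
  have := lerB_dist 1 (a * q ^+ j); rewrite normr1 normrM normrX. exact.
apply/eqP => q0; have := @tendsZ _ _ B (qpoch_tends a).
rewrite q0 mulr0 => /(_ (1/2)) [|N0 N0P]; first by rewrite divr_gt0.
have := N0P _ (leqnn N0); rewrite sub0r normrN normrM (gtr0_norm B0).
move=> /(le_trans _) - /(_ 1); rewrite mulrC low => /(_ isT).
by rewrite ler_pdivlMr // mul1r -subr_ge0 (_ : 1 - 2%:R = -1) ?oppr_ge0 ?ler10 //; ring.
Qed.

End QProduct.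

Lemma normC_sqr_lt1 (q : CC) : `|q| < 1 -> `|q ^+ 2| < 1.
Proof. by move=> q1; rewrite normrX exprn_ilt1. Qed.

Lemma qpoch_even_odd (q a : CC) : `|q| < 1 ->
  qpoch a q = qpoch a (q ^+ 2) * qpoch (a * q) (q ^+ 2).
Proof.
move=> q1; have q2 := normC_sqr_lt1 q1.
apply: (tends_unique (tends_double (qpoch_tends q1 a))).
have := tendsM (qpoch_tends q2 a) (qpoch_tends q2 (a * q)).
congr tends; apply/funext => N; elim: N => [|N IH].
  by rewrite /qprod !big_geq // mulr1.
by rewrite doubleS !qprodS -IH -!exprM -mul2n (exprS q (2 * N)%N); ring.
Qed.

Lemma qpoch_mul_opp (q a : CC) : `|q| < 1 ->
  qpoch a q * qpoch (- a) q = qpoch (a ^+ 2) (q ^+ 2).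
Proof.
move=> q1; have q2 := normC_sqr_lt1 q1.
apply: (tends_unique (tendsM (qpoch_tends q1 a) (qpoch_tends q1 (- a)))).
have := qpoch_tends q2 (a ^+ 2).
congr tends; apply/funext => N; rewrite /qprod -big_split /=.
by apply: eq_bigr => j _; rewrite -exprM mulnC exprM; ring.
Qed.

(** * The theta function and its zeros *)

Lemma exprn_small (K : realType) (t e : K) : 0 <= t < 1 -> 0 < e ->
  exists n, t ^+ n < e.
Proof.
move=> /andP[t0 t1] e0; have nt : `|t| < 1 by rewrite ger0_norm.
have /cvgrPdist_lt /(_ e e0)[N _ NP] := cvg_expr nt.
exists N; have h := NP N (leqnn N); move: h => /=.
by rewrite sub0r normrN ger0_norm // exprn_ge0.
Qed.

Lemma normC_exprn_small (t e : CC) : `|t| < 1 -> 0 < e ->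
  exists n, `|t| ^+ n < e.
Proof.
move=> t1 e0; rewrite (normCE t) in t1 *.
have eE : e = (complex.Re e)%:C%C by rewrite RRe_real // gtr0_real.
rewrite eE ltcR in e0 *; rewrite ltcR in t1.
have t0 : 0 <= complex.Re `|t| by rewrite -ler0c -normCE.
have [n nP] := @exprn_small _ (complex.Re `|t|) _ ltac:(by rewrite t0) e0.
by exists n; rewrite -rmorphXn ltcR.
Qed.

Section Theta.
Variable p : CC.
Hypothesis p01 : 0 < `|p| < 1.

Let p0 : p != 0. Proof. by case/andP: p01; rewrite normr_gt0. Qed.
Let p1 : `|p| < 1. Proof. by case/andP: p01. Qed.

(** What remains of [theta p x] without the factor [1 - x]; it has no zero for
    [`|p| < `|x| < `|p|^-1], an annulus that contains a fundamental domain of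
    multiplication by [p]. *)
Definition theta_cofactor (x : CC) : CC := qpoch (x * p) p * qpoch (p / x) p.

Lemma theta_factor (x : CC) : theta p x = (1 - x) * theta_cofactor x.
Proof. by rewrite /theta (qpoch_rec p1) -mulrA. Qed.

Lemma theta_at1 : theta p 1 = 0.
Proof. by rewrite theta_factor subrr mul0r. Qed.

(** Multiplication of the argument by [p] removes the first factor of one product
    and adds one factor to the other. *)
Lemma theta_mulp (x : CC) : x != 0 -> theta p (p * x) = - x^-1 * theta p x.
Proof.
move=> x0; rewrite [in RHS]theta_factor /theta_cofactor /theta.
rewrite (_ : p / (p * x) = x^-1); last by field; rewrite p0 x0.
rewrite [qpoch x^-1 p](qpoch_rec p1) (mulrC p x) (mulrC x^-1 p).
by field.
Qed.

Lemma thetaV (x : CC) : x != 0 -> theta p x^-1 = - x^-1 * theta p x.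
Proof.
move=> x0; rewrite -theta_mulp // /theta (mulrC (qpoch (p * x) p)).
by rewrite invrK (_ : p / (p * x) = x^-1) //; field; rewrite p0 x0.
Qed.

Lemma theta_pdiv (x : CC) : x != 0 -> theta p (p / x) = theta p x.
Proof.
move=> x0; rewrite /theta mulrC (_ : p / (p / x) = x) //.
by field; rewrite p0 x0.
Qed.

Lemma theta_cofactor_hol (x : CC) : x != 0 -> hol theta_cofactor x.
Proof.
move=> x0; apply: holM.
  apply: (hol_comp (f := fun z => qpoch z p)); last exact: qpoch_hol.
  apply: holM; [exact: hol_id|exact: hol_cst].
apply: (hol_comp (f := fun z => qpoch z p)); last exact: qpoch_hol.
apply: holM; [exact: hol_cst|apply: holV => //; exact: hol_id].
Qed.

Lemma theta_hol (x : CC) : x != 0 -> hol (theta p) x.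
Proof.
move=> x0; apply: holM; first exact: qpoch_hol.
apply: (hol_comp (f := fun z => qpoch z p)); last exact: qpoch_hol.
apply: holM; [exact: hol_cst|apply: holV => //; exact: hol_id].
Qed.

Lemma theta_cofactor_neq0 (x : CC) :
  `|p| < `|x| -> `|x * p| < 1 -> theta_cofactor x != 0.
Proof.
move=> px xp; have x0 : x != 0 by rewrite -normr_gt0 (le_lt_trans _ px).
rewrite mulf_neq0 ?qpoch_neq0 // normrM normfV ltr_pdivrMr ?normr_gt0 //.
by rewrite mul1r.
Qed.

Lemma theta_opp1_neq0 : theta p (-1) != 0.
Proof.
rewrite theta_factor; apply: mulf_neq0; first by rewrite opprK -mulr2n pnatr_eq0.
by apply: theta_cofactor_neq0; rewrite ?normrM normrN1 ?mul1r.
Qed.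

Lemma theta_mul_opp (x : CC) : theta p x * theta p (- x) = theta (p ^+ 2) (x ^+ 2).
Proof.
rewrite /theta -exprVn -exprMn -!(qpoch_mul_opp _ p1) invrN mulrN.
by ring.
Qed.

Lemma theta_even_odd (x : CC) : x != 0 ->
  theta p x = theta (p ^+ 2) x * theta (p ^+ 2) (p * x).
Proof.
move=> x0; rewrite /theta (qpoch_even_odd x p1) (qpoch_even_odd (p / x) p1).
rewrite (_ : p / x * p = p ^+ 2 / x); last by field.
rewrite (_ : p ^+ 2 / (p * x) = p / x); last by field; rewrite p0 x0.
by rewrite (mulrC p x); ring.
Qed.

(** The points lie in the same orbit of multiplication by [p]; using two exponents
    avoids negative powers. *)
Definition p_equiv (x y : CC) : Prop := exists k l : nat, p ^+ k * x = p ^+ l * y.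

Lemma theta_mulXp_eq0 (x : CC) (k : nat) : x != 0 ->
  (theta p (p ^+ k * x) == 0) = (theta p x == 0).
Proof.
move=> x0; elim: k => [|k IH]; first by rewrite expr0 mul1r.
have px0 : p ^+ k * x != 0 by rewrite mulf_neq0 // expf_neq0.
by rewrite exprS -mulrA theta_mulp // mulf_eq0 oppr_eq0 invr_eq0 (negPf px0) IH.
Qed.

Lemma p_equiv_theta_eq0 (x y : CC) : x != 0 -> y != 0 -> p_equiv x y ->
  (theta p x == 0) = (theta p y == 0).
Proof.
move=> x0 y0 [k [l E]].
by rewrite -(theta_mulXp_eq0 k x0) E theta_mulXp_eq0.
Qed.

Lemma p_equivM (x y x' y' : CC) :
  p_equiv x y -> p_equiv x' y' -> p_equiv (x * x') (y * y').
Proof.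
move=> [k [l E]] [k' [l' E']]; exists (k + k')%N, (l + l')%N.
by rewrite !exprD mulrACA E E' mulrACA.
Qed.

Lemma p_equiv_refl (x : CC) : p_equiv x x.
Proof. by exists 0%N, 0%N. Qed.

(** Division by a large power of [p] leads out of the disc of radius [r]; the
    first return into the disc under multiplication by [p] is in the annulus. *)
Lemma p_equiv_annulus (x r : CC) : x != 0 -> 0 < r ->
  exists y, [/\ y != 0, p_equiv x y, r * `|p| < `|y| & `|y| <= r].
Proof.
move=> x0 r0.
have nx : 0 < `|x| by rewrite normr_gt0.
have np : 0 < `|p| by rewrite normr_gt0.
have npn n : 0 < `|p| ^+ n by rewrite exprn_gt0.
have [M MP] := normC_exprn_small p1 (divr_gt0 nx r0).
have [n0 n0P] := normC_exprn_small p1 (divr_gt0 r0 (divr_gt0 nx (npn M))).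
set x' := x / p ^+ M.
have x'0 : x' != 0 by rewrite mulf_neq0 // invr_eq0 expf_neq0.
have nx' : `|x'| = `|x| / `|p| ^+ M by rewrite normrM normfV normrX.
have ex : exists n, `|p ^+ n * x'| <= r.
  exists n0; rewrite normrM normrX nx' ltW //.
  by rewrite -ltr_pdivlMr ?divr_gt0.
case: (ex_minnP ex) => -[|n] nr nmin.
  move: nr; rewrite expr0 mul1r nx' ler_pdivrMr //.
  move: MP; rewrite ltr_pdivlMr // mulrC => /lt_le_trans h /h.
  by rewrite ltxx.
exists (p ^+ n.+1 * x'); split => //.
- by rewrite mulf_neq0 // expf_neq0.
- exists n.+1, M; rewrite /x'; field.
  by rewrite expf_neq0.
- rewrite exprS -mulrA normrM mulrC ltr_pM2l //.
  rewrite real_ltNge ?normr_real ?gtr0_real //; apply/negP => /nmin.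
  by rewrite ltnn.
Qed.

(** Zeros of theta are isolated: [w] may be replaced by a point [y] of its orbit
    with [`|p| < `|y| <= 1], near which [1 - y * u] is the only factor that can
    vanish. *)
Lemma theta_near_neq0 (w : CC) : w != 0 ->
  (\forall u \near (1 : CC), u != 1 -> theta p (w * u) != 0)%classic.
Proof.
move=> w0; have [y [y0 wy py y1]] := p_equiv_annulus w0 ltr01.
rewrite mul1r in py.
have np : 0 < `|p| by rewrite normr_gt0.
have chi0 : theta_cofactor y != 0.
  apply: theta_cofactor_neq0 => //.
  by rewrite normrM (le_lt_trans _ p1) // ler_piMl.
have hlin : hol (fun u => y * u) 1 by apply: holM; [exact: hol_cst|exact: hol_id].
have ychi : (\forall u \near (1 : CC), theta_cofactor (y * u) != 0)%classic.
  apply: hol_near_neq0; rewrite ?mulr1 //.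
  by apply: (hol_comp hlin); apply: theta_cofactor_hol; rewrite mulr1.
have ylin : (\forall u \near (1 : CC), u != 1 -> 1 - y * u != 0)%classic.
  have [->|y1'] := eqVneq y 1.
    by near=> u; rewrite mul1r subr_eq0 eq_sym.
  have : (\forall u \near (1 : CC), 1 - y * u != 0)%classic.
    apply: hol_near_neq0; last by rewrite mulr1 subr_eq0 eq_sym.
    by apply: holB => //; exact: hol_cst.
  by apply: filterS => u.
have unz : (\forall u \near (1 : CC), u != 0)%classic.
  by apply: hol_near_neq0; [exact: hol_id|exact: oner_neq0].
near=> u => u1.
have u0 : u != 0 by near: u.
have -> : (theta p (w * u) == 0) = (theta p (y * u) == 0).
  by apply: p_equiv_theta_eq0; rewrite ?mulf_neq0 //; exact: p_equivM wy (p_equiv_refl u).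
rewrite theta_factor mulf_eq0 negb_or; apply/andP; split; last by near: u.
by move: u1; near: u.
Unshelve. all: by end_near.
Qed.

End Theta.

(** * Integrals over a segment *)

(** The structure rather than its carrier, so that results on real functions
    apply without unfolding to the real and imaginary parts below. *)
Definition RR : realType := Rdefinitions.R.

Section RealIntegral.
Variable K : realType.
Implicit Types (f g : K -> K) (a b c M k : K).
Local Notation mu := (@lebesgue_measure K).

(** Continuity is two-sided even at the end points: the integrands below extend
    continuously beyond the segment. *)
Definition cont_on (V : topologicalType) (f : K -> V) (a b : K) : Prop :=
  forall t, a <= t <= b -> {for t, continuous f}.

Definition itg (a b : K) (f : K -> K) : K := \int[mu]_(x in `[a, b]) f x.

Lemma cont_integrable f a b : cont_on f a b -> mu.-integrable `[a, b] (EFin \o f).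
Proof.
move=> fc; apply: continuous_compact_integrable; first exact: segment_compact.
apply: continuous_in_subspaceT => x; rewrite inE /= in_itv /= => xab.
exact: fc.
Qed.

Lemma eq_itg a b f g : (forall t, a <= t <= b -> f t = g t) -> itg a b f = itg a b g.
Proof.
move=> fg; apply: eq_Rintegral => x; rewrite inE /= in_itv /=; exact: fg.
Qed.

Lemma itgD a b f g : cont_on f a b -> cont_on g a b ->
  itg a b (fun t => f t + g t) = itg a b f + itg a b g.
Proof. by move=> fc gc; apply: RintegralD => //; exact: cont_integrable. Qed.

Lemma itgZ a b k f : cont_on f a b ->
  itg a b (fun t => k * f t) = k * itg a b f.
Proof. by move=> fc; apply: RintegralZl => //; exact: cont_integrable. Qed.

Lemma itg_cst a b k : a <= b -> itg a b (fun=> k) = k * (b - a).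
Proof.
move=> ab; rewrite /itg Rintegral_cst //= lebesgue_measure_itv /= lte_fin.
by move: ab; rewrite le_eqVlt => /predU1P[->|->] //=; rewrite ltxx subrr.
Qed.

Lemma itg_split a b c f : a <= c <= b -> cont_on f a b ->
  itg a b f = itg a c f + itg c b f.
Proof.
move=> /andP[ac cb] fc; have fi := cont_integrable fc.
have := Rintegral_itvB fi; move=> /(_ c); rewrite !bnd_simp => /(_ ac cb).
move=> /eqP; rewrite subr_eq => /eqP; rewrite addrC /itg => ->; congr (_ + _).
rewrite Rintegral_itv_obnd_cbnd //.
apply: integrableS fi => //; apply: subset_itvr; rewrite bnd_simp //.
Qed.

Lemma itg_bound a b f M : a <= b -> cont_on f a b ->
  (forall t, a <= t <= b -> `|f t| <= M) -> `|itg a b f| <= M * (b - a).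
Proof.
move=> ab fc fM; have fi := cont_integrable fc.
apply: (le_trans (le_normr_Rintegral _ fi)) => //.
rewrite -(itg_cst M ab); apply: le_Rintegral => //.
- exact: integrable_norm.
- by apply: cont_integrable => t _; exact: cst_continuous.
Qed.

Lemma itg_shift a b c f : a <= b -> cont_on f (a + c) (b + c) ->
  itg (a + c) (b + c) f = itg a b (fun t => f (t + c)).
Proof.
move=> ab fc; pose F : K -> K := fun x => x + c.
have dF : derive1 F = cst 1.
  by apply/funext => z; rewrite derive1E deriveD // derive_id derive_cst addr0.
have Fc : continuous F.
  by move=> x; apply: cvgD; [exact: cvg_id|exact: cvg_cst].
rewrite /itg /Rintegral; congr fine.
rewrite -/(F a) -/(F b) (@integration_by_substitution_increasing K F f a b) //.
- by apply: eq_integral => x _; rewrite /= dF /= mulr1.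
- by move=> x y _ _ xy; rewrite ltrD2r.
- by rewrite dF => x _; exact: cvg_cst.
- by rewrite dF; exact: is_cvg_cst.
- by rewrite dF; exact: is_cvg_cst.
- split=> [x _|x|x].
  + exact: derivableD.
  + by apply: cvg_at_right_filter; exact: Fc.
  + by apply: cvg_at_left_filter; exact: Fc.
- apply: continuous_in_subspaceT => x; rewrite inE /= in_itv /= => xab.
  exact: fc.
Qed.
End RealIntegral.

Definition cint (a b : RR) (f : RR -> CC) : CC :=
  (itg a b (fun t => complex.Re (f t)) +i* itg a b (fun t => complex.Im (f t)))%C.

Definition rc (x : RR) : CC := (x%:C)%C.

Lemma rc_ge0 (x : RR) : (0 <= rc x) = (0 <= x). Proof. exact: ler0c. Qed.
Lemma rc_gt0 (x : RR) : (0 < rc x) = (0 < x). Proof. exact: ltcR. Qed.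
Lemma ler_rc (x y : RR) : (rc x <= rc y) = (x <= y). Proof. exact: lecR. Qed.
Lemma ltr_rc (x y : RR) : (rc x < rc y) = (x < y). Proof. exact: ltcR. Qed.
Lemma rcD (x y : RR) : rc (x + y) = rc x + rc y. Proof. exact: rmorphD. Qed.
Lemma rcB (x y : RR) : rc (x - y) = rc x - rc y. Proof. exact: rmorphB. Qed.
Lemma rcM (x y : RR) : rc (x * y) = rc x * rc y. Proof. exact: rmorphM. Qed.
Lemma rcV (x : RR) : rc x^-1 = (rc x)^-1. Proof. exact: fmorphV. Qed.
Lemma rc0 : rc 0 = 0. Proof. by []. Qed.
Lemma rc1 : rc 1 = 1. Proof. by []. Qed.
Lemma norm_rc (x : RR) : `|rc x| = rc `|x|.
Proof. by rewrite /rc normc_def /= expr0n /= addr0 sqrtr_sqr. Qed.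
Lemma rcE (z : CC) : z \is Num.real -> z = rc (complex.Re z).
Proof. by move=> zr; rewrite /rc RRe_real. Qed.

Lemma cont_Re (f : RR -> CC) (t : RR) : {for t, continuous f} ->
  {for t, continuous (fun u => complex.Re (f u) : RR)}.
Proof.
move=> /cvgrPdist_le fc; apply/cvgrPdist_le => e e0.
have := fc (rc e); rewrite rc_gt0 => /(_ e0); apply: filterS => u h.
by rewrite -raddfB -ler_rc (le_trans _ h) // normC_ge_Re.
Qed.

Lemma cont_Im (f : RR -> CC) (t : RR) : {for t, continuous f} ->
  {for t, continuous (fun u => complex.Im (f u) : RR)}.
Proof.
move=> /cvgrPdist_le fc; apply/cvgrPdist_le => e e0.
have := fc (rc e); rewrite rc_gt0 => /(_ e0); apply: filterS => u h.
by rewrite -raddfB -ler_rc (le_trans _ h) // normC_ge_Im.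
Qed.

Lemma cont_on_Re (f : RR -> CC) a b : cont_on f a b ->
  cont_on (fun t => complex.Re (f t) : RR) a b.
Proof. by move=> fc t /fc; exact: cont_Re. Qed.

Lemma cont_on_Im (f : RR -> CC) a b : cont_on f a b ->
  cont_on (fun t => complex.Im (f t) : RR) a b.
Proof. by move=> fc t /fc; exact: cont_Im. Qed.

Lemma cont_onD (f g : RR -> CC) a b : cont_on f a b -> cont_on g a b ->
  cont_on (fun t => f t + g t) a b.
Proof. by move=> fc gc t tab; exact: cvgD (fc t tab) (gc t tab). Qed.

Lemma cont_on_cst (k : CC) (a b : RR) : cont_on (fun=> k) a b.
Proof. by move=> t _; exact: cst_continuous. Qed.

Lemma cont_onZ (f : RR -> CC) k a b : cont_on f a b ->
  cont_on (fun t => k * f t) a b.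
Proof. by move=> fc t tab; exact: cvgM (cvg_cst k) (fc t tab). Qed.

Lemma eq_cint a b f g : (forall t, a <= t <= b -> f t = g t) ->
  cint a b f = cint a b g.
Proof.
by move=> fg; congr (_ +i* _)%C; apply: eq_itg => t tab; rewrite fg.
Qed.

Lemma cintD a b (f g : RR -> CC) : cont_on f a b -> cont_on g a b ->
  cint a b (fun t => f t + g t) = cint a b f + cint a b g.
Proof.
move=> fc gc; rewrite /cint.
rewrite [LHS](_ : _ = ((itg a b (fun t => complex.Re (f t)) + itg a b (fun t => complex.Re (g t)))
  +i* (itg a b (fun t => complex.Im (f t)) + itg a b (fun t => complex.Im (g t))))%C) //.
congr (_ +i* _)%C.
  rewrite -itgD; [|exact: cont_on_Re..].
  by apply: eq_itg => t _; rewrite raddfD.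
rewrite -itgD; [|exact: cont_on_Im..].
by apply: eq_itg => t _; rewrite raddfD.
Qed.

Lemma cintZ a b (k : CC) (f : RR -> CC) : cont_on f a b -> cint a b (fun t => k * f t) = k * cint a b f.
Proof.
move=> fc; have fr := cont_on_Re fc; have fi := cont_on_Im fc.
have cZ (x : RR) (g : RR -> RR) : cont_on g a b -> cont_on (fun t => x * g t) a b.
  by move=> gc t tab; exact: cvgM (cvg_cst x) (gc t tab).
case: k => x y; rewrite /cint.
rewrite [RHS](_ : _ = ((x * itg a b (fun t => complex.Re (f t)) + - y * itg a b (fun t => complex.Im (f t)))
  +i* (x * itg a b (fun t => complex.Im (f t)) + y * itg a b (fun t => complex.Re (f t))))%C); last first.
  by simpc; congr (_ +i* _)%C; ring.
congr (_ +i* _)%C.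
  rewrite -!itgZ // -itgD; [|exact: cZ..].
  by apply: eq_itg => t _; case: (f t) => u v /=; ring.
rewrite -!itgZ // -itgD; [|exact: cZ..].
by apply: eq_itg => t _; case: (f t) => u v /=; ring.
Qed.

Lemma cint_cst a b (k : CC) : a <= b -> cint a b (fun=> k) = k * rc (b - a).
Proof.
move=> ab; rewrite /cint !itg_cst //; case: k => x y /=.
by rewrite /rc; simpc; congr (_ +i* _)%C; ring.
Qed.

Lemma cint_split a b c (f : RR -> CC) : a <= c <= b -> cont_on f a b ->
  cint a b f = cint a c f + cint c b f.
Proof.
move=> acb fc; rewrite /cint (itg_split acb (cont_on_Re fc)).
by rewrite (itg_split acb (cont_on_Im fc)).
Qed.

Lemma cint_shift a b c (f : RR -> CC) : a <= b -> cont_on f (a + c) (b + c) ->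
  cint (a + c) (b + c) f = cint a b (fun t => f (t + c)).
Proof.
by move=> ab fc; congr (_ +i* _)%C; apply: itg_shift => //;
  [exact: cont_on_Re|exact: cont_on_Im].
Qed.

(** The factor 2 comes from bounding the real and the imaginary part separately. *)
Lemma cint_bound a b (f : RR -> CC) M : a <= b -> cont_on f a b ->
  (forall t, a <= t <= b -> `|f t| <= rc M) -> `|cint a b f| <= rc (M * (b - a) *+ 2).
Proof.
move=> ab fc fM; rewrite (le_trans (normC_le_ReIm _)) // ler_rc mulr2n lerD //=.
  apply: itg_bound => //; first exact: cont_on_Re.
  by move=> t /fM h; rewrite -ler_rc (le_trans _ h) // normC_ge_Re.
apply: itg_bound => //; first exact: cont_on_Im.
by move=> t /fM h; rewrite -ler_rc (le_trans _ h) // normC_ge_Im.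
Qed.

(** * Integrals around rectangles *)

Lemma Re_rci (t : RR) : complex.Re (rc t * 'i) = 0.
Proof. by rewrite -complexiE ReiNIm /= oppr0. Qed.

Lemma Im_rci (t : RR) : complex.Im (rc t * 'i) = t.
Proof. by rewrite -complexiE ImiRe. Qed.

Lemma ReD (z w : CC) : complex.Re (z + w) = complex.Re z + complex.Re w.
Proof. exact: raddfD. Qed.
Lemma ImD (z w : CC) : complex.Im (z + w) = complex.Im z + complex.Im w.
Proof. exact: raddfD. Qed.
Lemma Re_rc (t : RR) : complex.Re (rc t) = t. Proof. by []. Qed.
Lemma Im_rc (t : RR) : complex.Im (rc t) = 0. Proof. by []. Qed.

Definition inrect (z : CC) (l m : RR) (w : CC) : Prop :=
  (complex.Re z <= complex.Re w <= complex.Re z + l) /\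
  (complex.Im z <= complex.Im w <= complex.Im z + m).

(** The integral of [G] along the boundary of a rectangle with lower left corner
    [z]; opposite sides are combined, so that both cuts of a rectangle into two
    amount to additivity of integrals over segments. *)
Definition rint (G : CC -> CC) (z : CC) (l m : RR) : CC :=
  cint 0 l (fun s => G (z + rc s) - G (z + rc m * 'i + rc s)) +
  'i * cint 0 m (fun t => G (z + rc l + rc t * 'i) - G (z + rc t * 'i)).

Lemma inrect_corner (z : CC) (l m s t : RR) : 0 <= s <= l -> 0 <= t <= m ->
  inrect z l m (z + rc s + rc t * 'i).
Proof.
move=> /andP[s0 sl] /andP[t0 tm]; rewrite /inrect !(ReD, ImD) Re_rci Im_rci Re_rc Im_rc.
by rewrite !addr0 !lerDl !lerD2l s0 sl t0 tm.
Qed.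

Lemma inrect_dist (z : CC) (l m : RR) (w : CC) : inrect z l m w ->
  `|w - z| <= rc (l + m).
Proof.
move=> [/andP[a b] /andP[c d]]; rewrite (le_trans (normC_le_ReIm _)) // ler_rc.
rewrite !raddfB /= lerD // ger0_norm ?subr_ge0 //.
  by rewrite lerBlDl.
by rewrite lerBlDl.
Qed.

Lemma cont_line (G : CC -> CC) (z k : CC) (t : RR) : `|k| = 1 ->
  {for z + rc t * k, continuous G} -> {for t, continuous (fun u => G (z + rc u * k))}.
Proof.
move=> k1 Gc; apply: (@continuous_comp _ _ _ (fun u => z + rc u * k) G); last exact: Gc.
apply/cvgrPdist_le => e e0.
have e0' : 0 < complex.Re e by rewrite -rc_gt0 -rcE // gtr0_real.
have := @cvg_id _ (nbhs t); move=> /cvgrPdist_le /(_ _ e0').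
apply: filterS => u; rewrite -ler_rc -rcE ?gtr0_real // => h.
rewrite (_ : z + rc t * k - (z + rc u * k) = rc (t - u) * k); last by rewrite rcB; ring.
by rewrite normrM k1 mulr1 norm_rc.
Qed.

Lemma cont_hline (G : CC -> CC) (z : CC) (t : RR) :
  {for z + rc t, continuous G} -> {for t, continuous (fun u => G (z + rc u))}.
Proof.
move=> Gc; have Gc1 : {for z + rc t * 1, continuous G} by rewrite mulr1.
have := cont_line (normr1 _) Gc1.
by rewrite (_ : (fun u => G (z + rc u * 1)) = fun u => G (z + rc u)) //;
  apply/funext => u; rewrite mulr1.
Qed.

Section Rectangle.
Variable G : CC -> CC.

Definition cont_rect (z : CC) (l m : RR) : Prop :=
  forall w, inrect z l m w -> {for w, continuous G}.

Lemma cont_rect_h (z : CC) (l m t : RR) : 0 <= l -> 0 <= t <= m ->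
  cont_rect z l m -> cont_on (fun s => G (z + rc t * 'i + rc s)) 0 l.
Proof.
move=> l0 tm Gc s sl; apply: cont_hline; apply: Gc.
by rewrite addrAC; apply: inrect_corner.
Qed.

Lemma cont_rect_v (z : CC) (l m s : RR) : 0 <= m -> 0 <= s <= l ->
  cont_rect z l m -> cont_on (fun t => G (z + rc s + rc t * 'i)) 0 m.
Proof.
move=> m0 sl Gc t tm; apply: cont_line; first exact: normCi.
by apply: Gc; apply: inrect_corner.
Qed.

Lemma cont_onB (f g : RR -> CC) a b : cont_on f a b -> cont_on g a b ->
  cont_on (fun t => f t - g t) a b.
Proof. by move=> fc gc t tab; exact: cvgB (fc t tab) (gc t tab). Qed.

Let cont_h (z : CC) (l m : RR) : 0 <= l -> 0 <= m -> cont_rect z l m ->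
  cont_on (fun s => G (z + rc s) - G (z + rc m * 'i + rc s)) 0 l.
Proof.
move=> l0 m0 Gc; apply: cont_onB; last by apply: (cont_rect_h _ _ Gc); rewrite ?m0 /=.
have := @cont_rect_h z l m 0 l0; rewrite lexx m0 rc0 mul0r addr0 => /(_ isT Gc).
exact.
Qed.

Let cont_v (z : CC) (l m : RR) : 0 <= l -> 0 <= m -> cont_rect z l m ->
  cont_on (fun t => G (z + rc l + rc t * 'i) - G (z + rc t * 'i)) 0 m.
Proof.
move=> l0 m0 Gc; apply: cont_onB; first by apply: (cont_rect_v _ _ Gc); rewrite ?l0 /=.
have := @cont_rect_v z l m 0 m0; rewrite lexx l0 rc0 addr0 => /(_ isT Gc).
exact.
Qed.

Lemma sub_rect_h1 (z : CC) (l1 l2 m : RR) : 0 <= l2 ->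
  forall w, inrect z l1 m w -> inrect z (l1 + l2) m w.
Proof.
move=> l20 w [/andP[a b] cd]; split=> //; rewrite a /= (le_trans b) //.
by rewrite lerD2l lerDl.
Qed.

Lemma sub_rect_h2 (z : CC) (l1 l2 m : RR) : 0 <= l1 ->
  forall w, inrect (z + rc l1) l2 m w -> inrect z (l1 + l2) m w.
Proof.
move=> l10 w []; rewrite !(ReD, ImD) Re_rc Im_rc addr0 => /andP[a b] cd; split=> //.
by rewrite (le_trans _ a) ?lerDl //= addrA.
Qed.

Lemma sub_rect_v1 (z : CC) (l m1 m2 : RR) : 0 <= m2 ->
  forall w, inrect z l m1 w -> inrect z l (m1 + m2) w.
Proof.
move=> m20 w [cd /andP[a b]]; split=> //; rewrite a /= (le_trans b) //.
by rewrite lerD2l lerDl.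
Qed.

Lemma sub_rect_v2 (z : CC) (l m1 m2 : RR) : 0 <= m1 ->
  forall w, inrect (z + rc m1 * 'i) l m2 w -> inrect z l (m1 + m2) w.
Proof.
move=> m10 w []; rewrite !(ReD, ImD) Re_rci Im_rci addr0 => cd /andP[a b]; split=> //.
by rewrite (le_trans _ a) ?lerDl //= addrA.
Qed.

Lemma rint_hsplit (z : CC) (l1 l2 m : RR) : 0 <= l1 -> 0 <= l2 -> 0 <= m ->
  cont_rect z (l1 + l2) m ->
  rint G z (l1 + l2) m = rint G z l1 m + rint G (z + rc l1) l2 m.
Proof.
move=> l10 l20 m0 Gc; have l0 : 0 <= l1 + l2 by rewrite addr_ge0.
have G1 : cont_rect z l1 m by move=> w /(sub_rect_h1 l20); exact: Gc.
have G2 : cont_rect (z + rc l1) l2 m by move=> w /(sub_rect_h2 l10); exact: Gc.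
have ch := cont_h l0 m0 Gc.
have l1b : 0 <= l1 <= l1 + l2 by rewrite l10 lerDl.
rewrite /rint (cint_split l1b ch).
have -> : cint l1 (l1 + l2) (fun s => G (z + rc s) - G (z + rc m * 'i + rc s)) =
    cint 0 l2 (fun s => G (z + rc l1 + rc s) - G (z + rc l1 + rc m * 'i + rc s)).
  have := @cint_shift 0 l2 l1 (fun s => G (z + rc s) - G (z + rc m * 'i + rc s)) l20.
  rewrite add0r (addrC l2) => ->.
    by apply: eq_cint => t _; rewrite rcD; congr (G _ - G _); ring.
  move=> t /andP[t0 t1]; apply: ch.
  by rewrite t1 (le_trans l10).
have -> : cint 0 m (fun t => G (z + rc (l1 + l2) + rc t * 'i) - G (z + rc t * 'i)) =
    cint 0 m (fun t => G (z + rc l1 + rc t * 'i) - G (z + rc t * 'i)) +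
    cint 0 m (fun t => G (z + rc l1 + rc l2 + rc t * 'i) - G (z + rc l1 + rc t * 'i)).
  rewrite -cintD; [|exact: cont_v|exact: cont_v].
  by apply: eq_cint => t _; rewrite rcD addrA; ring.
by ring.
Qed.

Lemma rint_vsplit (z : CC) (l m1 m2 : RR) : 0 <= l -> 0 <= m1 -> 0 <= m2 ->
  cont_rect z l (m1 + m2) ->
  rint G z l (m1 + m2) = rint G z l m1 + rint G (z + rc m1 * 'i) l m2.
Proof.
move=> l0 m10 m20 Gc; have m0 : 0 <= m1 + m2 by rewrite addr_ge0.
have G1 : cont_rect z l m1 by move=> w /(sub_rect_v1 m20); exact: Gc.
have G2 : cont_rect (z + rc m1 * 'i) l m2 by move=> w /(sub_rect_v2 m10); exact: Gc.
have cv := cont_v l0 m0 Gc.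
have m1b : 0 <= m1 <= m1 + m2 by rewrite m10 lerDl.
rewrite /rint (cint_split m1b cv).
have -> : cint m1 (m1 + m2) (fun t => G (z + rc l + rc t * 'i) - G (z + rc t * 'i)) =
    cint 0 m2 (fun t => G (z + rc m1 * 'i + rc l + rc t * 'i) - G (z + rc m1 * 'i + rc t * 'i)).
  have := @cint_shift 0 m2 m1 (fun t => G (z + rc l + rc t * 'i) - G (z + rc t * 'i)) m20.
  rewrite add0r (addrC m2) => ->.
    by apply: eq_cint => t _; rewrite rcD; congr (G _ - G _); ring.
  move=> t /andP[t0 t1]; apply: cv.
  by rewrite t1 (le_trans m10).
have -> : cint 0 l (fun s => G (z + rc s) - G (z + rc (m1 + m2) * 'i + rc s)) =
    cint 0 l (fun s => G (z + rc s) - G (z + rc m1 * 'i + rc s)) +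
    cint 0 l (fun s => G (z + rc m1 * 'i + rc s) - G (z + rc m1 * 'i + rc m2 * 'i + rc s)).
  rewrite -cintD; [|exact: cont_h|exact: cont_h].
  by apply: eq_cint => t _; rewrite rcD mulrDl addrA; ring.
by ring.
Qed.

(** The boundary integral of an affine function is 0, by direct computation, so
    only the distance of [G] to such a function contributes. *)
Lemma rint_affine_bound (z : CC) (l m e : RR) (A B : CC) : 0 <= l -> 0 <= m ->
  cont_rect z l m -> (forall w, inrect z l m w -> `|G w - (A + B * w)| <= rc e) ->
  `|rint G z l m| <= rc (4%:R * e * (l + m)).
Proof.
move=> l0 m0 Gc Ge; pose H w := G w - (A + B * w).
have ch := cont_h l0 m0 Gc; have cv := cont_v l0 m0 Gc.
have hc : cont_on (fun s => H (z + rc s) - H (z + rc m * 'i + rc s)) 0 l.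
  rewrite (_ : (fun s => _) =
      fun s => G (z + rc s) - G (z + rc m * 'i + rc s) + B * 'i * rc m).
    exact: (cont_onD ch (@cont_on_cst (B * 'i * rc m) 0 l)).
  by apply/funext => t; rewrite /H; ring.
have vc : cont_on (fun t => H (z + rc l + rc t * 'i) - H (z + rc t * 'i)) 0 m.
  rewrite (_ : (fun t => _) =
      fun t => G (z + rc l + rc t * 'i) - G (z + rc t * 'i) + - (B * rc l)).
    exact: (cont_onD cv (@cont_on_cst (- (B * rc l)) 0 m)).
  by apply/funext => t; rewrite /H; ring.
have Eh : cint 0 l (fun s => G (z + rc s) - G (z + rc m * 'i + rc s)) =
    cint 0 l (fun s => H (z + rc s) - H (z + rc m * 'i + rc s)) - B * 'i * rc m * rc l.
  have -> : - (B * 'i * rc m * rc l) = cint 0 l (fun=> - (B * 'i * rc m)).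
    by rewrite cint_cst // subr0; ring.
  rewrite -(cintD hc (@cont_on_cst (- (B * 'i * rc m)) 0 l)).
  by apply: eq_cint => t _; rewrite /H; ring.
have Ev : cint 0 m (fun t => G (z + rc l + rc t * 'i) - G (z + rc t * 'i)) =
    cint 0 m (fun t => H (z + rc l + rc t * 'i) - H (z + rc t * 'i)) + B * rc l * rc m.
  have -> : B * rc l * rc m = cint 0 m (fun=> B * rc l).
    by rewrite cint_cst // subr0.
  rewrite -(cintD vc (@cont_on_cst (B * rc l) 0 m)).
  by apply: eq_cint => t _; rewrite /H; ring.
rewrite /rint Eh Ev.
set I1 := cint 0 l _; set I2 := cint 0 m _.
rewrite (_ : _ + _ = I1 + 'i * I2); last by ring.
have H2 w w' : inrect z l m w -> inrect z l m w' -> `|H w - H w'| <= rc (e *+ 2).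
  move=> iw iw'; rewrite mulr2n rcD (le_trans (ler_normB _ _)) // lerD //; exact: Ge.
have b1 : `|I1| <= rc (4%:R * e * l).
  have -> : 4%:R * e * l = e *+ 2 * (l - 0) *+ 2 by ring.
  apply: cint_bound => //.
  move=> t tl; apply: H2.
    have -> : z + rc t = z + rc t + rc 0 * 'i by rewrite rc0 mul0r addr0.
    by apply: inrect_corner; rewrite ?lexx.
  by rewrite addrAC; apply: inrect_corner; rewrite ?lexx ?m0.
have b2 : `|I2| <= rc (4%:R * e * m).
  have -> : 4%:R * e * m = e *+ 2 * (m - 0) *+ 2 by ring.
  apply: cint_bound => //.
  move=> t tm; apply: H2.
    by apply: inrect_corner; rewrite ?lexx ?l0.
  have -> : z + rc t * 'i = z + rc 0 + rc t * 'i by rewrite rc0 addr0.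
  by apply: inrect_corner; rewrite ?lexx ?l0.
rewrite (le_trans (ler_normD _ _)) // mulrDr rcD lerD //.
by rewrite normrM normCi mul1r.
Qed.

End Rectangle.

(** * Goursat's theorem *)

Section Goursat.
Variable G : CC -> CC.

(** The negation of the bound to be proved. The square of [l + m] is divided by 4
    when the rectangle is cut into four, so if the bound holds on the four parts
    then it holds on the whole. *)
Definition exceeds (E : RR) (l m : RR) (z : CC) : bool :=
  ~~ (`|rint G z l m| <= rc (E * (l + m) ^+ 2)).

(** The corner of a quarter on which the bound fails, if it fails on the whole. *)
Definition next_corner (E : RR) (l m : RR) (z : CC) : CC :=
  let q := exceeds E (l / 2) (m / 2) in
  if q z then z else
  if q (z + rc (l / 2)) then z + rc (l / 2) else
  if q (z + rc (m / 2) * 'i) then z + rc (m / 2) * 'i else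
  z + rc (m / 2) * 'i + rc (l / 2).

Lemma half_ge0 (x : RR) : 0 <= x -> 0 <= x / 2.
Proof. by move=> x0; rewrite divr_ge0. Qed.

Lemma next_corner_sub (E l m : RR) (z : CC) : 0 <= l -> 0 <= m ->
  forall w, inrect (next_corner E l m z) (l / 2) (m / 2) w -> inrect z l m w.
Proof.
move=> /half_ge0 l0 /half_ge0 m0 w H; rewrite (splitr l) (splitr m).
move: H; rewrite /next_corner; case: ifP => _; last case: ifP => _; last case: ifP => _.
- by move=> /(sub_rect_h1 l0) /(sub_rect_v1 m0).
- by move=> /(sub_rect_h2 l0) /(sub_rect_v1 m0).
- by move=> /(sub_rect_h1 l0) /(sub_rect_v2 m0).
- by move=> /(sub_rect_h2 l0) /(sub_rect_v2 m0).
Qed.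

Lemma next_corner_exceeds (E l m : RR) (z : CC) : 0 <= l -> 0 <= m ->
  cont_rect G z l m -> exceeds E l m z ->
  exceeds E (l / 2) (m / 2) (next_corner E l m z).
Proof.
move=> /half_ge0 l0 /half_ge0 m0 Gc bz; rewrite /next_corner.
case: ifP => [//|/negbFE b1]; case: ifP => [//|/negbFE b2].
case: ifP => [//|/negbFE b3]; apply/negP => b4; move/negP : bz; apply.
rewrite (splitr l) (splitr m) in Gc.
rewrite [X in rint G z X m](splitr l) [X in rint G z _ X](splitr m).
rewrite rint_vsplit ?addr_ge0 // rint_hsplit //; last first.
  by move=> w /(sub_rect_v1 m0); exact: Gc.
rewrite rint_hsplit //; last first.
  by move=> w /(sub_rect_v2 m0); exact: Gc.
have -> : E * (l + m) ^+ 2 = E * (l / 2 + m / 2) ^+ 2 + E * (l / 2 + m / 2) ^+ 2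
    + (E * (l / 2 + m / 2) ^+ 2 + E * (l / 2 + m / 2) ^+ 2) by field.
rewrite !rcD; apply: (le_trans (ler_normD _ _)); apply: lerD.
  by apply: (le_trans (ler_normD _ _)); exact: lerD.
by apply: (le_trans (ler_normD _ _)); exact: lerD.
Qed.

Fixpoint corner (E l m : RR) (z : CC) (n : nat) : CC :=
  if n is k.+1 then next_corner E (l / 2 ^+ k) (m / 2 ^+ k) (corner E l m z k)
  else z.

Lemma corner_sub (E l m : RR) (z : CC) (n k : nat) : 0 <= l -> 0 <= m ->
  forall w, inrect (corner E l m z (n + k)) (l / 2 ^+ (n + k)) (m / 2 ^+ (n + k)) w ->
  inrect (corner E l m z n) (l / 2 ^+ n) (m / 2 ^+ n) w.
Proof.
move=> l0 m0; elim: k => [|k IH] w; first by rewrite addn0.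
rewrite addnS /= => H; apply: IH; move: H.
rewrite exprS !invfM (mulrA l) (mulrA m) !(mulrAC _ 2^-1).
by apply: next_corner_sub; rewrite divr_ge0 // exprn_ge0.
Qed.

Lemma corner_exceeds (E l m : RR) (z : CC) (n : nat) : 0 <= l -> 0 <= m ->
  cont_rect G z l m -> exceeds E l m z ->
  exceeds E (l / 2 ^+ n) (m / 2 ^+ n) (corner E l m z n).
Proof.
move=> l0 m0 Gc bz; elim: n => [|n IH]; first by rewrite expr0 !divr1.
rewrite exprS !invfM (mulrA l) (mulrA m) !(mulrAC _ 2^-1) /=.
apply: next_corner_exceeds; rewrite ?divr_ge0 ?exprn_ge0 //.
move=> w H; apply: Gc.
have := @corner_sub E l m z 0 n l0 m0 w; rewrite add0n expr0 !divr1; exact.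
Qed.

Lemma inrect_self (z : CC) (l m : RR) : 0 <= l -> 0 <= m -> inrect z l m z.
Proof. by move=> l0 m0; rewrite /inrect !lexx !lerDl l0 m0. Qed.

Lemma inrect_closed (z L : CC) (l m : RR) (u : nat -> CC) :
  (forall n, inrect z l m (u n)) -> tends u L -> inrect z l m L.
Proof.
move=> uz uL.
have key (f : CC -> RR) : (forall v w, rc `|f v - f w| <= `|v - w|) ->
    forall a b, (forall n, a <= f (u n) <= b) -> a <= f L <= b.
  move=> fv a b H; apply/andP; split; apply/ler_addgt0Pr => e e0.
    have [N /(_ N (leqnn N)) hN] := uL (rc e) ltac:(by rewrite rc_gt0).
    have := le_trans (fv _ _) hN; rewrite ler_rc ler_distl => /andP[h1 h2].
    by case/andP: (H N) => h3 h4; rewrite (le_trans h3) // -lerBlDr.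
  have [N /(_ N (leqnn N)) hN] := uL (rc e) ltac:(by rewrite rc_gt0).
  have := le_trans (fv _ _) hN; rewrite ler_rc ler_distl => /andP[h1 h2].
  by case/andP: (H N) => h3 h4; rewrite (le_trans h2) // lerD2r.
split.
  refine (key (fun v => complex.Re v) _ (complex.Re z) (complex.Re z + l) _).
    by move=> v w; rewrite -raddfB normC_ge_Re.
  by move=> n; case: (uz n).
refine (key (fun v => complex.Im v) _ (complex.Im z) (complex.Im z + m) _).
  by move=> v w; rewrite -raddfB normC_ge_Im.
by move=> n; case: (uz n).
Qed.

(** If the boundary integral were not 0, it would exceed some multiple of the
    squared size of the rectangle. Quartering yields nested rectangles with the
    same property that shrink to a point, near which [G] is affine up to an error
    that is small compared with the size: [rint_affine_bound] contradicts this. *)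
Lemma goursat (z : CC) (l m : RR) : 0 <= l -> 0 <= m ->
  (forall w, inrect z l m w -> hol G w) -> rint G z l m = 0.
Proof.
move=> l0 m0 Gh.
have Gc : cont_rect G z l m by move=> w /Gh; exact: hol_cont.
have lm0 : 0 <= l + m by rewrite addr_ge0.
suff small (E : RR) : 0 < E -> `|rint G z l m| <= rc (E * (l + m) ^+ 2).
  apply/eqP; rewrite -normr_le0; apply/ler_addgt0Pr => e e0; rewrite add0r.
  have e0' : 0 < complex.Re e by rewrite -rc_gt0 -rcE // gtr0_real.
  have K0 : 0 < (l + m) ^+ 2 + 1 by rewrite ltr_wpDl // exprn_ge0.
  rewrite (le_trans (small _ (divr_gt0 e0' K0))) //.
  rewrite [leRHS]rcE ?gtr0_real // ler_rc mulrAC ler_pdivrMr //.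
  by rewrite ler_pM2l // lerDl.
move=> E0; apply/negPn/negP => bz.
pose zn := corner E l m z.
pose ln n := l / 2 ^+ n; pose mn n := m / 2 ^+ n.
have ln0 n : 0 <= ln n by rewrite divr_ge0 // exprn_ge0.
have mn0 n : 0 <= mn n by rewrite divr_ge0 // exprn_ge0.
have znk n k : inrect (zn n) (ln n) (mn n) (zn (n + k)%N).
  by apply: (@corner_sub E l m z n k l0 m0); apply: inrect_self; [exact: ln0|exact: mn0].
have lmn n : ln n + mn n = (l + m) / 2 ^+ n by rewrite -mulrDl.
have [L LP] : exists L, tends zn L.
  apply: (@geometric_cvg _ (rc (l + m)) (rc (2^-1))).
    by rewrite rc_ge0 invr_ge0 ler0n /= -rc1 ltr_rc invf_lt1 ?ltr1n.
  move=> N; have := inrect_dist (znk N 1%N); rewrite addn1 lmn.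
  suff <- : rc (l + m) * rc 2^-1 ^+ N = rc ((l + m) / 2 ^+ N) by [].
  by rewrite -exprVn rcM /rc rmorphXn.
have Ln n : inrect (zn n) (ln n) (mn n) L.
  apply: (@inrect_closed _ _ _ _ (fun k => zn (n + k)%N)) => // e /LP[N0 N0P].
  by exists N0 => N h; apply: N0P; rewrite (leq_trans h) // leq_addl.
have LR : inrect z l m L by have := Ln 0%N; rewrite /ln /mn expr0 !divr1.
have [D DP] := Gh _ LR.
(* [rint_affine_bound] costs a factor 4 and [dist] a factor 2 *)
have e0 : 0 < E / 16%:R by rewrite divr_gt0.
have [d d0 dP] := DP (rc (E / 16%:R)) ltac:(by rewrite rc_gt0).
have d0' : 0 < complex.Re d by rewrite -rc_gt0 -rcE // gtr0_real.
have [n nP] : exists n, (1 / 2 : RR) ^+ n < complex.Re d / (2%:R * (l + m) + 1).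
  apply: exprn_small; last by rewrite divr_gt0 // ltr_wpDl // mulr_ge0.
  by rewrite mul1r invr_ge0 ler0n /= invf_lt1 ?ltr1n.
have dist w : inrect (zn n) (ln n) (mn n) w -> `|w - L| <= rc (2%:R * (ln n + mn n)).
  move=> wr; rewrite (_ : w - L = (w - zn n) - (L - zn n)); last by ring.
  rewrite mulr_natl mulr2n rcD (le_trans (ler_normB _ _)) // lerD //.
    exact: inrect_dist.
  exact: inrect_dist.
have := @corner_exceeds E l m z n l0 m0 Gc bz; move/negP; apply.
have cr : cont_rect G (zn n) (ln n) (mn n).
  move=> w H; apply: Gc; have := @corner_sub E l m z 0 n l0 m0 w.
  by rewrite add0n expr0 !divr1; exact.
have -> : E * (l / 2 ^+ n + m / 2 ^+ n) ^+ 2 =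
  4%:R * (E / 8%:R * (ln n + mn n)) * (ln n + mn n) *+ 2 by rewrite -/(ln n) -/(mn n); field.
rewrite mulr2n rcD ler_wpDr //.
  by rewrite rc_ge0 !mulr_ge0 // ?addr_ge0 // ltW.
apply: (@rint_affine_bound G _ _ _ _ (G L - D * L) D); [exact: ln0|exact: mn0|exact: cr|].
move=> w wr.
have wL := dist w wr.
rewrite (_ : G w - _ = G (L + (w - L)) - G L - D * (w - L)); last first.
  by rewrite (_ : L + (w - L) = w); ring.
apply: le_trans (dP _ _) _.
  rewrite (le_lt_trans wL) // [ltRHS]rcE ?gtr0_real // ltr_rc lmn.
  move: nP; rewrite ltr_pdivlMr; last by rewrite ltr_wpDl // mulr_ge0.
  rewrite mul1r exprVn => /(le_lt_trans _); apply.
  rewrite (_ : _^-1 * _ = 2%:R * ((l + m) / 2 ^+ n) + (2 ^+ n)^-1); last by ring.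
  by rewrite lerDl invr_ge0 exprn_ge0.
apply: (le_trans (ler_wpM2l _ wL)); first by rewrite rc_ge0 ltW.
by rewrite -rcM (_ : E / 16%:R * (2%:R * (ln n + mn n)) = E / 8%:R * (ln n + mn n)) //; field.
Qed.

End Goursat.

(** Goursat's theorem with an exceptional point at which [G] is only continuous:
    four cuts isolate a square of side [2 * k] around [b]; the other parts
    contribute 0, and the square contributes at most a multiple of [k]. *)
Lemma goursat_point (G : CC -> CC) (z b : CC) (l m : RR) :
  complex.Re z < complex.Re b < complex.Re z + l ->
  complex.Im z < complex.Im b < complex.Im z + m ->
  cont_rect G z l m ->
  (forall w, inrect z l m w -> w != b -> hol G w) -> rint G z l m = 0.
Proof.
move=> /andP[b1 b2] /andP[b3 b4] Gc Gh.
apply/eqP; rewrite -normr_le0; apply/ler_addgt0Pr => e e0; rewrite add0r.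
have e0' : 0 < complex.Re e by rewrite -rc_gt0 -rcE // gtr0_real.
have br : inrect z l m b by split; rewrite ltW //= ltW.
have /cvgrPdist_le /(_ 1 ltr01) /nbhs_ballP[d /= d0 dP] := Gc _ br.
have d0' : 0 < complex.Re d by rewrite -rc_gt0 -rcE // gtr0_real.
have [k [k0 [k1 [k2 [k3 [k4 [k5 k6]]]]]]] : exists k : RR, 0 < k /\
    k <= complex.Re b - complex.Re z /\ k <= complex.Re z + l - complex.Re b /\
    k <= complex.Im b - complex.Im z /\ k <= complex.Im z + m - complex.Im b /\
    k *+ 8 < complex.Re d /\ k *+ 16 <= complex.Re e.
  set x1 := complex.Re b - _; set x2 := _ - complex.Re b.
  set x3 := complex.Im b - _; set x4 := _ - complex.Im b.
  have x10 : 0 < x1 by rewrite subr_gt0.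
  have x20 : 0 < x2 by rewrite subr_gt0.
  have x30 : 0 < x3 by rewrite subr_gt0.
  have x40 : 0 < x4 by rewrite subr_gt0.
  (* the square fits into the rectangle, [G] varies by at most 1 on it, and its
     contribution is at most [16 * k] *)
  exists (Num.min (Num.min x1 x2) (Num.min (Num.min x3 x4)
      (Num.min (complex.Re d / 16) (complex.Re e / 16)))).
  set k := Num.min _ _.
  have [p1 p2] : k <= x1 /\ k <= x2 by split; rewrite /k !ge_min lexx ?orbT.
  have [p3 p4] : k <= x3 /\ k <= x4 by split; rewrite /k !ge_min lexx ?orbT.
  have [p5 p6] : k <= complex.Re d / 16 /\ k <= complex.Re e / 16.
    by split; rewrite /k !ge_min lexx ?orbT.
  have p0 : 0 < k by rewrite /k !lt_min x10 x20 x30 x40 !divr_gt0.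
  do !split => //; last by rewrite -mulr_natr -ler_pdivlMr.
  rewrite -mulr_natr -ltr_pdivlMr // (le_lt_trans p5) //.
  by rewrite ltr_pM2l // ltf_pV2 ?posrE ?ltr_nat.
have lE : l = (complex.Re b - complex.Re z - k) +
    (k *+ 2 + (complex.Re z + l - complex.Re b - k)) by ring.
have mE : m = (complex.Im b - complex.Im z - k) +
    (k *+ 2 + (complex.Im z + m - complex.Im b - k)) by ring.
move: lE mE.
set l1 := (_ - k); set l3 := (_ - k); set m1 := (_ - k); set m3 := (_ - k) => lE mE.
have l10 : 0 <= l1 by rewrite subr_ge0.
have l30 : 0 <= l3 by rewrite subr_ge0.
have m10 : 0 <= m1 by rewrite subr_ge0.
have m30 : 0 <= m3 by rewrite subr_ge0.
have k20 : 0 <= k *+ 2 by rewrite mulrn_wge0 // ltW.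
have m0 : 0 <= m by rewrite mE; do 2!apply: addr_ge0 => //.
pose z1 := z + rc l1; pose z2 := z1 + rc m1 * 'i.
have s0 w : inrect z l1 m w -> inrect z l m w.
  by move=> H; rewrite [X in inrect z X]lE; apply: sub_rect_h1 H; rewrite addr_ge0.
have s1 w : inrect z1 (k *+ 2 + l3) m w -> inrect z l m w.
  by move=> H; rewrite [X in inrect z X]lE; exact: sub_rect_h2 H.
have s2 w : inrect z1 (k *+ 2) m w -> inrect z l m w.
  by move=> H; apply: s1; apply: sub_rect_h1 H.
have s3 w : inrect (z1 + rc (k *+ 2)) l3 m w -> inrect z l m w.
  by move=> H; apply: s1; apply: sub_rect_h2 H.
have s4 w : inrect z1 (k *+ 2) m1 w -> inrect z l m w.
  by move=> H; apply: s2; rewrite mE; apply: sub_rect_v1 H; rewrite addr_ge0.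
have s5 w : inrect z2 (k *+ 2) (k *+ 2 + m3) w -> inrect z l m w.
  by move=> H; apply: s2; rewrite mE; apply: sub_rect_v2 H.
have s6 w : inrect z2 (k *+ 2) (k *+ 2) w -> inrect z l m w.
  by move=> H; apply: s5; apply: sub_rect_v1 H.
have s7 w : inrect (z2 + rc (k *+ 2) * 'i) (k *+ 2) m3 w -> inrect z l m w.
  by move=> H; apply: s5; apply: sub_rect_v2 H.
have split1 : rint G z l m = rint G z l1 m + rint G z1 (k *+ 2 + l3) m.
  by rewrite [X in rint G z X]lE; apply: rint_hsplit => //; [exact: addr_ge0|rewrite -lE].
have split2 : rint G z1 (k *+ 2 + l3) m =
    rint G z1 (k *+ 2) m + rint G (z1 + rc (k *+ 2)) l3 m.
  by apply: rint_hsplit => // w /s1; exact: Gc.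
have split3 : rint G z1 (k *+ 2) m =
    rint G z1 (k *+ 2) m1 + rint G z2 (k *+ 2) (k *+ 2 + m3).
  rewrite [X in rint G z1 _ X]mE; apply: rint_vsplit => //; first exact: addr_ge0.
  rewrite -mE.
  by move=> w /s2; exact: Gc.
have split4 : rint G z2 (k *+ 2) (k *+ 2 + m3) =
    rint G z2 (k *+ 2) (k *+ 2) + rint G (z2 + rc (k *+ 2) * 'i) (k *+ 2) m3.
  by apply: rint_vsplit => // w /s5; exact: Gc.
have Rz1 : complex.Re z1 = complex.Re b - k by rewrite ReD Re_rc /l1; ring.
have Iz1 : complex.Im z1 = complex.Im z by rewrite ImD Im_rc addr0.
have Iz2 : complex.Im z2 = complex.Im b - k by rewrite ImD Im_rci Iz1 /m1; ring.
rewrite split1 split2 split3 split4.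
rewrite (@goursat G z l1 m) //; last first.
  move=> w H; apply: Gh; first exact: s0.
  apply/eqP => wb; move: H; rewrite wb => -[/andP[_]].
  by rewrite /l1 leNgt (_ : _ + _ = complex.Re b - k :> RR) ?gtrBl ?k0 //; ring.
rewrite (@goursat G (z1 + rc (k *+ 2)) l3 m) //; last first.
  move=> w H; apply: Gh; first exact: s3.
  apply/eqP => wb; move: H; rewrite wb => -[/andP[+ _] _].
  rewrite ReD Re_rc Rz1 leNgt (_ : _ + _ = complex.Re b + k :> RR) ?ltrDl ?k0 //.
  by rewrite mulr2n; ring.
rewrite (@goursat G z1 (k *+ 2) m1) //; last first.
  move=> w H; apply: Gh; first exact: s4.
  apply/eqP => wb; move: H; rewrite wb => -[_ /andP[_]].
  by rewrite Iz1 /m1 leNgt (_ : _ + _ = complex.Im b - k :> RR) ?gtrBl ?k0 //; ring.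
rewrite (@goursat G (z2 + rc (k *+ 2) * 'i) (k *+ 2) m3) //; last first.
  move=> w H; apply: Gh; first exact: s7.
  apply/eqP => wb; move: H; rewrite wb => -[_ /andP[+ _]].
  rewrite ImD Im_rci Iz2 leNgt (_ : _ + _ = complex.Im b + k :> RR) ?ltrDl ?k0 //.
  by rewrite mulr2n; ring.
rewrite !add0r !addr0 [leRHS]rcE ?gtr0_real //.
apply: (@le_trans _ _ (rc (4%:R * 1 * (k *+ 2 + k *+ 2)))); last first.
  by rewrite ler_rc (le_trans _ k6) // le_eqVlt; apply/orP; left; apply/eqP; ring.
apply: (@rint_affine_bound G _ _ _ _ (G b) 0) => // [w /s6|w H]; first exact: Gc.
rewrite mul0r addr0 distrC; apply: dP; rewrite -ball_normE /ball_ /=.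
have br2 : inrect z2 (k *+ 2) (k *+ 2) b.
  rewrite /inrect Iz2 ReD Re_rci addr0 Rz1 !gerBl ltW //=.
  by rewrite -!addrA !lerDl mulr2n addKr ltW.
rewrite (_ : b - w = (b - z2) - (w - z2)); last by ring.
apply: (le_lt_trans (ler_normB _ _)).
apply: (@le_lt_trans _ _ (rc (k *+ 8))); last by rewrite [ltRHS]rcE ?gtr0_real // ltr_rc.
have -> : k *+ 8 = (k *+ 2 + k *+ 2) + (k *+ 2 + k *+ 2) by ring.
by rewrite rcD lerD // inrect_dist.
Qed.

(** * The complex exponential *)

Lemma real_derive0_eps (K : realType) (f : K -> K) (D : K) :
  is_derive (0 : K) (1 : K) f D -> forall e : K, 0 < e -> exists2 d : K, 0 < d &
    forall h, `|h| < d -> `|f h - f 0 - D * h| <= e * `|h|.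
Proof.
move=> [fd fD] e e0.
have : (h^-1 *: ((f \o shift 0) (h *: 1) - f 0) @[h --> 0^'] --> D)%classic.
  by rewrite -fD; exact: fd.
move=> /cvgrPdist_le /(_ e e0).
rewrite near_withinE => /nbhs_ballP[d /= d0 dP]; exists d => // h hd.
have [->|h0] := eqVneq h 0; first by rewrite mulr0 subrr subr0 normr0 mulr0.
have := dP h; rewrite -ball_normE /ball_ /= sub0r normrN => /(_ hd h0).
rewrite addr0 [_%:A](mulr1 h) => dP'.
have nh : 0 < `|h| by rewrite normr_gt0.
rewrite -ler_pdivrMr // -normfV -normrM.
rewrite (_ : _ * _ = - (D - h^-1 * (f h - f 0))) ?normrN //.
by field.
Qed.

(** The exponential carries vertical segments of length [2 * pi] to circles and
    rectangles to annuli, which reduces integrals over circles to [goursat]. *)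
Definition cexp (z : CC) : CC :=
  (expR (complex.Re z : RR) * cos (complex.Im z : RR) +i*
   (expR (complex.Re z : RR) * sin (complex.Im z : RR)))%C.

Lemma cexpD (z w : CC) : cexp (z + w) = cexp z * cexp w.
Proof.
rewrite /cexp ReD ImD (@exp.expRD RR) (@trigo.cosD RR) (@trigo.sinD RR).
by rewrite [RHS]/GRing.mul /=; congr (_ +i* _)%C; ring.
Qed.

Lemma norm_cexp (z : CC) : `|cexp z| = rc (expR (complex.Re z : RR)).
Proof.
rewrite normc_def /= !exprMn -mulrDr (@cos2Dsin2 RR) mulr1 sqrtr_sqr ger0_norm //.
Qed.

Lemma cexp_neq0 (z : CC) : cexp z != 0.
Proof. by rewrite -normr_gt0 norm_cexp rc_gt0 expR_gt0. Qed.

Lemma cexp_surj (z : CC) : z != 0 -> exists w, cexp w = z.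
Proof.
move=> z0; set r : RR := complex.Re `|z|.
have rE : `|z| = rc r by rewrite /r -rcE // normr_real.
have r0 : 0 < r by rewrite -rc_gt0 -rE normr_gt0.
set c : RR := complex.Re z / r.
have zr : complex.Re z ^+ 2 + complex.Im z ^+ 2 = r ^+ 2.
  apply: complexI; rewrite add_Re2_Im2 rE /rc -rmorphXn //.
have c1 : -1 <= c <= 1.
  rewrite -ler_norml /c normrM normfV (gtr0_norm r0) ler_pdivrMr // mul1r.
  by rewrite -ler_rc -rE normC_ge_Re.
have sE : Num.sqrt (1 - c ^+ 2) = `|complex.Im z| / r.
  rewrite (_ : 1 - c ^+ 2 = (complex.Im z / r) ^+ 2).
    by rewrite sqrtr_sqr normrM normfV (gtr0_norm r0).
  rewrite /c !expr_div_n -(divff (x := r ^+ 2)) ?expf_neq0 ?gt_eqF // -mulrBl -zr.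
  by congr (_ / _); ring.
have key (s : RR) : `|s| = 1 -> s * `|complex.Im z| = complex.Im z ->
    exists w, cexp w = z.
  move=> s1 sz; exists (ln r +i* (s * acos c))%C; rewrite /cexp /= lnK //.
  have cE : cos (s * acos c) = c.
    case: (ger0P s) s1 => _ s1; first by rewrite s1 mul1r acosK.
    by rewrite -[s]opprK s1 mulN1r (@cosN RR) acosK.
  have snE : sin (s * acos c) = complex.Im z / r.
    rewrite -sz -mulrA -sE -(sin_acos c1).
    case: (ger0P s) s1 => _ s1; first by rewrite s1 !mul1r.
    by rewrite -[s]opprK s1 !mulN1r (@sinN RR).
  rewrite cE snE /c !(mulrC r) !divfK ?gt_eqF //.
  by case: (z).
have [i0|i0] := leP 0 (complex.Im z).
  by apply: (key 1); rewrite ?normr1 // mul1r ger0_norm.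
by apply: (key (-1)); rewrite ?normrN1 // mulN1r ltr0_norm // opprK.
Qed.

Lemma cexp_eq1 (z : CC) : cexp z = 1 -> `|complex.Im z : RR| <= pi -> z = 0.
Proof.
move=> E zpi.
have r0 : complex.Re z = 0.
  have : rc (expR (complex.Re z : RR)) = rc 1 by rewrite -norm_cexp E normr1.
  by move=> [e1]; apply: (@expR_inj RR); rewrite e1 (@exp.expR0 RR).
move: E; rewrite /cexp r0 (@exp.expR0 RR) !mul1r => -[c1 _].
suff i0 : complex.Im z = 0 by apply/eqP; rewrite eq_complex r0 i0 !eqxx.
apply/eqP; rewrite -normr_eq0; apply/eqP.
apply: (@cos_inj RR); rewrite ?in_itv /= ?normr_ge0 ?lexx ?pi_ge0 //.
by rewrite cos_norm c1 (@trigo.cos0 RR).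
Qed.

Lemma cexp_periodic (z : CC) : cexp (z + rc (pi *+ 2) * 'i) = cexp z.
Proof.
rewrite /cexp ReD ImD Re_rci Im_rci addr0.
by rewrite (@cosD2pi RR) (@sinD2pi RR).
Qed.

(** By [cexpD] it suffices to consider the point 0, where the estimate is
    assembled from the derivatives of [expR], [cos] and [sin]. *)
Lemma cexp_hol (z : CC) : hol cexp z.
Proof.
suff h0 : forall e : CC, 0 < e -> exists2 d : CC, 0 < d &
    forall h, `|h| < d -> `|cexp h - 1 - h| <= e * `|h|.
  exists (cexp z) => e e0.
  have nz : 0 < `|cexp z| by rewrite normr_gt0 cexp_neq0.
  have [d d0 dP] := h0 _ (divr_gt0 e0 nz); exists d => // h hd.
  rewrite cexpD (_ : _ - _ = cexp z * (cexp h - 1 - h)); last by ring.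
  rewrite normrM mulrC -ler_pdivlMr // mulrAC; exact: dP.
move=> e e0.
set e' : RR := complex.Re e.
have eE : e = rc e' by rewrite /e' -rcE // gtr0_real.
have e0' : 0 < e' by rewrite -rc_gt0 -eE.
pose k := Num.min 1 (e' / 8).
have k0 : 0 < k by rewrite lt_min ltr01 divr_gt0.
have k1 : k <= 1 by rewrite ge_min lexx.
have k8 : k * 8 <= e' by rewrite -ler_pdivlMr // ge_min lexx orbT.
have [d1 d10 E1] := real_derive0_eps (@is_derive_expR RR 0) k0.
have [d2 d20 E2] := real_derive0_eps (@is_derive_cos RR 0) k0.
have [d3 d30 E3] := real_derive0_eps (@is_derive_sin RR 0) k0.
exists (rc (Num.min (k / 2) (Num.min d1 (Num.min d2 d3)))).
  by rewrite rc_gt0 !lt_min divr_gt0 // d10 d20 d30.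
move=> h hd; set a : RR := complex.Re h; set b : RR := complex.Im h.
have nE : `|h| = rc (complex.Re `|h|) by rewrite -rcE // normr_real.
set n : RR := complex.Re `|h| in nE.
have an : `|a| <= n by rewrite -ler_rc -nE normC_ge_Re.
have bn : `|b| <= n by rewrite -ler_rc -nE normC_ge_Im.
have n0 : 0 <= n by apply: le_trans an.
rewrite nE ltr_rc !lt_min in hd.
case/and4P: hd => nk n1 n2 n3.
have {E1} := E1 a (le_lt_trans an n1).
have {E2} := E2 b (le_lt_trans bn n2).
have {E3} := E3 b (le_lt_trans bn n3).
rewrite (@exp.expR0 RR) (@trigo.cos0 RR) (@trigo.sin0 RR) !(oppr0, mul0r, addr0, mul1r).
set x := expR a; set c := cos b; set s := sin b => Es Ec Ex.
have kn : k * n <= n by rewrite ler_piMl.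
have Hx : `|x - 1 - a| <= k * n by rewrite (le_trans Ex) // ler_wpM2l // ltW.
have Hc : `|c - 1| <= k * n by rewrite (le_trans Ec) // ler_wpM2l // ltW.
have Hs : `|s - b| <= k * n by rewrite (le_trans Es) // ler_wpM2l // ltW.
rewrite eE nE -rcM.
apply: (le_trans (normC_le_ReIm _)); rewrite ler_rc.
have -> : complex.Re (cexp h - 1 - h) = (x - 1 - a) * c + (1 + a) * (c - 1).
  have E : x * c - 1 - a = (x - 1 - a) * c + (1 + a) * (c - 1) by ring.
  by rewrite !raddfB; exact: E.
have -> : complex.Im (cexp h - 1 - h) = (x - 1) * s + (s - b).
  have E : x * s - 0 - b = (x - 1) * s + (s - b) by ring.
  by rewrite !raddfB; exact: E.
have nk' : n * n <= n * (k / 2) by rewrite ler_wpM2l // ltW.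
have c2 : `|c| <= 2.
  rewrite (_ : c = (c - 1) + 1); last by ring.
  rewrite (le_trans (ler_normD _ _)) // normr1 (_ : 2 = 1 + 1 :> RR) // lerD2r.
  by rewrite (le_trans Hc) // (le_trans kn) // (le_trans (ltW nk)) //; lra.
have a2 : `|1 + a| <= 2.
  rewrite (le_trans (ler_normD _ _)) // normr1 (_ : 2 = 1 + 1 :> RR) // lerD2l.
  by rewrite (le_trans an) // (le_trans (ltW nk)) //; lra.
have s2 : `|s| <= n *+ 2.
  rewrite (_ : s = (s - b) + b); last by ring.
  by rewrite (le_trans (ler_normD _ _)) // mulr2n lerD // (le_trans Hs).
have x2 : `|x - 1| <= n *+ 2.
  rewrite (_ : x - 1 = (x - 1 - a) + a); last by ring.
  by rewrite (le_trans (ler_normD _ _)) // mulr2n lerD // (le_trans Hx).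
have P1 : `|(x - 1 - a) * c + (1 + a) * (c - 1)| <= k * n * 2 + 2 * (k * n).
  by rewrite (le_trans (ler_normD _ _)) // !normrM lerD // ler_pM.
have P2 : `|(x - 1) * s + (s - b)| <= n *+ 2 * (n *+ 2) + k * n.
  by rewrite (le_trans (ler_normD _ _)) // normrM lerD // ler_pM.
apply: (le_trans (lerD P1 P2)).
have k8n : k * 8 * n <= e' * n by rewrite ler_wpM2r.
nra.
Qed.

(** * Means over circles *)

Definition tau : RR := pi *+ 2.

Lemma tau_gt0 : 0 < tau.
Proof. by rewrite /tau mulrn_wgt0 // pi_gt0. Qed.

(** This is [2 * pi] times the mean value of [g] on the circle of radius [expR u];
    [v] is the angle at which the circle is entered. *)
Definition mean (g : CC -> CC) (u v : RR) : CC :=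
  cint 0 tau (fun t => g (cexp (rc u + rc v * 'i + rc t * 'i))).

Definition cont_circle (g : CC -> CC) (u : RR) : Prop :=
  forall z, `|z| = rc (expR u) -> {for z, continuous g}.

Lemma norm_cexp_line (u v t : RR) :
  `|cexp (rc u + rc v * 'i + rc t * 'i)| = rc (expR u).
Proof. by rewrite norm_cexp !ReD !Re_rci !addr0 Re_rc. Qed.

Lemma cont_cexp (g : CC -> CC) (w : CC) :
  {for cexp w, continuous g} -> {for w, continuous (fun w => g (cexp w))}.
Proof.
move=> gc; apply: (@continuous_comp _ _ _ cexp g) => //.
exact: hol_cont (cexp_hol w).
Qed.

Lemma mean_cont (g : CC -> CC) (u v t : RR) : cont_circle g u ->
  {for t, continuous (fun t => g (cexp (rc u + rc v * 'i + rc t * 'i)))}.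
Proof.
move=> gc; apply: (@cont_line (fun w => g (cexp w)) _ 'i t (normCi _)).
by apply: cont_cexp; apply: gc; rewrite norm_cexp_line.
Qed.

Lemma mean_cont_on (g : CC -> CC) (u v a b : RR) : cont_circle g u ->
  cont_on (fun t => g (cexp (rc u + rc v * 'i + rc t * 'i))) a b.
Proof. by move=> gc t _; exact: mean_cont. Qed.

Lemma eq_mean (f g : CC -> CC) (u v : RR) :
  (forall z, `|z| = rc (expR u) -> f z = g z) -> mean f u v = mean g u v.
Proof. by move=> fg; apply: eq_cint => t _; apply: fg; rewrite norm_cexp_line. Qed.

Lemma meanD (f g : CC -> CC) (u v : RR) : cont_circle f u -> cont_circle g u ->
  mean (fun z => f z + g z) u v = mean f u v + mean g u v.
Proof. by move=> fc gc; rewrite /mean -cintD //; exact: mean_cont_on. Qed.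

Lemma meanZ (k : CC) (f : CC -> CC) (u v : RR) : cont_circle f u ->
  mean (fun z => k * f z) u v = k * mean f u v.
Proof. by move=> fc; rewrite /mean -cintZ //; exact: mean_cont_on. Qed.

Lemma mean_cst (k : CC) (u v : RR) : mean (fun=> k) u v = k * rc tau.
Proof. by rewrite /mean cint_cst ?subr0 // ltW // tau_gt0. Qed.

Lemma mean_bound (g : CC -> CC) (u v M : RR) : cont_circle g u ->
  (forall z, `|z| = rc (expR u) -> `|g z| <= rc M) ->
  `|mean g u v| <= rc (M * tau *+ 2).
Proof.
move=> gc gM; have := @cint_bound 0 tau _ M (ltW tau_gt0) (@mean_cont_on g u v 0 tau gc).
rewrite subr0; apply => t _; apply: gM.
by rewrite norm_cexp_line.
Qed.

Lemma periodic_cint (f : RR -> CC) (T v : RR) : 0 <= T ->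
  (forall t, {for t, continuous f}) -> (forall t, f (t + T) = f t) ->
  cint 0 T (fun t => f (t + v)) = cint 0 T f.
Proof.
move=> T0; have pos (h : RR -> CC) (a : RR) : (forall t, {for t, continuous h}) ->
    (forall t, h (t + T) = h t) -> 0 <= a ->
    cint 0 T (fun t => h (t + a)) = cint 0 T h.
  move=> hc hT a0.
  have hco x y : cont_on h x y by move=> t _; exact: hc.
  have := @cint_shift 0 T a h T0 (hco _ _); rewrite add0r => <-.
  have s1 : 0 <= a <= T + a by rewrite a0 lerDr.
  have s2 : 0 <= T <= T + a by rewrite T0 lerDl.
  have := cint_split s1 (hco _ _); rewrite (cint_split s2 (hco _ _)).
  have := @cint_shift 0 a T h a0 (hco _ _); rewrite add0r [a + T]addrC => ->.
  rewrite (@eq_cint 0 a (fun t => h (t + T)) h) // => /eqP.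
  by rewrite addrC => /eqP /addrI.
move=> fc fT; have [v0|v0] := leP 0 v; first exact: pos.
have gc t : {for t, continuous (fun t => f (t + v))}.
  apply: (@continuous_comp _ _ _ (fun t => t + v) f); last exact: fc.
  by apply: cvgD; [exact: cvg_id|exact: cvg_cst].
have nv : 0 <= - v by rewrite oppr_ge0 ltW.
have gT t : f (t + T + v) = f (t + v) by rewrite addrAC fT.
have := pos (fun t => f (t + v)) (- v) gc gT nv.
by rewrite (@eq_cint 0 T (fun t => f (t - v + v)) f) // => t _; rewrite subrK.
Qed.

(** The integrand is periodic in the angle. *)
Lemma mean_shift (g : CC -> CC) (u v : RR) : cont_circle g u ->
  mean g u v = mean g u 0.
Proof.
move=> gc.
have := @periodic_cint (fun t => g (cexp (rc u + rc 0 * 'i + rc t * 'i))) tau v (ltW tau_gt0).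
rewrite /mean => <-.
- by apply: eq_cint => t _; rewrite rcD rc0 mul0r addr0; congr (g (cexp _)); ring.
- by move=> t; exact: mean_cont.
- by move=> t; rewrite rcD mulrDl addrA cexp_periodic.
Qed.

Lemma mean_rot (g : CC -> CC) (u v : RR) (w : CC) :
  mean (fun z => g (cexp w * z)) u v = mean g (u + complex.Re w) (v + complex.Im w).
Proof.
apply: eq_cint => t _; rewrite -cexpD; congr (g (cexp _)).
rewrite !rcD {1}(complexE w) complexiE; rewrite /rc; ring.
Qed.

Lemma inrect_annulus (u1 u2 v T : RR) (w : CC) :
  inrect (rc u1 + rc v * 'i) (u2 - u1) T w ->
  rc (expR u1) <= `|cexp w| <= rc (expR u2).
Proof.
move=> [+ _]; rewrite ReD Re_rci Re_rc addr0 subrKC => /andP[a b].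
by rewrite norm_cexp !ler_rc !(@ler_expR RR) a b.
Qed.

(** The horizontal sides of the rectangle have the same image under the
    exponential and cancel; the vertical sides are the two circles. *)
Lemma rint_mean (g : CC -> CC) (u1 u2 v : RR) : u1 <= u2 ->
  (forall z, rc (expR u1) <= `|z| <= rc (expR u2) -> {for z, continuous g}) ->
  rint (fun w => g (cexp w)) (rc u1 + rc v * 'i) (u2 - u1) tau =
  'i * (mean g u2 v - mean g u1 v).
Proof.
move=> u12 gc; have e12 : expR u1 <= expR u2 by rewrite (@ler_expR RR).
have c1 : cont_circle g u1 by move=> z zE; apply: gc; rewrite zE lexx ler_rc.
have c2 : cont_circle g u2 by move=> z zE; apply: gc; rewrite zE lexx andbT ler_rc.
rewrite /rint (@eq_cint 0 (u2 - u1) _ (fun=> 0)) => [|s _]; last first.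
  rewrite (_ : rc u1 + rc v * 'i + rc tau * 'i + rc s =
    rc u1 + rc v * 'i + rc s + rc tau * 'i) ?cexp_periodic ?subrr //.
  by ring.
rewrite cint_cst ?subr_ge0 // mul0r add0r; congr (_ * _).
have -> : mean g u2 v - mean g u1 v = mean g u2 v + (-1) * mean g u1 v by ring.
rewrite /mean -cintZ; last exact: mean_cont_on.
rewrite -cintD; [|exact: mean_cont_on|apply: cont_onZ; exact: mean_cont_on].
apply: eq_cint => t _; rewrite mulN1r; congr (g (cexp _) - _).
by rewrite rcB; ring.
Qed.

Lemma mean_eq (g : CC -> CC) (u1 u2 v : RR) : u1 <= u2 ->
  (forall z, rc (expR u1) <= `|z| <= rc (expR u2) -> hol g z) ->
  mean g u1 v = mean g u2 v.
Proof.
move=> u12 gh.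
have gc z : rc (expR u1) <= `|z| <= rc (expR u2) -> {for z, continuous g}.
  by move=> /gh; exact: hol_cont.
have := @rint_mean g u1 u2 v u12 gc; rewrite goursat ?subr_ge0 ?(ltW tau_gt0) //.
  by move/esym/eqP; rewrite mulf_eq0 (negPf (neq0Ci _)) subr_eq0 /= => /eqP.
by move=> w /inrect_annulus /gh; apply: hol_comp; exact: cexp_hol.
Qed.

(** The strip is started at the angle opposite to [w], so that [w] is the only
    point of the rectangle that is mapped to the exceptional point. *)
Lemma mean_eq_point (g : CC -> CC) (u1 u2 : RR) (w : CC) :
  u1 < complex.Re w < u2 ->
  (forall z, rc (expR u1) <= `|z| <= rc (expR u2) -> {for z, continuous g}) ->
  (forall z, rc (expR u1) <= `|z| <= rc (expR u2) -> z != cexp w -> hol g z) ->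
  mean g u1 0 = mean g u2 0.
Proof.
move=> /andP[w1 w2] gc gh; have u12 : u1 <= u2 by rewrite ltW // (lt_trans w1).
have e12 : expR u1 <= expR u2 by rewrite (@ler_expR RR).
have c1 : cont_circle g u1 by move=> z zE; apply: gc; rewrite zE lexx ler_rc.
have c2 : cont_circle g u2 by move=> z zE; apply: gc; rewrite zE lexx andbT ler_rc.
pose v : RR := complex.Im w - pi.
rewrite -(mean_shift v c1) -(mean_shift v c2).
have := @rint_mean g u1 u2 v u12 gc.
rewrite (@goursat_point _ _ w).
- by move/esym/eqP; rewrite mulf_eq0 (negPf (neq0Ci _)) subr_eq0 /= => /eqP.
- by rewrite ReD Re_rci Re_rc addr0 subrKC w1 w2.
- rewrite ImD Im_rci Im_rc add0r /v gtrBl (@pi_gt0 RR) /= -addrA ltrDl.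
  by rewrite /tau mulr2n addKr (@pi_gt0 RR).
- by move=> x /inrect_annulus h; apply: cont_cexp; exact: gc.
move=> x xr xw; apply: hol_comp; first exact: cexp_hol.
apply: gh; first exact: inrect_annulus xr.
apply: contra xw => /eqP E; rewrite -subr_eq0; apply/eqP; apply: cexp_eq1.
  apply: (mulIf (cexp_neq0 w)); rewrite -cexpD subrK mul1r //.
case: xr => _; rewrite ImD Im_rci Im_rc add0r /v => /andP[h1 h2].
rewrite raddfB ler_norml; apply/andP; split.
  by rewrite lerBrDl.
rewrite lerBlDl (le_trans h2) // /tau mulr2n addrA subrK //.
Qed.

(** * Cauchy's formula in an annulus *)

Lemma hol_local (f g : CC -> CC) (x d : CC) : 0 < d ->
  (forall h, `|h| < d -> f (x + h) = g (x + h)) -> hol g x -> hol f x.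
Proof.
move=> d0 fg [D DP]; exists D => e e0; have [d' d'0 dP] := DP e e0.
have rd : d \is Num.real by rewrite gtr0_real.
have rd' : d' \is Num.real by rewrite gtr0_real.
exists (rc (Num.min (complex.Re d : RR) (complex.Re d'))).
  by rewrite rc_gt0 lt_min -!rc_gt0 -!rcE // d0 d'0.
move=> h; have nE : `|h| = rc (complex.Re `|h|) by rewrite -rcE // normr_real.
rewrite nE ltr_rc lt_min -!ltr_rc -!rcE ?normr_real // => /andP[h1 h2].
have := fg 0; rewrite normr0 addr0 => /(_ d0) ->.
by rewrite fg // dP.
Qed.

Lemma eps_cont (f : CC -> CC) (x : CC) :
  (forall e : CC, 0 < e -> exists2 d : CC, 0 < d &
    forall z, `|x - z| < d -> `|f x - f z| <= e) -> {for x, continuous f}.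
Proof.
have FF := nbhs_filter x.
have [_ K] := @cvgrPdist_le _ _ _ _ FF f (f x).
move=> H; apply: K => e e0; have [d d0 dP] := H e e0.
by apply/nbhs_ballP; exists d => //= z; rewrite -ball_normE /ball_ /=; exact: dP.
Qed.

Lemma contM (f g : CC -> CC) (x : CC) : {for x, continuous f} ->
  {for x, continuous g} -> {for x, continuous (fun z : CC => f z * g z)}.
Proof. by move=> fx gx; exact: cvgM fx gx. Qed.

Lemma hol_slope (N : CC -> CC) (b z : CC) : z != b -> hol N z ->
  hol (fun z => (N z - N b) / (z - b)) z.
Proof.
move=> zb Nz; apply: holM; first by apply: holB => //; exact: hol_cst.
apply: holV; first by rewrite subr_eq0.
by apply: holB; [exact: hol_id|exact: hol_cst].
Qed.

Lemma cont_of_hol (f : CC -> CC) (u : RR) :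
  (forall z, `|z| = rc (expR u) -> hol f z) -> cont_circle f u.
Proof. by move=> fh z /fh; exact: hol_cont. Qed.

Lemma norm_small_eq0 (X : CC) : (forall e : RR, 0 < e -> `|X| <= rc e) -> X = 0.
Proof.
move=> H; apply/eqP; rewrite -normr_le0; apply/ler_addgt0Pr => e e0; rewrite add0r.
by rewrite [leRHS]rcE ?gtr0_real //; apply: H; rewrite -rc_gt0 -rcE // gtr0_real.
Qed.

Section Kernel.
Variable w : CC.
Let b : CC := cexp w.

Let sub_neq0 (z : CC) : `|z| != `|b| -> z - b != 0.
Proof. by rewrite subr_eq0; apply: contra => /eqP ->. Qed.

Let kernel_hol (z : CC) : `|z| != `|b| -> hol (fun z => z / (z - b)) z.
Proof.
move=> zb; apply: holM; first exact: hol_id.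
apply: holV; first exact: sub_neq0.
by apply: holB; [exact: hol_id|exact: hol_cst].
Qed.

(** The mean does not depend on the radius and tends to 0 with it. *)
Lemma kernel_mean_inside (u : RR) : u < complex.Re w ->
  mean (fun z => z / (z - b)) u 0 = 0.
Proof.
move=> uw; have euw : expR u < expR (complex.Re w : RR) by rewrite (@ltr_expR RR).
set c : RR := expR (complex.Re w : RR) - expR u.
have c0 : 0 < c by rewrite subr_gt0.
have nb : `|b| = rc (c + expR u) by rewrite norm_cexp subrK.
apply: norm_small_eq0 => e e0.
pose r := Num.min (expR u) (e * c / (tau *+ 2)).
have t2 : 0 < tau *+ 2 by rewrite mulrn_wgt0 // tau_gt0.
have r0 : 0 < r by rewrite lt_min (@expR_gt0 RR) !divr_gt0 // mulr_gt0.
have ru : expR (ln r) <= expR u by rewrite (@lnK RR) // ge_min lexx.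
have far z : `|z| <= rc (expR u) -> rc c <= `|z - b|.
  move=> zu; rewrite distrC (le_trans _ (lerB_dist _ _)) // nb lerBrDr rcD lerD2l.
  exact: zu.
have nzb z : `|z| <= rc (expR u) -> `|z| != `|b|.
  by move=> zu; rewrite lt_eqF // (le_lt_trans zu) // nb ltr_rc ltrDr.
rewrite -(@mean_eq _ (ln r) u 0); last first.
- by move=> z /andP[_ z2]; apply: kernel_hol; exact: nzb.
- by rewrite -(@ler_expR RR).
have := @mean_bound (fun z => z / (z - b)) (ln r) 0 (r / c).
rewrite (@lnK RR) // => H; apply: (le_trans (H _ _)).
- apply: cont_of_hol => z zE; apply: kernel_hol; apply: nzb.
  by rewrite zE ler_rc.
- move=> z zE; rewrite normrM normfV zE rcM.
  have zu : `|z| <= rc (expR u) by rewrite zE ler_rc -[r](@lnK RR).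
  have zb0 : 0 < `|z - b| by rewrite normr_gt0; apply: sub_neq0; exact: nzb.
  rewrite ler_pM2l ?rc_gt0 // rcV lef_pV2 ?posrE ?(rc_gt0 c) //.
  exact: far.
rewrite ler_rc -mulrnAr mulrAC ler_pdivrMr // -ler_pdivlMr //.
by rewrite ge_min lexx orbT.
Qed.

(** Since [z / (z - b) = 1 + b / (z - b)], and the mean of the second summand is
    independent of the radius and tends to 0 as the radius grows. *)
Lemma kernel_mean_outside (u : RR) : complex.Re w < u ->
  mean (fun z => z / (z - b)) u 0 = rc tau.
Proof.
move=> uw; have euw : expR (complex.Re w : RR) < expR u by rewrite (@ltr_expR RR).
set B : RR := expR (complex.Re w : RR).
have B0 : 0 < B by exact: expR_gt0.
have nb : `|b| = rc B by rewrite norm_cexp.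
have nzb z : rc (expR u) <= `|z| -> `|z| != `|b|.
  by move=> zu; rewrite gt_eqF // (lt_le_trans _ zu) // nb ltr_rc.
have k2 z : rc (expR u) <= `|z| -> hol (fun z => b / (z - b)) z.
  move=> zu; apply: holM; first exact: hol_cst.
  apply: holV; first by apply: sub_neq0; exact: nzb.
  by apply: holB; [exact: hol_id|exact: hol_cst].
rewrite (@eq_mean _ (fun z => 1 + b / (z - b))) => [|z zE]; last first.
  by field; apply: sub_neq0; apply: nzb; rewrite zE.
have c1 : cont_circle (fun=> 1) u by apply: cont_of_hol => z zE; exact: hol_cst.
have c2 : cont_circle (fun z => b / (z - b)) u.
  by apply: cont_of_hol => z zE; apply: k2; rewrite zE.
rewrite (meanD 0 c1 c2).
- rewrite mean_cst mul1r [X in _ + X](_ : _ = 0) ?addr0 //.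
  apply: norm_small_eq0 => e e0.
  have t2 : 0 < tau *+ 2 by rewrite mulrn_wgt0 // tau_gt0.
  pose r := expR u + B + B * (tau *+ 2) / e.
  have q0 : 0 < B * (tau *+ 2) / e by rewrite divr_gt0 // mulr_gt0.
  have r0 : 0 < r by rewrite !addr_gt0 ?(@expR_gt0 RR).
  have ru : expR u <= expR (ln r).
    by rewrite (@lnK RR) // /r -addrA lerDl ltW // addr_gt0.
  rewrite (@mean_eq _ u (ln r) 0); last first.
  + by move=> z /andP[z1 _]; exact: k2.
  + by rewrite -(@ler_expR RR).
  have := @mean_bound (fun z => b / (z - b)) (ln r) 0 (B / (B * (tau *+ 2) / e)).
  rewrite (@lnK RR) // => H; apply: (le_trans (H _ _)).
  + apply: cont_of_hol => z zE; apply: k2.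
    by rewrite zE ler_rc.
  + move=> z zE; rewrite normrM normfV nb rcM ler_pM2l ?rc_gt0 //.
    have zu : rc (expR u) <= `|z| by rewrite zE ler_rc -[r](@lnK RR).
    have zb0 : 0 < `|z - b| by rewrite normr_gt0; apply: sub_neq0; exact: nzb.
    rewrite rcV lef_pV2 ?posrE ?(rc_gt0 (B * (tau *+ 2) / e)) //.
    rewrite (le_trans _ (lerB_dist _ _)) // zE nb -rcB ler_rc /r.
    by rewrite [leRHS](_ : _ = expR u + B * (tau *+ 2) / e) ?lerDr ?(@expR_ge0 RR) //; ring.
  have E (T : RR) : 0 < T -> B / (B * T / e) * T = e.
    by move=> T0; field; rewrite !gt_eqF.
  by rewrite ler_rc -mulrnAr E.
Qed.

(** The slope [(N z - N b) / (z - b)] extends continuously to [b], so by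
    [mean_eq_point] its product with [z] has the same mean on both circles. It
    remains to subtract [N b] times the means of [z / (z - b)]. *)
Lemma cauchy_annulus (N : CC -> CC) (u1 u2 : RR) : u1 < complex.Re w < u2 ->
  (forall z, rc (expR u1) <= `|z| <= rc (expR u2) -> hol N z) ->
  mean (fun z => N z * z / (z - b)) u2 0 - mean (fun z => N z * z / (z - b)) u1 0
    = N b * rc tau.
Proof.
move=> /andP[w1 w2] Nh.
have e1 : expR u1 < expR (complex.Re w : RR) by rewrite (@ltr_expR RR).
have e2 : expR (complex.Re w : RR) < expR u2 by rewrite (@ltr_expR RR).
have nb : `|b| = rc (expR (complex.Re w : RR)) by rewrite norm_cexp.
have bin : rc (expR u1) <= `|b| <= rc (expR u2) by rewrite nb !ler_rc !ltW.
have [D DP] := Nh _ bin.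
pose Q z := if z == b then D else (N z - N b) / (z - b).
have Qh z : rc (expR u1) <= `|z| <= rc (expR u2) -> z != b -> hol Q z.
  move=> zin zb; apply: (@hol_local _ _ _ `|z - b|); last exact: hol_slope zb (Nh _ zin).
    by rewrite normr_gt0 subr_eq0.
  move=> h hz; rewrite /Q; case: eqP => // zhb; move: hz.
  by rewrite -zhb opprD addrA subrr sub0r normrN ltxx.
have Qc : {for b, continuous Q}.
  apply: eps_cont => e e0; have [d d0 dP] := DP e e0; exists d => // z zd.
  have [->|zb] := eqVneq z b; first by rewrite subrr normr0 ltW.
  rewrite {1}/Q eqxx /Q (negPf zb).
  have zb0 : 0 < `|z - b| by rewrite normr_gt0 subr_eq0.
  have zdb : `|z - b| < d by rewrite distrC.
  have := dP _ zdb; rewrite subrKC => H.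
  rewrite (_ : D - (N z - N b) / (z - b) = - ((N z - N b - D * (z - b)) / (z - b))).
    by rewrite normrN normrM normfV ler_pdivrMr.
  by field; rewrite subr_eq0 zb.
have Gc (z : CC) : rc (expR u1) <= `|z| <= rc (expR u2) ->
    {for z, continuous (fun z : CC => z * Q z)}.
  move=> zin; have [zb|zb] := eqVneq z b.
    by rewrite zb; exact: contM (hol_cont (hol_id b)) Qc.
  by apply: hol_cont; apply: holM; [exact: hol_id|exact: Qh].
have Gh z : rc (expR u1) <= `|z| <= rc (expR u2) -> z != b -> hol (fun z => z * Q z) z.
  by move=> zin zb; apply: holM; [exact: hol_id|exact: Qh].
have w12 : u1 < complex.Re w < u2 by rewrite w1 w2.
have u12 : u1 <= u2 by exact: ltW (lt_trans w1 w2).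
have E1 : u1 <= u1 <= u2 by rewrite lexx u12.
have E2 : u1 <= u2 <= u2 by rewrite lexx u12.
have E := @mean_eq_point (fun z => z * Q z) u1 u2 w w12 Gc Gh.
have split (u : RR) : u1 <= u <= u2 -> expR u != expR (complex.Re w : RR) ->
    mean (fun z => z * Q z) u 0 =
    mean (fun z => N z * z / (z - b)) u 0 - N b * mean (fun z => z / (z - b)) u 0.
  move=> /andP[uu1 uu2] uw.
  have zin z : `|z| = rc (expR u) -> rc (expR u1) <= `|z| <= rc (expR u2).
    by move=> ->; rewrite !ler_rc !(@ler_expR RR) uu1 uu2.
  have nzb z : `|z| = rc (expR u) -> `|z| != `|b|.
    by move=> ->; rewrite nb; apply: contra uw => /eqP /complexI ->.
  have zb z : `|z| = rc (expR u) -> z != b.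
    by move=> /nzb; apply: contra => /eqP ->.
  have kc : cont_circle (fun z => z / (z - b)) u.
    by apply: cont_of_hol => z /nzb; exact: kernel_hol.
  have kc' : cont_circle (fun z => - N b * (z / (z - b))) u.
    apply: cont_of_hol => z /nzb H.
    by apply: holM; [exact: hol_cst|exact: kernel_hol].
  have nc : cont_circle (fun z => N z * z / (z - b)) u.
    apply: cont_of_hol => z zE.
    rewrite (_ : (fun z => N z * z / (z - b)) = (fun z => N z * (z / (z - b)))).
      by apply: holM; [apply: Nh; exact: zin|apply: kernel_hol; exact: nzb].
    by apply/funext => x; rewrite mulrA.
  rewrite (@eq_mean _ (fun z => N z * z / (z - b) + (- N b) * (z / (z - b)))).
    by rewrite (meanD 0 nc kc') (meanZ (- N b) 0 kc) mulNr.
  move=> z zE; rewrite /Q (negPf (zb _ zE)).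
  by field; rewrite subr_eq0 zb.
rewrite (split _ E1 (negbT (lt_eqF e1))) (split _ E2 (negbT (gt_eqF e2))) in E.
rewrite (kernel_mean_inside w1) (kernel_mean_outside w2) in E.
have fin (A B k t : CC) : A - k * 0 = B - k * t -> B - A = k * t.
  by rewrite mulr0 subr0 => ->; ring.
exact: fin E.
Qed.
End Kernel.

Lemma addrBDB (V : zmodType) (a b c d : V) : a - b - (c - d) = a - c - (b - d).
Proof. by rewrite !opprB addrACA [RHS]addrACA [- c - b]addrC. Qed.

Section MultiPole.
Variables (N : CC -> CC) (u1 u2 : RR).
Hypothesis u12 : u1 < u2.
Hypothesis Nh : forall z, rc (expR u1) <= `|z| <= rc (expR u2) -> hol N z.

Definition in_annulus (b : CC) : bool := rc (expR u1) < `|b| < rc (expR u2).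

(** For [f] meromorphic in the annulus this is [2 * pi] times the sum of the
    residues of [f z / z]. *)
Definition jump (f : CC -> CC) : CC := mean f u2 0 - mean f u1 0.

Definition on_boundary (z : CC) : Prop :=
  `|z| = rc (expR u1) \/ `|z| = rc (expR u2).

Lemma eq_jump (f g : CC -> CC) : (forall z, on_boundary z -> f z = g z) ->
  jump f = jump g.
Proof.
by move=> fg; congr (_ - _); apply: eq_mean => z zE; apply: fg; [right|left].
Qed.

Lemma jumpB (k : CC) (f g : CC -> CC) :
  (forall z, on_boundary z -> hol f z) -> (forall z, on_boundary z -> hol g z) ->
  jump (fun z => k * (f z - g z)) = k * (jump f - jump g).
Proof.
move=> fh gh.
have mB (u : RR) : (forall z, `|z| = rc (expR u) -> on_boundary z) ->
    mean (fun z => k * (f z - g z)) u 0 = k * (mean f u 0 - mean g u 0).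
  move=> ub.
  have fc : cont_circle f u by apply: cont_of_hol => z /ub /fh.
  have gc : cont_circle g u by apply: cont_of_hol => z /ub /gh.
  have kf : cont_circle (fun z => k * f z) u.
    by apply: cont_of_hol => z /ub /fh; apply: holM; exact: hol_cst.
  have kg : cont_circle (fun z => (- k) * g z) u.
    by apply: cont_of_hol => z /ub /gh; apply: holM; exact: hol_cst.
  rewrite (@eq_mean _ (fun z => k * f z + (- k) * g z)) => [|z _]; last by ring.
  by rewrite (meanD 0 kf kg) (meanZ k 0 fc) (meanZ (- k) 0 gc) mulNr mulrBr.
have m1 : forall z, `|z| = rc (expR u1) -> on_boundary z by left.
have m2 : forall z, `|z| = rc (expR u2) -> on_boundary z by right.
rewrite /jump (mB _ m1) (mB _ m2) -mulrBr; congr (_ * _).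
exact: addrBDB.
Qed.

Lemma boundary_neq (z b : CC) : on_boundary z -> in_annulus b -> z - b != 0.
Proof.
move=> zb /andP[b1 b2]; rewrite subr_eq0; apply/eqP => E; move: zb b1 b2.
by rewrite -E => -[] ->; rewrite ltxx.
Qed.

Lemma boundary_in (z : CC) : on_boundary z -> rc (expR u1) <= `|z| <= rc (expR u2).
Proof.
have e12 : expR u1 <= expR u2 by rewrite (@ler_expR RR) ltW.
by move=> [] ->; rewrite lexx ler_rc e12.
Qed.

Lemma multipole_hol (bs : seq CC) (y z : CC) : all in_annulus bs ->
  in_annulus y -> on_boundary z ->
  hol (fun z => N z * z / ((\prod_(b <- bs) (z - b)) * (z - y))) z.
Proof.
move=> bsin yin zb.
apply: holM; first by apply: holM; [exact: Nh (boundary_in zb)|exact: hol_id].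
apply: holV.
  apply: mulf_neq0; last exact: boundary_neq.
  rewrite prodf_seq_neq0; apply: sub_all bsin => b bin /=.
  exact: boundary_neq.
apply: holM; last by apply: holB; [exact: hol_id|exact: hol_cst].
by apply: hol_prod => b _; apply: holB; [exact: hol_id|exact: hol_cst].
Qed.

(** Partial fractions reduce several simple poles to Cauchy's formula at one;
    since [N] vanishes on [bs], only the pole at [y] contributes. *)
Lemma cauchy_multipole (bs : seq CC) (y : CC) : all in_annulus bs -> uniq bs ->
  (forall b, b \in bs -> N b = 0) -> in_annulus y -> y \notin bs ->
  jump (fun z => N z * z / ((\prod_(b <- bs) (z - b)) * (z - y))) =
  N y / (\prod_(b <- bs) (y - b)) * rc tau.
Proof.
elim: bs y => [|b bs IH] y /=.
  move=> _ _ _ yin _; rewrite big_nil divr1.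
  have y0 : y != 0.
    case/andP: yin => h _; rewrite -normr_gt0 (le_lt_trans _ h) // rc_ge0.
    exact: expR_ge0.
  have [w wy] := cexp_surj y0.
  have win : u1 < complex.Re w < u2.
    by move: yin; rewrite /in_annulus -wy norm_cexp !ltr_rc !(@ltr_expR RR).
  have C : jump (fun z => N z * z / (z - y)) = N y * rc tau.
    by rewrite -wy; exact: cauchy_annulus.
  by rewrite -C; refine (eq_jump _) => z _; rewrite big_nil mul1r.
move=> /andP[bin bsin] /andP[bbs bsu] N0 yin; rewrite inE negb_or => /andP[yb ybs].
have N0' c : c \in bs -> N c = 0 by move=> cbs; apply: N0; rewrite inE cbs orbT.
have yb0 : y - b != 0 by rewrite subr_eq0.
have := IH y bsin bsu N0' yin ybs; have := IH b bsin bsu N0' bin bbs.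
rewrite (N0 b) ?inE ?eqxx // !mul0r => Eb Ey.
rewrite (@eq_jump _ (fun z => (y - b)^-1 *
   (N z * z / ((\prod_(b <- bs) (z - b)) * (z - y)) -
    N z * z / ((\prod_(b <- bs) (z - b)) * (z - b))))); last first.
  move=> z zb; rewrite big_cons.
  have zbb := boundary_neq zb bin; have zyy := boundary_neq zb yin.
  have P0 : \prod_(b <- bs) (z - b) != 0.
    rewrite prodf_seq_neq0; apply: sub_all bsin => c cin /=.
    exact: boundary_neq.
  by field; rewrite yb0 P0 zbb zyy.
rewrite jumpB; [|by move=> z; exact: multipole_hol..].
rewrite Ey Eb subr0 big_cons invfM; ring.
Qed.

End MultiPole.

Lemma near_one_real (Q : CC -> Prop) :
  (\forall u \near (1 : CC), u != 1 -> Q u)%classic ->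
  exists2 x : RR, 1 < x & Q (rc x).
Proof.
move=> /nbhs_ballP[d /= d0 dP].
have d0' : 0 < complex.Re d by rewrite -rc_gt0 -rcE // gtr0_real.
exists (1 + complex.Re d / 2); first by rewrite ltrDl divr_gt0.
apply: dP.
  rewrite -ball_normE /ball_ /= rcD rc1 opprD addrA subrr sub0r normrN norm_rc.
  rewrite gtr0_norm ?divr_gt0 // [ltRHS]rcE ?gtr0_real // ltr_rc.
  by rewrite ltr_pdivrMr // ltr_pMr // ltr1n.
by rewrite rcD rc1 -subr_eq0 addrAC subrr add0r gt_eqF // rc_gt0 divr_gt0.
Qed.

(** * Theta functions of given degree and norm *)

Section ThetaSpace.
Variable p : CC.
Hypothesis p01 : 0 < `|p| < 1.

Let p0 : p != 0. Proof. by case/andP: p01; rewrite normr_gt0. Qed.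

(** Degree 0 is admitted, in contrast with [A_theta]: [theta_space_prod] needs it
    for the empty product. *)
Definition theta_space (n : nat) (s : CC) (f : CC -> CC) : Prop :=
  (forall x, x != 0 -> hol f x) /\
  (forall x, x != 0 -> f (p * x) = (-1) ^+ n / (s * x ^+ n) * f x).

Lemma theta_space_pXp_eq0 (n k : nat) (s : CC) (f : CC -> CC) (x : CC) :
  theta_space n s f -> s != 0 -> x != 0 -> (f (p ^+ k * x) == 0) = (f x == 0).
Proof.
move=> [_ fp] s0 x0; elim: k => [|k IH]; first by rewrite expr0 mul1r.
have px0 : p ^+ k * x != 0 by rewrite mulf_neq0 // expf_neq0.
rewrite exprS -mulrA fp // mulf_eq0 IH mulf_eq0 signr_eq0 invr_eq0 mulf_eq0.
by rewrite (negPf s0) expf_eq0 (negPf px0) andbF.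
Qed.

Lemma theta_space_equiv_eq0 (n : nat) (s : CC) (f : CC -> CC) (x y : CC) :
  theta_space n s f -> s != 0 -> x != 0 -> y != 0 -> p_equiv p x y ->
  (f x == 0) = (f y == 0).
Proof.
move=> fV s0 x0 y0 [k [l E]].
by rewrite -(theta_space_pXp_eq0 k fV s0 x0) E (theta_space_pXp_eq0 l fV s0 y0).
Qed.

Section Vanishing.
Variables (n : nat) (s : CC) (f : CC -> CC) (bs : seq CC) (y : CC).
Variables (w : CC) (u2 : RR).
Hypothesis wp : cexp w = p.
Hypothesis fV : theta_space n s f.
Hypothesis s0 : s != 0.
Hypothesis bsn : size bs = n.
Hypothesis bsin : all (in_annulus (u2 + complex.Re w) u2) bs.
Hypothesis bsu : uniq bs.
Hypothesis f0 : forall b, b \in bs -> f b = 0.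
Hypothesis th0 : theta p (s * \prod_(b <- bs) b) != 0.
Hypothesis yin : in_annulus (u2 + complex.Re w) u2 y.
Hypothesis ybs : y \notin bs.

Let u1 : RR := u2 + complex.Re w.

Let norm_p : `|p| = rc (expR (complex.Re w : RR)).
Proof. by rewrite -wp norm_cexp. Qed.

Let w_lt0 : complex.Re w < 0.
Proof.
case/andP: p01 => _; rewrite norm_p -rc1 ltr_rc -(@exp.expR0 RR).
by rewrite (@ltr_expR RR).
Qed.

Let u12 : u1 < u2. Proof. by rewrite /u1 gtrDl. Qed.

Let e1 : rc (expR u1) = `|p| * rc (expR u2).
Proof. by rewrite /u1 (@exp.expRD RR) rcM norm_p mulrC. Qed.

Let in_neq0 (b : CC) : in_annulus u1 u2 b -> b != 0.
Proof.
by case/andP=> h _; rewrite -normr_gt0 (le_lt_trans _ h) // rc_ge0 (@expR_ge0 RR).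
Qed.

Let closed_neq0 (z : CC) : rc (expR u1) <= `|z| <= rc (expR u2) -> z != 0.
Proof.
by case/andP=> h _; rewrite -normr_gt0 (lt_le_trans _ h) // rc_gt0 (@expR_gt0 RR).
Qed.

Let cofactor_neq0 (z b : CC) : in_annulus u1 u2 b ->
  rc (expR u1) <= `|z| <= rc (expR u2) -> theta_cofactor p (z / b) != 0.
Proof.
move=> bin /andP[z1 z2]; have b0 := in_neq0 bin; case/andP: bin => b1 b2.
have nb : 0 < `|b| by rewrite normr_gt0.
have np : 0 < `|p| by rewrite normr_gt0.
apply: theta_cofactor_neq0 => //.
  rewrite normrM normfV ltr_pdivlMr //.
  by apply: lt_le_trans z1; rewrite e1 ltr_pM2l.
rewrite !normrM normfV mulrAC ltr_pdivrMr // mul1r mulrC.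
by apply: le_lt_trans b1; rewrite e1 ler_pM2l.
Qed.

Let t : CC := (s * \prod_(b <- bs) b)^-1.

Let prod_neq0 : \prod_(b <- bs) b != 0.
Proof.
by rewrite prodf_seq_neq0; apply: sub_all bsin => b /in_neq0.
Qed.

Let t0 : t != 0. Proof. by rewrite invr_eq0 mulf_neq0. Qed.

Let y0 : y != 0. Proof. exact: in_neq0 yin. Qed.

(** This function is invariant under multiplication by [p]: the argument of the
    theta function in the numerator is chosen for this purpose. Because [f]
    vanishes on [bs], its only possible pole in the annulus is [y]. *)
Let H (z : CC) : CC :=
  f z * theta p (t * (z / y)) / (theta p (z / y) * \prod_(b <- bs) theta p (z / b)).

Let H_periodic (z : CC) : z != 0 -> H (p * z) = H z.
Proof.
move=> z0; case: fV => _ fp; rewrite /H fp //.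
have zy0 : z / y != 0 by rewrite mulf_neq0 // invr_eq0.
have E1 : theta p (t * (p * z / y)) = - (t * (z / y))^-1 * theta p (t * (z / y)).
  rewrite (_ : t * (p * z / y) = p * (t * (z / y))); last by ring.
  by rewrite theta_mulp // mulf_neq0.
have E2 : theta p (p * z / y) = - (z / y)^-1 * theta p (z / y).
  by rewrite -(mulrA p) theta_mulp.
have E3 : \prod_(b <- bs) theta p (p * z / b) =
    (-1) ^+ n * (\prod_(b <- bs) b) / z ^+ n * \prod_(b <- bs) theta p (z / b).
  rewrite -bsn; elim: bs bsin => [|b l IH] /=.
    by move=> _; rewrite !big_nil !expr0; field.
  move=> /andP[bin lin]; rewrite !big_cons IH // -(mulrA p).
  have b0 := in_neq0 bin.
  rewrite theta_mulp ?mulf_neq0 ?invr_eq0 // !exprS.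
  by field; rewrite b0 z0 expf_neq0.
rewrite E1 E2 E3.
set e := (-1) ^+ n; set B := \prod_(b <- bs) b; set P := \prod_(b <- bs) theta p (z / b).
have e0 : e != 0 by rewrite signr_eq0.
have zn0 : z ^+ n != 0 by rewrite expf_neq0.
rewrite (_ : - (z / y)^-1 * theta p (z / y) * (e * B / z ^+ n * P) =
    (- (z / y)^-1 * (e * B / z ^+ n)) * (theta p (z / y) * P)); last by ring.
have alg (e' B' zn X T F : CC) : e' != 0 -> B' != 0 -> zn != 0 ->
    e' / (s * zn) * F * (- ((s * B')^-1 * (z / y))^-1 * T) *
    ((- (z / y)^-1 * (e' * B' / zn))^-1 * X) = F * T * X.
  by move=> e'0 B'0 zn'0; field; rewrite y0 z0 e'0 B'0 zn'0 s0.
rewrite [(_ * (theta p (z / y) * P))^-1]invfM; exact: alg.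
Qed.

(** Multiplication by [p] maps the outer circle to the inner one, hence the jump of
    [H] is 0. By [cauchy_multipole] it is also a multiple of [f y], and the factor
    is not 0; this is where [th0] enters. *)
Lemma theta_space_vanish_annulus : f y = 0.
Proof.
pose K := - y * \prod_(b <- bs) (- b).
pose N (z : CC) := K * (f z * theta p (t * (z / y)) /
  (z * (theta_cofactor p (z / y) * \prod_(b <- bs) theta_cofactor p (z / b)))).
have chi_prod z : rc (expR u1) <= `|z| <= rc (expR u2) ->
    \prod_(b <- bs) theta_cofactor p (z / b) != 0.
  move=> zin; rewrite prodf_seq_neq0; apply: sub_all bsin => b bin /=.
  exact: cofactor_neq0.
have div_hol b z : b != 0 -> hol (fun z => z / b) z.
  by move=> b0; apply: holM; [exact: hol_id|exact: hol_cst].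
have Nh z : rc (expR u1) <= `|z| <= rc (expR u2) -> hol N z.
  move=> zin; have z0 := closed_neq0 zin; case: fV => fh _.
  apply: holM; first exact: hol_cst.
  apply: holM; first apply: holM; first exact: fh.
    apply: (@hol_comp (theta p) (fun z => t * (z / y))).
      by apply: holM; [exact: hol_cst|exact: div_hol].
    by apply: theta_hol => //; rewrite !mulf_neq0 // invr_eq0.
  apply: holV.
    by do 2!apply: mulf_neq0 => //; [exact: cofactor_neq0|exact: chi_prod].
  apply: holM; first exact: hol_id.
  apply: holM.
    apply: (@hol_comp (theta_cofactor p) (fun z => z / y)); first exact: div_hol.
    by apply: theta_cofactor_hol => //; rewrite mulf_neq0 // invr_eq0.
  rewrite (_ : (fun z => \prod_(b <- bs) _) =
      fun z => \prod_(b <- bs | b != 0) theta_cofactor p (z / b)).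
    apply: hol_prod => b b0.
    apply: (@hol_comp (theta_cofactor p) (fun z => z / b)); first exact: div_hol.
    by apply: theta_cofactor_hol => //; rewrite mulf_neq0 // invr_eq0.
  apply/funext => x; rewrite big_seq_cond [RHS]big_seq_cond; apply: eq_bigl => b.
  by case: (boolP (b \in bs)) => //= /(allP bsin) /in_neq0 ->.
have N0 b : b \in bs -> N b = 0 by move=> /f0 fb; rewrite /N fb !mul0r mulr0.
have J := @cauchy_multipole N u1 u2 u12 Nh bs y bsin bsu N0 yin ybs.
have HE z : on_boundary u1 u2 z ->
    N z * z / (\prod_(b <- bs) (z - b) * (z - y)) = H z.
  move=> zb; have zin := boundary_in u12 zb; have z0 := closed_neq0 zin.
  have PE : \prod_(b <- bs) theta p (z / b) = (\prod_(b <- bs) (z - b)) *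
      (\prod_(b <- bs) theta_cofactor p (z / b)) / \prod_(b <- bs) (- b).
    elim: bs bsin => [|b l IH] /=; first by move=> _; rewrite !big_nil; field.
    move=> /andP[bin lin]; rewrite !big_cons IH // theta_factor //.
    have b0 := in_neq0 bin.
    have l0 : \prod_(b <- l) (- b) != 0.
      by rewrite prodf_seq_neq0; apply: sub_all lin => c /in_neq0; rewrite /= oppr_eq0.
    by field; rewrite b0 l0.
  have zy := boundary_neq zb yin.
  have zP : \prod_(b <- bs) (z - b) != 0.
    by rewrite prodf_seq_neq0; apply: sub_all bsin => c cin /=; exact: boundary_neq zb cin.
  have l0 : \prod_(b <- bs) (- b) != 0.
    by rewrite prodf_seq_neq0; apply: sub_all bsin => c /in_neq0; rewrite /= oppr_eq0.
  rewrite /N /H PE (theta_factor p01 (z / y)) /K.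
  have cy := cofactor_neq0 yin zin; have cb := chi_prod _ zin.
  have alg (F T c1 c2 Q L : CC) : c1 != 0 -> c2 != 0 -> Q != 0 -> L != 0 ->
      - y * L * (F * T / (z * (c1 * c2))) * z / (Q * (z - y)) =
      F * T / ((1 - z / y) * c1 * (Q * c2 / L)).
    have yz : y - z != 0 by rewrite -opprB oppr_eq0.
    by move=> c10 c20 Q0 L0; field; rewrite ?y0 ?z0 ?c10 ?c20 ?Q0 ?L0 ?zy ?yz.
  exact: alg cy cb zP l0.
have theta_neq0 b z : on_boundary u1 u2 z -> in_annulus u1 u2 b -> theta p (z / b) != 0.
  move=> zb bin; have b0 := in_neq0 bin.
  rewrite theta_factor //; apply: mulf_neq0; last exact: cofactor_neq0 (boundary_in u12 zb).
  rewrite (_ : 1 - z / b = - ((z - b) / b)); last by field.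
  by rewrite oppr_eq0 mulf_neq0 ?invr_eq0 //; exact: boundary_neq zb bin.
have Hh z : on_boundary u1 u2 z -> hol H z.
  move=> zb; have z0 := closed_neq0 (boundary_in u12 zb); case: fV => fh _.
  apply: holM; first apply: holM; first exact: fh.
    apply: (@hol_comp (theta p) (fun z => t * (z / y))).
      by apply: holM; [exact: hol_cst|exact: div_hol].
    by apply: theta_hol => //; rewrite !mulf_neq0 // invr_eq0.
  apply: holV.
    apply: mulf_neq0; first exact: theta_neq0.
    by rewrite prodf_seq_neq0; apply: sub_all bsin => b bin /=; exact: theta_neq0.
  apply: holM.
    apply: (@hol_comp (theta p) (fun z => z / y)); first exact: div_hol.
    by apply: theta_hol => //; rewrite mulf_neq0 // invr_eq0.
  rewrite (_ : (fun z => \prod_(b <- bs) _) =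
      fun z => \prod_(b <- bs | b != 0) theta p (z / b)).
    apply: hol_prod => b b0.
    apply: (@hol_comp (theta p) (fun z => z / b)); first exact: div_hol.
    by apply: theta_hol => //; rewrite mulf_neq0 // invr_eq0.
  apply/funext => x; rewrite big_seq_cond [RHS]big_seq_cond; apply: eq_bigl => b.
  by case: (boolP (b \in bs)) => //= /(allP bsin) /in_neq0 ->.
have c1 : cont_circle H u1 by apply: cont_of_hol => z zE; apply: Hh; left.
have J0 : jump u1 u2 H = 0.
  rewrite /jump; apply/eqP; rewrite subr_eq0; apply/eqP.
  rewrite -(mean_shift (complex.Im w) c1).
  have R := mean_rot H u2 0 w; rewrite add0r in R; rewrite -R wp.
  apply: eq_mean => z zE; apply/esym; apply: H_periodic.
  by rewrite -normr_gt0 zE rc_gt0 (@expR_gt0 RR).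
have NJ : N y / \prod_(b <- bs) (y - b) * rc tau = 0.
  by rewrite -J -J0; refine (eq_jump _) => z; exact: HE.
have yin' : rc (expR u1) <= `|y| <= rc (expR u2).
  by case/andP: yin => h1 h2; rewrite !ltW.
have tE : theta p (t * (y / y)) != 0.
  have X0 : s * \prod_(b <- bs) b != 0 by rewrite mulf_neq0.
  by rewrite divff // mulr1 /t (thetaV p01 X0) mulf_neq0 // oppr_eq0 invr_eq0.
have yb0 : \prod_(b <- bs) (y - b) != 0.
  rewrite prodf_seq_neq0; apply/allP => b bbs /=; rewrite subr_eq0.
  by apply: contra ybs => /eqP ->.
have l0 : \prod_(b <- bs) (- b) != 0.
  by rewrite prodf_seq_neq0; apply: sub_all bsin => c /in_neq0; rewrite /= oppr_eq0.
have tau0 : rc tau != 0 by rewrite gt_eqF // rc_gt0 tau_gt0.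
have yb0' : (\prod_(b <- bs) (y - b))^-1 != 0 by rewrite invr_eq0.
have Ny0 : N y = 0.
  by apply: (mulIf yb0'); apply: (mulIf tau0); rewrite NJ !mul0r.
have K0 : K != 0 by rewrite mulf_neq0 // oppr_eq0.
have D0 : (y * (theta_cofactor p (y / y) *
    \prod_(b <- bs) theta_cofactor p (y / b)))^-1 != 0.
  rewrite invr_eq0 mulf_neq0 //; apply: mulf_neq0; first exact: cofactor_neq0.
  exact: chi_prod.
apply: (mulIf tE); apply: (mulIf D0); apply: (mulfI K0).
by rewrite -[LHS]/(N y) Ny0 !mul0r mulr0.
Qed.
End Vanishing.
End ThetaSpace.

(** Zeros of theta are isolated, so every real number slightly larger than 1
    satisfies the finitely many conditions. *)
Lemma generic_point (q : CC) (l : seq CC) : 0 < `|q| < 1 ->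
  all (fun b => b != 0) l ->
  exists2 x : RR, 1 < x & all (fun b => theta q (b * rc x) != 0) l.
Proof.
move=> q01 l0; apply: (@near_one_real (fun u => all (fun b => theta q (b * u) != 0) l)).
elim: l l0 => [_|b l IH /= /andP[b0 /IH lP]]; first by near=> u.
have bP := theta_near_neq0 q01 b0.
near=> u => u1; apply/andP; split.
  by move: u1; near: u.
by move: u1; near: u.
Unshelve. all: by end_near.
Qed.

Section ThetaUniqueness.
Variable p : CC.
Hypothesis p01 : 0 < `|p| < 1.

Let p0 : p != 0. Proof. by case/andP: p01; rewrite normr_gt0. Qed.

Let q01 : 0 < `|(`|p| : CC)| < 1. Proof. by rewrite normr_id. Qed.

Lemma p_equiv_prod (bs : seq CC) (g : CC -> CC) :
  (forall b, b \in bs -> p_equiv p b (g b)) ->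
  p_equiv p (\prod_(b <- bs) b) (\prod_(b <- map g bs) b).
Proof.
elim: bs => [|b bs IH] H; first by rewrite !big_nil; exact: p_equiv_refl.
rewrite /= !big_cons; apply: p_equivM; first by apply: H; rewrite inE eqxx.
by apply: IH => c cbs; apply: H; rewrite inE cbs orbT.
Qed.

Lemma p_equiv_sym (x y : CC) : p_equiv p x y -> p_equiv p y x.
Proof. by move=> [k [l E]]; exists l, k. Qed.

Lemma p_equiv_trans (x y z : CC) : p_equiv p x y -> p_equiv p y z -> p_equiv p x z.
Proof.
move=> [k [l E]] [k' [l' E']]; exists (k + k')%N, (l + l')%N.
by rewrite (addnC k) !exprD -mulrA E mulrCA E' mulrA.
Qed.

(** A nonzero theta function of degree [n] has [n] zeros modulo [p], and their
    product is determined modulo [p] by the norm. Multiplication by powers of [p]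
    brings all the points into one annulus, whose radius is chosen such that none
    of them falls on its boundary. *)
Lemma theta_space_vanish (n : nat) (s : CC) (f : CC -> CC) (bs : seq CC) :
  theta_space p n s f -> s != 0 -> size bs = n ->
  all (fun b => b != 0) bs ->
  pairwise (fun b b' => theta p (b / b') != 0) bs ->
  (forall b, b \in bs -> f b = 0) -> theta p (s * \prod_(b <- bs) b) != 0 ->
  forall y, y != 0 -> f y = 0.
Proof.
move=> fV s0 bsn bs0 bsp f0 th0 y y0.
have [w wp] := cexp_surj p0.
have nbs0 : all (fun b => b != 0) (map Num.norm (y :: bs)).
  by rewrite all_map; apply/allP => b; rewrite inE /= normr_eq0 => /predU1P[->//|/(allP bs0)].
(* For the nome [`|p|] theta vanishes at 1, so [xP] implies that no [`|b| * x]
   is a power of [`|p|]: no translate of [b] has modulus [x^-1]. *)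
have [x x1] := generic_point q01 nbs0; rewrite all_map => xP.
have x0 : 0 < x by apply: lt_trans x1.
pose r := rc x^-1; have r0 : 0 < r by rewrite rc_gt0 invr_gt0.
pose u2 : RR := - ln x.
have e2 : rc (expR u2) = r by rewrite /u2 (@expRN RR) (@lnK RR).
have e1 : rc (expR (u2 + complex.Re w : RR)) = r * `|p|.
  by rewrite (@exp.expRD RR) rcM e2 -wp norm_cexp.
have ex b : exists b', b \in y :: bs ->
    [/\ b' != 0, p_equiv p b b' & in_annulus (u2 + complex.Re w) u2 b'].
  have [bin|] := boolP (b \in y :: bs); last by exists b.
  have b0 : b != 0.
    by move: bin; rewrite inE => /predU1P[->|/(allP bs0)].
  have [b' [b'0 bb' b1 b2]] := p_equiv_annulus p01 b0 r0.
  exists b' => _; split=> //; rewrite /in_annulus e1 e2 b1 lt_neqAle b2 andbT.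
  apply/eqP => b'r; move/allP : xP => /(_ _ bin) /= /negP; apply.
  have bx0 : `|b| * rc x != 0 by rewrite mulf_neq0 ?normr_eq0 // gt_eqF // rc_gt0.
  rewrite (@p_equiv_theta_eq0 _ q01 _ 1) ?oner_eq0 //; first by rewrite theta_at1.
  case: bb' => k [l E]; exists k, l.
  rewrite mulrA -normrX -normrM E normrM b'r normrX mulr1 -mulrA /r -rcM mulVf ?rc1 ?mulr1 //.
  by rewrite gt_eqF.
have [g gP] := choice ex.
have gbs b : b \in bs -> [/\ g b != 0, p_equiv p b (g b)
    & in_annulus (u2 + complex.Re w) u2 (g b)].
  by move=> bbs; apply: gP; rewrite inE bbs orbT.
have [gy0 gye gyin] := gP y (mem_head _ _).
have bsnz b : b \in bs -> b != 0 by move/(allP bs0).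
suff : f (g y) = 0.
  move/eqP => fg; apply/eqP.
  by rewrite (theta_space_equiv_eq0 p01 fV s0 y0 gy0 gye).
have [/mapP[b bbs gyb]|gyb] := boolP (g y \in map g bs).
  have [gb0 gbe _] := gbs _ bbs; rewrite gyb; apply/eqP.
  by rewrite -(theta_space_equiv_eq0 p01 fV s0 (bsnz _ bbs) gb0 gbe) f0.
apply: (theta_space_vanish_annulus p01 wp fV s0 _ _ _ _ _ gyin gyb).
- by rewrite size_map.
- by apply/allP => _ /mapP[b /gbs[_ _ h] ->].
- elim: bs bsp bsnz gbs {bsn bs0 f0 th0 nbs0 xP ex gP gyb} => //= b bs IH /andP[bbs bsp] bsnz gbs.
  rewrite IH // ?andbT; last first.
  + by move=> c cbs; apply: gbs; rewrite inE cbs orbT.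
  + by move=> c cbs; apply: bsnz; rewrite inE cbs orbT.
  apply/mapP => -[c cbs E]; move/allP : bbs => /(_ _ cbs) /negP; apply.
  have [gb0 gbe _] := gbs b (mem_head _ _).
  have [gc0 gce _] : [/\ g c != 0, p_equiv p c (g c) & in_annulus (u2 + complex.Re w) u2 (g c)].
    by apply: gbs; rewrite inE cbs orbT.
  have b0 := bsnz b (mem_head _ _).
  have c0 : c != 0 by apply: bsnz; rewrite inE cbs orbT.
  rewrite (@p_equiv_theta_eq0 _ p01 _ 1) ?oner_eq0 ?mulf_neq0 ?invr_eq0 ?theta_at1 //.
  rewrite -(divff c0); apply: p_equivM; last exact: p_equiv_refl.
  by apply: p_equiv_trans gbe _; rewrite E; exact: p_equiv_sym.
- by move=> _ /mapP[b bbs ->]; have [gb0 gbe _] := gbs _ bbs; apply/eqP;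
    rewrite -(theta_space_equiv_eq0 p01 fV s0 (bsnz _ bbs) gb0 gbe) f0.
have P0 : \prod_(b <- bs) b != 0 by rewrite prodf_seq_neq0; apply/allP => b /bsnz.
have P0' : \prod_(b <- map g bs) b != 0.
  by rewrite prodf_seq_neq0; apply/allP => _ /mapP[b /gbs[h _ _] ->].
have sP0 : s * \prod_(b <- bs) b != 0 by rewrite mulf_neq0.
have sP0' : s * \prod_(b <- map g bs) b != 0 by rewrite mulf_neq0.
rewrite -(p_equiv_theta_eq0 p01 sP0 sP0') //.
apply: p_equivM; first exact: p_equiv_refl.
by apply: p_equiv_prod => b /gbs[].
Qed.

Lemma theta_space_lin (n : nat) (s k k' : CC) (f g : CC -> CC) :
  theta_space p n s f -> theta_space p n s g ->
  theta_space p n s (fun x => k * f x + k' * g x).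
Proof.
move=> [fh fp] [gh gp]; split=> x x0.
  apply: holD; apply: holM; [exact: hol_cst|exact: fh|exact: hol_cst|exact: gh].
by rewrite fp // gp //; ring.
Qed.

Lemma theta_spaceM (n m : nat) (s t : CC) (f g : CC -> CC) :
  theta_space p n s f -> theta_space p m t g ->
  theta_space p (n + m) (s * t) (fun x => f x * g x).
Proof.
move=> [fh fp] [gh gp]; split=> x x0.
  by apply: holM; [exact: fh|exact: gh].
by rewrite fp // gp // !exprD !invfM; ring.
Qed.

Lemma theta_space_theta (b : CC) : b != 0 ->
  theta_space p 1 b (fun x => theta p (b * x)).
Proof.
move=> b0; split=> x x0.
  apply: (@hol_comp (theta p) (fun x => b * x)).
    by apply: holM; [exact: hol_cst|exact: hol_id].
  by apply: theta_hol => //; rewrite mulf_neq0.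
rewrite mulrCA theta_mulp ?mulf_neq0 // !expr1.
by field; rewrite b0 x0.
Qed.

Lemma theta_space_prod (I : Type) (r : seq I) (Q : pred I) (b : I -> CC) :
  (forall i, b i != 0) ->
  theta_space p (\sum_(i <- r | Q i) 1) (\prod_(i <- r | Q i) b i)
    (fun x => \prod_(i <- r | Q i) theta p (b i * x)).
Proof.
move=> b0.
elim: r => [|i r IH].
  rewrite !big_nil (_ : (fun x => _) = fun=> 1); last first.
    by apply/funext => x; rewrite big_nil.
  split=> x x0; first exact: hol_cst.
  by rewrite !expr0 mulr1 divr1 mulr1.
rewrite (_ : (fun x => _) = fun x => (if Q i then theta p (b i * x) else 1) *
    \prod_(j <- r | Q j) theta p (b j * x)); last first.
  by apply/funext => x; rewrite big_cons; case: ifP => // _; rewrite mul1r.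
rewrite !big_cons; case: (Q i); last first.
  rewrite (_ : (fun x => _) = fun x => \prod_(j <- r | Q j) theta p (b j * x)) //.
  by apply/funext => x; rewrite mul1r.
exact: theta_spaceM (theta_space_theta (b0 i)) IH.
Qed.

(** A theta function of degree [n] is determined, up to a factor, by [n - 1]
    of its zeros: the remaining zero is forced by the norm. The factor is
    eliminated by comparing the values at two points. *)
Lemma theta_space_unique (n : nat) (s : CC) (f : CC -> CC) (xs : seq CC) :
  theta_space p n s f -> s != 0 -> (size xs).+1 = n ->
  all (fun b => b != 0) xs ->
  pairwise (fun b b' => theta p (b / b') != 0) xs ->
  (forall b, b \in xs -> f b = 0) ->
  forall y w, y != 0 -> w != 0 ->
  let T z := theta p (s * (\prod_(b <- xs) b) * z) * \prod_(b <- xs) theta p (z / b) in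
  f y * T w = f w * T y.
Proof.
move=> fV s0 xsn xs0 xsp f0 y w y0 w0 T.
set X := \prod_(b <- xs) b.
have X0 : X != 0 by rewrite prodf_seq_neq0; apply/allP => b /(allP xs0).
have xsV : forall b, (if b \in xs then b^-1 else 1) != 0.
  move=> b; case: ifP => [/(allP xs0) b0|_]; last exact: oner_neq0.
  by rewrite invr_eq0.
have TV : theta_space p n s T.
  have sX0 : s * X != 0 by rewrite mulf_neq0.
  have := theta_spaceM (theta_space_theta sX0) (theta_space_prod xs predT xsV).
  rewrite sum1_size add1n xsn.
  rewrite (_ : s * X * _ = s); last first.
    rewrite -mulrA (_ : X * _ = 1) ?mulr1 // /X -big_split /= big1_seq // => b /= bxs.
    by rewrite bxs mulfV //; exact: (allP xs0).
  rewrite (_ : (fun x => _) = T) //; apply/funext => z; congr (_ * _).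
  by rewrite /= [LHS]big_seq [RHS]big_seq; apply: eq_bigr => b bxs; rewrite bxs mulrC.
have T0 b : b \in xs -> T b = 0.
  move=> bxs; rewrite /T; apply/eqP; rewrite mulf_eq0; apply/orP; right.
  rewrite prodf_seq_eq0; apply/hasP; exists b => //=.
  by rewrite divff ?theta_at1 //; exact: (allP xs0).
have key v z : v != 0 -> z != 0 -> T v != 0 -> f z * T v = f v * T z.
  move=> v0 z0 Tv; apply/eqP; rewrite -subr_eq0; apply/eqP.
  have hV := theta_space_lin (T v) (- f v) fV TV.
  have Tv1 : theta p (s * X * v) != 0 by apply: contraNneq Tv => E; rewrite /T E mul0r.
  have Tv2 b : b \in xs -> theta p (v / b) != 0.
    move=> bxs; apply: contraNneq Tv => E; rewrite /T mulf_eq0; apply/orP; right.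
    by rewrite prodf_seq_eq0; apply/hasP; exists b => //=; rewrite E.
  have := @theta_space_vanish n s _ (v :: xs) hV s0 xsn.
  rewrite /= v0 xs0 xsp => /(_ isT) H.
  rewrite mulrC -mulNr; apply: H => //.
  - by rewrite andbT; apply/allP => b /Tv2.
  - move=> b; rewrite inE => /predU1P[->|bxs]; first by rewrite mulNr mulrC subrr.
    by rewrite (f0 _ bxs) (T0 _ bxs) !mulr0 addr0.
  by rewrite big_cons mulrCA mulrC.
have [Tw|Tw] := eqVneq (T w) 0; last exact: key.
have [Ty|Ty] := eqVneq (T y) 0; first by rewrite Tw Ty !mulr0.
by apply/esym; exact: key.
Qed.

End ThetaUniqueness.

(** * Theta identities *)

Section ThetaIdentities.
Variable p : CC.
Hypothesis p01 : 0 < `|p| < 1.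

Let p0 : p != 0. Proof. by case/andP: p01; rewrite normr_gt0. Qed.
Let p1 : `|p| < 1. Proof. by case/andP: p01. Qed.
Let np0 : 0 < `|p|. Proof. by case/andP: p01. Qed.

Let q01 : 0 < `|p ^+ 2| < 1.
Proof. by rewrite normrX exprn_gt0 // exprn_ilt1. Qed.

Lemma theta_sqr_nome_neq0 : theta (p ^+ 2) p != 0.
Proof.
rewrite (theta_factor q01); apply: mulf_neq0.
  by rewrite subr_eq0; apply: contraTneq p1 => <-; rewrite normr1 ltxx.
apply: theta_cofactor_neq0 => //; first by rewrite normrX expr2 -[ltRHS]mul1r ltr_pM2r.
by rewrite -exprS normrX exprn_ilt1.
Qed.

Lemma thetaVN (x : CC) : x != 0 -> theta p (- x^-1) = x^-1 * theta p (- x).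
Proof.
by move=> x0; rewrite -invrN (thetaV p01) ?oppr_eq0 // invrN opprK.
Qed.

(** The factors 1 give this sum the shape of [theta_space_lin]. *)
Let pair_sum (c x : CC) : CC :=
  1 * (theta p (c * x) * theta p (- c^-1 * x)) +
  1 * (theta p (c^-1 * x) * theta p (- c * x)).

Let pair_sum_space (c : CC) : c != 0 -> theta_space p 2 (-1) (pair_sum c).
Proof.
move=> c0; apply: theta_space_lin.
  have -> : -1 = c * - c^-1 by rewrite mulrN divff.
  by apply: (@theta_spaceM _ 1 1); apply: theta_space_theta; rewrite ?oppr_eq0 ?invr_eq0.
have -> : -1 = c^-1 * - c by rewrite mulrN mulVf.
by apply: (@theta_spaceM _ 1 1); apply: theta_space_theta; rewrite ?oppr_eq0 ?invr_eq0.
Qed.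

Let pair_sum_half (c y : CC) : c != 0 -> y != 0 ->
  pair_sum c y * theta (p ^+ 2) p =
  2%:R * theta (p ^+ 2) (p * c ^+ 2) * theta (p ^+ 2) (y ^+ 2).
Proof.
move=> c0 y0.
(* at a square root of [p], [theta_pdiv] makes the two summands equal *)
pose w := sqrtC p.
have w2 : w ^+ 2 = p by rewrite sqrtCK.
have w0 : w != 0 by rewrite sqrtC_eq0.
have z1 : pair_sum c 1 = 0.
  by rewrite /pair_sum !mulr1 (thetaV p01) // thetaVN //; ring.
have H : forall b, b \in [:: 1 : CC] -> pair_sum c b = 0.
  by move=> b; rewrite inE => /eqP ->.
have := theta_space_unique p01 (pair_sum_space c0) (xs := [:: 1]).
rewrite oppr_eq0 oner_eq0 /= oner_eq0 => /(_ isT erefl isT isT H y w y0 w0).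
have TE z : theta p (-1 * (\prod_(b <- [:: 1 : CC]) b) * z) *
    \prod_(b <- [:: 1 : CC]) theta p (z / b) = theta (p ^+ 2) (z ^+ 2).
  by rewrite !big_seq1 mulr1 divr1 mulN1r mulrC theta_mul_opp.
rewrite !TE w2 => ->; congr (_ * _).
have e1 : theta p (c^-1 * w) = theta p (c * w).
  rewrite -(theta_pdiv p01 (x := c * w)) ?mulf_neq0 //; congr (theta p _).
  by rewrite -w2; field; rewrite c0 w0.
have e2 : theta p (- c^-1 * w) = theta p (- (c * w)).
  rewrite -(theta_pdiv p01 (x := - (c * w))) ?oppr_eq0 ?mulf_neq0 //; congr (theta p _).
  by rewrite -w2; field; rewrite c0 w0.
rewrite /pair_sum e1 e2 mulNr !mul1r (theta_mul_opp p01) exprMn w2 mulrC.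
ring.
Qed.

(** This is [pair_sum_half] at [c = y = 'i], where one of the two summands
    vanishes. *)
Lemma theta_opp1_sqr_nome : theta p (-1) * theta (p ^+ 2) p = 2%:R.
Proof.
have t0 := theta_opp1_neq0 p01.
have i0 : ('i : CC) != 0 by exact: neq0Ci.
have := pair_sum_half i0 i0.
rewrite /pair_sum mulVf // (theta_at1 p01) mul0r mulr0 addr0 mul1r.
rewrite -!expr2 sqrCi mulNr mulVf // => H.
have nz1 : (-1 : CC) != 0 by rewrite oppr_eq0 oner_eq0.
apply: (mulfI t0); rewrite mulrA H [in RHS](theta_even_odd p01 nz1); ring.
Qed.

(** Both sides are theta functions of degree 2 in [x] that vanish at 1; they
    are compared at a square root of the nome, where the left-hand side is
    computed by [theta_pdiv]. *)
Lemma theta_three_term (c x : CC) : c != 0 -> x != 0 ->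
  theta p (c * x) * theta p (- (x / c)) + theta p (x / c) * theta p (- (c * x)) =
  theta p (-1) * theta (p ^+ 2) (p * c ^+ 2) * theta (p ^+ 2) (x ^+ 2).
Proof.
move=> c0 x0; apply: (mulIf theta_sqr_nome_neq0).
transitivity (pair_sum c x * theta (p ^+ 2) p).
  by congr (_ * _); rewrite /pair_sum !mul1r !mulNr (mulrC c^-1).
rewrite pair_sum_half // -theta_opp1_sqr_nome; ring.
Qed.

(** For [p = 0] this is [x + x^-1 - y - y^-1], and in general [psi_pluecker] lets
    it be used like a difference of values of one function. *)
Definition psi (x y : CC) : CC := x^-1 * theta p (x * y) * theta p (x / y).

Lemma psi_opp (x y : CC) : x != 0 -> y != 0 -> psi y x = - psi x y.
Proof.
move=> x0 y0; rewrite /psi -[y / x]invf_div (thetaV p01); last first.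
  by rewrite mulf_neq0 ?invr_eq0.
by rewrite (mulrC y x); field; rewrite x0 y0.
Qed.

Lemma psi_self (x : CC) : x != 0 -> psi x x = 0.
Proof. by move=> x0; rewrite /psi divff // (theta_at1 p01) mulr0. Qed.

(** As a function of [x], the combination of the first and third terms vanishes at
    [a], so by [theta_space_unique] it is a multiple of [psi x a]; the factor is
    found by evaluation at [b]. *)
Lemma psi_pluecker (a b x y : CC) : a != 0 -> b != 0 -> x != 0 -> y != 0 ->
  psi a b != 0 ->
  psi x y * psi a b = psi x a * psi y b - psi x b * psi y a.
Proof.
move=> a0 b0 x0 y0 ab.
pose f z := psi a b * (theta p (y * z) * theta p (y^-1 * z)) +
            psi y a * (theta p (b * z) * theta p (b^-1 * z)).
have fE z : z != 0 -> f z = z * (psi a b * psi z y + psi y a * psi z b).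
  move=> z0; rewrite /f /psi (mulrC y z) (mulrC b z) (mulrC y^-1) (mulrC b^-1).
  set t1 := theta p (z * y); set t2 := theta p (z / y).
  set t3 := theta p (z * b); set t4 := theta p (z / b).
  set A := _ * theta p (a / b); set B := _ * theta p (y / a).
  by field.
have fV : theta_space p 2 1 f.
  apply: theta_space_lin.
    have -> : 1 = y * y^-1 by rewrite divff.
    by apply: (@theta_spaceM _ 1 1); apply: theta_space_theta; rewrite ?invr_eq0.
  have -> : 1 = b * b^-1 by rewrite divff.
  by apply: (@theta_spaceM _ 1 1); apply: theta_space_theta; rewrite ?invr_eq0.
have fa : forall z, z \in [:: a] -> f z = 0.
  by move=> z; rewrite inE => /eqP ->; rewrite fE // (psi_opp a0 y0); ring.
have := theta_space_unique p01 fV (xs := [:: a]).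
rewrite oner_eq0 /= a0 => /(_ isT erefl isT isT fa x b x0 b0).
have TE z : z != 0 -> theta p (1 * (\prod_(c <- [:: a]) c) * z) *
    \prod_(c <- [:: a]) theta p (z / c) = z * psi z a.
  by move=> z0; rewrite !big_seq1 mul1r /psi (mulrC a z) !mulrA mulfV // mul1r.
rewrite !TE // !fE // psi_self // mulr0 addr0 (psi_opp a0 b0) (psi_opp y0 b0) => H.
apply: (mulIf ab); apply: (mulIf b0); apply: (mulIf x0).
have H' : x * (psi a b * psi x y + psi y a * psi x b) * (b * - psi a b) =
  b * (psi a b * - psi y b) * (x * psi x a) by exact: H.
have E : (psi x y * psi a b) * psi a b * b * x =
  - (x * (psi a b * psi x y + psi y a * psi x b) * (b * - psi a b)) -
   psi x b * psi y a * psi a b * b * x by ring.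
by rewrite E H'; ring.
Qed.

End ThetaIdentities.

(** * Determinants over a field *)

Section Determinants.
Variable F : fieldType.

Lemma prod_pairs_recr (n : nat) (f : nat -> nat -> F) :
  \prod_(i < n.+1) \prod_(j < n.+1 | (i < j)%N) f i j =
  (\prod_(i < n) \prod_(j < n | (i < j)%N) f i j) * \prod_(i < n) f i n.
Proof.
rewrite big_ord_recr /= [X in _ * X]big_pred0 => [|j]; last by rewrite ltnNge -ltnS ltn_ord.
rewrite mulr1 -big_split; apply: eq_bigr => i _ /=.
by rewrite big_mkcond big_ord_recr /= ltn_ord -big_mkcond.
Qed.

Lemma prod_offdiag (n : nat) (f : nat -> nat -> F) :
  \prod_(i < n) \prod_(j < n | j != i) f i j =
  \prod_(i < n) \prod_(j < n | (i < j)%N) (f i j * f j i).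
Proof.
under [RHS]eq_bigr do rewrite big_split /=.
rewrite big_split /= [X in _ = _ * X](exchange_big_dep predT) //= -big_split /=.
apply: eq_bigr => i _.
rewrite (bigID (fun j : 'I_n => (i < j)%N)) /=; congr (_ * _); apply: eq_bigl => j.
  by rewrite -val_eqE /= neq_ltn; case: ltngtP.
by rewrite -val_eqE /= neq_ltn -leqNgt; case: ltngtP.
Qed.

Lemma prod_pairs_sym (n : nat) (f : nat -> F) :
  \prod_(i < n) \prod_(j < n | (i < j)%N) (f i * f j) = \prod_(i < n) f i ^+ n.-1.
Proof.
rewrite -(prod_offdiag n (fun i _ => f i)); apply: eq_bigr => i _.
by rewrite prodr_const cardC1 card_ord.
Qed.

Lemma prod_offdiag_swap (n : nat) (f : nat -> F) :
  \prod_(l < n) \prod_(k < n | k != l) f k = \prod_(k < n) f k ^+ n.-1.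
Proof.
rewrite (prod_offdiag n (fun _ j => f j)) -prod_pairs_sym.
by apply: eq_bigr => i _; apply: eq_bigr => j _; rewrite mulrC.
Qed.

Lemma det_scale (n : nat) (d e : 'I_n -> F) (A : 'I_n -> 'I_n -> F) :
  \det (\matrix_(i, j) (d i * e j * A i j)) =
  (\prod_i d i) * (\prod_j e j) * \det (\matrix_(i, j) A i j).
Proof.
rewrite (_ : \matrix_(i, j) _ = diag_mx (\row_i d i) *m
    (\matrix_(i, j) A i j) *m diag_mx (\row_j e j)); last first.
  by apply/matrixP => i j; rewrite mul_diag_mx mul_mx_diag !mxE; ring.
rewrite !det_mulmx !det_diag mulrAC; congr (_ * _ * _).
  by apply: eq_bigr => i _; rewrite mxE.
by apply: eq_bigr => i _; rewrite mxE.
Qed.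

Lemma det_eq_col (n : nat) (A : 'M[F]_n) (j k : 'I_n) : j != k ->
  (forall i, A i j = A i k) -> \det A = 0.
Proof.
move=> jk E; rewrite -det_tr (determinant_alternate jk) // => i.
by rewrite !mxE E.
Qed.

Lemma size_prod_offdiag (n : nat) (r : 'I_n -> F) (l : 'I_n) :
  (size (\prod_(k < n | k != l) ('X - (r k)%:P))%R <= n)%N.
Proof.
rewrite size_prod => [|k _]; last by rewrite polyXsubC_eq0.
under eq_bigr do rewrite size_XsubC.
rewrite sum_nat_const cardC1 card_ord muln2 -addnn subSn ?leq_addr // addnK.
by rewrite prednK //; case: l => m /=; exact: leq_ltn_trans.
Qed.

(** Write the entries as the values at [t i] of the Lagrange polynomials of
    [r]: the matrix is a Vandermonde matrix of [t] times a matrix of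
    coefficients, whose determinant is found by taking [t = r]. *)
Lemma det_lagrange (n : nat) (t r : nat -> F) :
  \det (\matrix_(i < n, l < n) \prod_(k < n | k != l) (t i - r k)) =
  (\prod_(i < n) \prod_(j < n | (i < j)%N) (t i - t j)) *
  \prod_(i < n) \prod_(j < n | (i < j)%N) (r j - r i).
Proof.
have [[i [j [ij rij]]]|distinct] :
    (exists i : 'I_n, exists j : 'I_n, (i < j)%N /\ r i = r j) \/
    (forall i j : 'I_n, (i < j)%N -> r j - r i != 0).
  have [/existsP[i /existsP[j /andP[ij /eqP rij]]]|/existsPn H] :=
      boolP [exists i : 'I_n, exists j : 'I_n, (i < j)%N && (r i == r j)].
    by left; exists i, j.
  right => i j ij; have /existsPn /(_ j) := H i.
  by rewrite ij /= subr_eq0 eq_sym.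
  rewrite (@det_eq_col _ _ i j) => [|| i']; last 2 first.
  - by rewrite -val_eqE neq_ltn ij.
  - rewrite !mxE (bigD1 j) /=; last by rewrite -val_eqE neq_ltn ij orbT.
    rewrite [RHS](bigD1 i) /=; last by rewrite -val_eqE neq_ltn ij.
    by rewrite rij; congr (_ * _); apply: eq_bigl => k; rewrite andbC.
  have Z : \prod_(i < n) \prod_(j < n | (i < j)%N) (r j - r i) = 0.
    by rewrite (bigD1 i) //= (bigD1 j) //= rij subrr !mul0r.
  by rewrite Z mulr0.
pose L (l : 'I_n) : {poly F} := \prod_(k < n | k != l) ('X - (r k)%:P).
pose C : 'M[F]_n := \matrix_(m, l) (L l)`_m.
have factor (u : nat -> F) :
    \matrix_(i < n, l < n) \prod_(k < n | k != l) (u i - r k) =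
    (Vandermonde n (\row_(i < n) u i))^T *m C.
  apply/matrixP => i l; rewrite !mxE.
  transitivity (L l).[u i].
    by rewrite horner_prod; apply: eq_bigr => k _; rewrite !hornerE.
  rewrite (horner_coef_wide _ (size_prod_offdiag r l)).
  by apply: eq_bigr => m _; rewrite !mxE mulrC.
have detV (u : nat -> F) : \det (Vandermonde n (\row_(i < n) u i))^T =
    \prod_(i < n) \prod_(j < n | (i < j)%N) (u j - u i).
  rewrite det_tr det_Vandermonde; apply: eq_bigr => i _; apply: eq_bigr => j _.
  by rewrite !mxE.
have Vr0 : \prod_(i < n) \prod_(j < n | (i < j)%N) (r j - r i) != 0.
  by apply/prodf_neq0 => i _; apply/prodf_neq0 => j ij; exact: distinct.
have detC : \det C = \prod_(i < n) \prod_(j < n | (i < j)%N) (r i - r j).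
  apply: (mulfI Vr0); rewrite -[in LHS]detV -det_mulmx -factor.
  rewrite (_ : \matrix_(i < n, l < n) _ =
      diag_mx (\row_l \prod_(k < n | k != l) (r l - r k))).
    rewrite det_diag; under eq_bigr do rewrite mxE.
    rewrite (prod_offdiag n (fun i j => r i - r j)).
    by rewrite -big_split; apply: eq_bigr => i _; rewrite -big_split; apply: eq_bigr => j _; rewrite mulrC.
  apply/matrixP => i l; rewrite !mxE; have [->|il] := eqVneq i l; first by rewrite mulr1n.
  by rewrite mulr0n (bigD1 i) //= subrr mul0r.
rewrite factor det_mulmx detV detC -!big_split; apply: eq_bigr => i _.
by rewrite -!big_split; apply: eq_bigr => j _ /=; ring.
Qed.

End Determinants.

(** * Determinants of theta functions *)

Section ThetaDeterminants.
Variable p : CC.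
Hypothesis p01 : 0 < `|p| < 1.

Let p0 : p != 0. Proof. by case/andP: p01; rewrite normr_gt0. Qed.

Lemma psi_neq0_sym (x b : CC) : x != 0 -> b != 0 -> theta p (x * b) != 0 ->
  theta p (x^-1 * b) != 0 -> psi p x b != 0.
Proof.
move=> x0 b0 h1 h2; have xb0 : x^-1 * b != 0 by rewrite mulf_neq0 ?invr_eq0.
rewrite /psi (_ : x / b = (x^-1 * b)^-1); last by field; rewrite x0 b0.
rewrite (thetaV p01 xb0) mulf_neq0 //; first by rewrite mulf_neq0 ?invr_eq0.
by rewrite mulf_neq0 // oppr_eq0 invr_eq0.
Qed.

Lemma generic_psi (l : seq CC) : all (fun b => b != 0) l ->
  exists2 b : CC, b != 0 & forall x, x \in l -> psi p x b != 0.
Proof.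
move=> l0.
have ll0 : all (fun b => b != 0) (l ++ map (@GRing.inv CC) l).
  by rewrite all_cat l0 all_map; apply: sub_all l0 => b /=; rewrite invr_eq0.
have [b b1] := generic_point p01 ll0; rewrite all_cat all_map => /andP[/allP h1 /allP h2].
have b0 : rc b != 0 by rewrite gt_eqF // rc_gt0 (lt_trans _ b1).
exists (rc b) => // x xl; apply: psi_neq0_sym => //.
- exact: (allP l0).
- exact: h1.
- exact: h2.
Qed.

(** For generic [a] and [b], [psi_pluecker] writes [psi x y] as
    [psi x b * psi y b / psi a b * (t x - t y)] with [t z = psi z a / psi z b];
    the outer factors are pulled out of the rows and columns, and [det_lagrange]
    remains. *)
Lemma det_psi (n : nat) (x c : nat -> CC) :
  (forall i, x i != 0) -> (forall i, c i != 0) ->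
  \det (\matrix_(i < n, l < n) \prod_(k < n | k != l) psi p (x i) (c k)) =
  (\prod_(i < n) \prod_(j < n | (i < j)%N) psi p (x i) (x j)) *
  \prod_(i < n) \prod_(j < n | (i < j)%N) psi p (c j) (c i).
Proof.
move=> x0 c0.
have l0 : all (fun b => b != 0) (mkseq x n ++ mkseq c n).
  by rewrite all_cat; apply/andP; split; apply/allP => _ /mapP[i _ ->].
have [b b0 bP] := generic_psi l0.
have b1 : all (fun b => b != 0) [:: b] by rewrite /= b0.
have [a a0 /(_ b (mem_head _ _)) ba] := generic_psi b1.
have K0 : psi p a b != 0 by rewrite psi_opp // oppr_eq0.
set K := psi p a b in K0.
have xb (i : 'I_n) : psi p (x i) b != 0.
  by apply: bP; rewrite mem_cat map_f // mem_iota /= add0n ltn_ord.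
have cb (i : 'I_n) : psi p (c i) b != 0.
  by apply: bP; rewrite mem_cat orbC map_f // mem_iota /= add0n ltn_ord.
pose tx i := psi p (x i) a / psi p (x i) b.
pose tc i := psi p (c i) a / psi p (c i) b.
have E (y z : CC) : y != 0 -> z != 0 -> psi p y b != 0 -> psi p z b != 0 ->
    psi p y z = psi p y b / K * psi p z b *
      (psi p y a / psi p y b - psi p z a / psi p z b).
  move=> y0 z0 yb zb; apply: (mulIf K0).
  by rewrite (psi_pluecker p01 a0 b0 y0 z0 K0) -/K; field; rewrite yb zb K0.
rewrite (_ : \matrix_(i < n, l < n) _ = \matrix_(i < n, l < n)
   ((psi p (x i) b / K) ^+ n.-1 * (\prod_(k < n | k != l) psi p (c k) b) *
    \prod_(k < n | k != l) (tx i - tc k))); last first.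
  apply/matrixP => i l; rewrite !mxE.
  under eq_bigr => k _ do rewrite (E _ _ (x0 i) (c0 k) (xb i) (cb k)).
  by rewrite big_split /= big_split /= prodr_const cardC1 card_ord.
rewrite det_scale det_lagrange (prod_offdiag_swap n (fun k => psi p (c k) b)).
rewrite -(prod_pairs_sym n (fun k => psi p (x k) b / K)).
rewrite -(prod_pairs_sym n (fun k => psi p (c k) b)).
rewrite -!big_split; apply: eq_bigr => i _.
rewrite -!big_split; apply: eq_bigr => j _ /=.
rewrite (E _ _ (x0 i) (x0 j) (xb i) (xb j)) (E _ _ (c0 j) (c0 i) (cb j) (cb i)).
by rewrite /tx /tc; field; rewrite K0 !xb !cb.
Qed.

Lemma theta_space_sum (n : nat) (s : CC) (m : nat) (k : 'I_m -> CC)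
    (F : 'I_m -> CC -> CC) : (forall i, theta_space p n s (F i)) ->
  theta_space p n s (fun y => \sum_i F i y * k i).
Proof.
move=> FV; split=> x x0.
  elim: (index_enum _) => [|i r IH].
    rewrite (_ : (fun y => _) = fun=> 0); first exact: hol_cst.
    by apply/funext => y; rewrite big_nil.
  rewrite (_ : (fun y => _) = fun y => F i y * k i + \sum_(j <- r) F j y * k j).
    by apply: holD => //; apply: holM; [exact: (FV i).1|exact: hol_cst].
  by apply/funext => y; rewrite big_cons.
rewrite mulr_sumr; apply: eq_bigr => i _.
by rewrite (FV i).2 // mulrA.
Qed.

Definition flag_fun (n : nat) (a : nat -> CC) (P : nat -> CC -> CC) (j : nat) (y : CC) : CC :=
  P j y * \prod_(j.+1 <= k < n) theta p (a k * y).

Lemma flag_fun_space (n : nat) (s : CC) (a : nat -> CC) (P : nat -> CC -> CC) (j : nat) :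
  (j < n)%N -> (forall i, a i != 0) ->
  theta_space p j.+1 (s / \prod_(j.+1 <= k < n) a k) (P j) ->
  theta_space p n s (flag_fun n a P j).
Proof.
move=> jn a0 PV; have := theta_spaceM PV (theta_space_prod p01 (index_iota j.+1 n) predT a0).
rewrite sum1_size size_iota subnKC //.
rewrite divfK // prodf_seq_neq0; apply/allP => i _; exact: a0.
Qed.

Lemma pairwise_mkseq (r : rel CC) (x : nat -> CC) (n : nat) :
  (forall i j, (i < j < n)%N -> r (x i) (x j)) -> pairwise r (mkseq x n).
Proof.
move=> H; rewrite pairwise_map.
have : pairwise ltn (iota 0 n) by rewrite -sorted_pairwise ?iota_ltn_sorted //; exact: ltn_trans.
have a : all (fun i => (i < n)%N) (iota 0 n) by apply/allP => i; rewrite mem_iota.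
refine (sub_in_pairwise _ a) => i j _; move=> jn ij.
by apply: H; apply/andP; split; [exact: ij|exact: jn].
Qed.

(** Induction on [n]. As a function of the last point, the determinant is a
    theta function of norm [s] that vanishes at the other points, so
    [theta_space_unique] compares its values at [x n] and at [(a n)^-1]. At the
    latter point all entries of the last row but one vanish, and the cofactor is
    a determinant of size [n] for the norm [s / a n]. *)
Lemma det_flag (n : nat) (s : CC) (a x : nat -> CC) (P : nat -> CC -> CC) :
  s != 0 -> (forall i, a i != 0) -> (forall i, x i != 0) ->
  (forall j, (j < n)%N -> theta_space p j.+1 (s / \prod_(j.+1 <= k < n) a k) (P j)) ->
  (forall i j, (i < j < n)%N -> theta p (x i / x j) != 0) ->
  (forall i m, (i < m < n)%N -> theta p (a m * x i) != 0) ->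
  (forall m, (m < n)%N ->
     theta p (s * (\prod_(0 <= i < m) x i) / \prod_(m <= k < n) a k) != 0) ->
  \det (\matrix_(i < n, j < n) flag_fun n a P j (x i)) *
    theta p (s / \prod_(0 <= k < n) a k) =
  theta p (s * \prod_(0 <= i < n) x i) * (\prod_(i < n) P i (1 / a i)) *
  \prod_(i < n) \prod_(j < n | (i < j)%N) (a j * x j * theta p (x i / x j)).
Proof.
move=> s0 a0 x0; elim: n s s0 => [|n IH] s s0 PV xd ax sx.
  by rewrite det_mx00 !big_ord0 !big_geq // divr1 !mulr1 mul1r.
pose f y := \det (\matrix_(i < n.+1, j < n.+1)
   flag_fun n.+1 a P j (if i == ord_max then y else x i)).
have fE : f = fun y => \sum_(j < n.+1) flag_fun n.+1 a P j y *
    cofactor (\matrix_(i < n.+1, j < n.+1) flag_fun n.+1 a P j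
      (if i == ord_max then 1 else x i)) ord_max j.
  apply/funext => y; rewrite /f (expand_det_row _ ord_max); apply: eq_bigr => j _.
  rewrite mxE eqxx; congr (_ * ((-1) ^+ _ * \det _)).
  apply/matrixP => i k; rewrite !mxE.
  by rewrite eq_sym (negPf (neq_lift _ _)).
have fV : theta_space p n.+1 s f.
  rewrite fE; apply: theta_space_sum => j; apply: flag_fun_space => //.
  exact: PV.
have fx i : (i < n)%N -> f (x i) = 0.
  move=> lin; rewrite /f (determinant_alternate (i1 := ord_max) (i2 := inord i)) //.
    by rewrite -val_eqE /= inordK ?(ltn_trans lin) // gtn_eqF.
  move=> j; rewrite !mxE eqxx -val_eqE /= inordK ?(ltn_trans lin) //.
  by rewrite (ltn_eqF lin).
have fD : f (x n) = \det (\matrix_(i < n.+1, j < n.+1) flag_fun n.+1 a P j (x i)).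
  congr (\det _); apply/matrixP => i j; rewrite !mxE.
  by case: eqP => [->|].
have an0 := a0 n.
pose s' := s / a n.
have s'0 : s' != 0 by rewrite mulf_neq0 ?invr_eq0.
have prA m : (m <= n)%N -> s' / \prod_(m <= k < n) a k = s / \prod_(m <= k < n.+1) a k.
  by move=> mn; rewrite big_nat_recr //= invfM /s'; ring.
have prA' m X : (m <= n)%N -> s' * X / \prod_(m <= k < n) a k = s * X / \prod_(m <= k < n.+1) a k.
  by move=> mn; rewrite mulrAC prA // mulrAC.
pose D' := \det (\matrix_(i < n, j < n) flag_fun n a P j (x i)).
have fa : f (a n)^-1 = P n (1 / a n) * ((\prod_(i < n) theta p (a n * x i)) * D').
  rewrite /f (expand_det_row _ ord_max) (bigD1 ord_max) //= big1 ?addr0 => [|j jn]; last first.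
    have jn' : (j < n)%N.
      by rewrite ltn_neqAle -ltnS ltn_ord andbT; move: jn; rewrite -val_eqE.
    rewrite !mxE eqxx /flag_fun big_nat_recr //= mulfV // (theta_at1 p01).
    by rewrite mulr0 mulr0 mul0r.
  rewrite !mxE eqxx /flag_fun big_geq // mulr1 div1r /cofactor; congr (_ * _).
  rewrite -signr_odd addnn odd_double mul1r.
  transitivity (\det (\matrix_(i < n, j < n)
      (theta p (a n * x i) * 1 * flag_fun n a P j (x i)))).
    congr (\det _); apply/matrixP => i j; rewrite !mxE.
    rewrite [lift _ i == _]eq_sym (negPf (neq_lift _ _)) !lift_max /flag_fun big_nat_recr //=.
    by rewrite mulr1; ring.
  by rewrite det_scale big1_eq mulr1.
have xs0 : all (fun b => b != 0) (mkseq x n) by apply/allP => _ /mapP[i _ ->].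
have xsp : pairwise (fun b b' => theta p (b / b') != 0) (mkseq x n).
  apply: (@pairwise_mkseq (fun b b' => theta p (b / b') != 0)) => i j /andP[ij jn].
  by apply: xd; rewrite ij ltnW.
have fxs (b : CC) : b \in mkseq x n -> f b = 0.
  case/mapP => i; rewrite mem_iota /= add0n => lin ->; exact: fx.
have xsz : (size (mkseq x n)).+1 = n.+1 by rewrite size_mkseq.
have an1 : (a n)^-1 != 0 by rewrite invr_eq0.
have mkE (g : CC -> CC) : \prod_(b <- mkseq x n) g b = \prod_(i < n) g (x i).
  by rewrite big_map -(big_mkord xpredT (fun i => g (x i))) /index_iota subn0.
have := theta_space_unique p01 fV s0 xsz xs0 xsp fxs (x0 n) an1.
rewrite fD fa /= (mkE id) (mkE (fun b => theta p ((a n)^-1 / b))).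
rewrite (mkE (fun b => theta p (x n / b))); set D := \det _.
have ax0 i : a n * x i != 0 by rewrite mulf_neq0.
have -> : \prod_(i < n) theta p ((a n)^-1 / x i) =
    (\prod_(i < n) theta p (a n * x i)) * \prod_(i < n) (- (a n * x i)^-1).
  rewrite -big_split; apply: eq_bigr => i _ /=.
  by rewrite -invfM (thetaV p01 (ax0 i)) mulrC.
have -> : \prod_(i < n) theta p (x n / x i) =
    (\prod_(i < n) (a n * x n * theta p (x i / x n))) * \prod_(i < n) (- (a n * x i)^-1).
  rewrite -big_split; apply: eq_bigr => i _ /=.
  rewrite -[x n / x i]invf_div (thetaV p01); last by rewrite mulf_neq0 ?invr_eq0.
  by field; rewrite an0 !x0.
have Q0 : \prod_(i < n) theta p (a n * x i) != 0.
  by apply/prodf_neq0 => i _; apply: ax; rewrite ltn_ord /=.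
have M0 : \prod_(i < n) (- (a n * x i)^-1) != 0.
  by apply/prodf_neq0 => i _; rewrite oppr_eq0 invr_eq0.
have T0 : theta p (s * (\prod_(i < n) x i) / a n) != 0.
  by have := sx n (ltnSn n); rewrite big_nat1 big_mkord.
have IHD : D' * theta p (s / \prod_(0 <= k < n.+1) a k) =
    theta p (s * (\prod_(i < n) x i) / a n) * \prod_(i < n) P i (1 / a i) *
    \prod_(i < n) \prod_(j < n | (i < j)%N) (a j * x j * theta p (x i / x j)).
  rewrite -prA // IH // ?big_mkord.
  - by rewrite (_ : s' * \prod_(i < n) x i = s * (\prod_(i < n) x i) / a n) // /s'; ring.
  - by move=> j jn; rewrite prA //; apply: PV; exact: ltnW.
  - by move=> i j /andP[ij jn]; apply: xd; rewrite ij ltnW.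
  - by move=> i m /andP[im mn]; apply: ax; rewrite im ltnW.
  by move=> m mn; rewrite prA' ?(ltnW mn) //; apply: sx; exact: ltnW.
rewrite (prod_pairs_recr n (fun i j => a j * x j * theta p (x i / x j))).
rewrite (big_mkord xpredT x) !big_ord_recr /=.
move: IHD Q0 M0 T0.
set t := theta p (s / _); set Q := \prod_(i < n) theta p _; set M := \prod_(i < n) (- _).
set T1 := theta p (s * _ / _); set V := \prod_(i < n) \prod_(j < n | _) _.
set PP := \prod_(i < n) P i _; set W := \prod_(i < n) (_ * _ * _).
set Th := theta p (s * (_ * x n)); move=> IHD Q0 M0 T0.
rewrite -[s * _ * x n]mulrA -/Th => U.
apply: (mulIf T0); apply: (mulIf Q0); apply: (mulIf M0).
have -> : D * t * T1 * Q * M = t * (D * (T1 * (Q * M))) by ring.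
rewrite U (_ : t * _ = P n (1 / a n) * Q * (D' * t) * (Th * (W * M))); last by ring.
by rewrite IHD; ring.
Qed.

End ThetaDeterminants.

(** * The formula for generic parameters *)

Section GenericFormula.
Variable p : CC.
Hypothesis p01 : 0 < `|p| < 1.

Let p0 : p != 0. Proof. by case/andP: p01; rewrite normr_gt0. Qed.

Variables (n : nat) (c : nat -> CC).
Hypothesis c0 : forall i, c i != 0.

(** The factors with [k != l] give the zeros needed for interpolation; the first
    factor adjusts the degree and the norm. *)
Definition node (l : nat) (y : CC) : CC :=
  theta p (- (y / c l)) * \prod_(k < n | (k : nat) != l) theta p (y / c k).

Definition antisym (F : CC -> CC) (y : CC) : CC :=
  y ^- n * (\prod_(k < n) theta p (c k * y)) * F y -
  y ^+ n * (\prod_(k < n) theta p (c k * y^-1)) * F y^-1.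

Let cprod_neq0 : \prod_(i < n) c i != 0. Proof. by apply/prodf_neq0. Qed.

Lemma node_space (l : 'I_n) : theta_space p n (- (\prod_(i < n) c i)^-1) (node l).
Proof.
have cV i : (c i)^-1 != 0 by rewrite invr_eq0.
have ncl : - (c l)^-1 != 0 by rewrite oppr_eq0.
have := theta_spaceM (theta_space_theta p01 ncl)
  (theta_space_prod p01 (index_enum 'I_n) (fun k : 'I_n => (k : nat) != l) (fun k => cV k)).
rewrite sum1_card.
have -> : #|(fun k : 'I_n => (k : nat) != l)| = n.-1.
  by rewrite -[n in RHS]card_ord -(cardC1 l); apply: eq_card => k; rewrite !inE.
rewrite add1n prednK; last by case: (l) => m; exact: leq_ltn_trans.
have -> : - (c l)^-1 * \prod_(k < n | (k : nat) != l) (c k)^-1 = - (\prod_(i < n) c i)^-1.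
  by rewrite mulNr -prodfV [in RHS](bigD1 l).
rewrite (_ : (fun x => _) = node l) //.
apply/funext => y; rewrite /node mulNr mulrC [y / _]mulrC mulrC; congr (_ * _).
by apply: eq_bigr => k _; rewrite mulrC.
Qed.

Lemma node_other (l m : 'I_n) : m != l -> node l (c m) = 0.
Proof.
move=> ml; rewrite /node (bigD1 m) //= divff // (theta_at1 p01) mul0r mulr0 //.
Qed.

Lemma node_self (l : nat) :
  node l (c l) = theta p (-1) * \prod_(k < n | (k : nat) != l) theta p (c l / c k).
Proof. by rewrite /node divff. Qed.

Hypothesis cd : forall i j, (i < j < n)%N -> theta p (c i / c j) != 0.

Lemma distinct_sym (i j : 'I_n) : i != j -> theta p (c i / c j) != 0.
Proof.
rewrite -val_eqE neq_ltn => /orP[ij|ji].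
  by apply: cd; rewrite ij ltn_ord.
have E : theta p (c j / c i) != 0 by apply: cd; rewrite ji ltn_ord.
rewrite -[c i / c j]invf_div (thetaV p01); last by rewrite mulf_neq0 ?invr_eq0.
by rewrite mulf_neq0 // oppr_eq0 invr_eq0 mulf_neq0 ?invr_eq0.
Qed.

Lemma node_self_neq0 (l : 'I_n) : node l (c l) != 0.
Proof.
rewrite node_self mulf_neq0 ?(theta_opp1_neq0 p01) //.
by apply/prodf_neq0 => k kl; apply: distinct_sym; rewrite eq_sym.
Qed.

(** Both sides lie in the same space and agree at the [n] points [c k]; the
    product of these points is not that of the zeros of a nonzero function of the
    space because [theta p (-1) != 0]. *)
Lemma theta_interpolation (F : CC -> CC) (y : CC) :
  theta_space p n (- (\prod_(i < n) c i)^-1) F -> y != 0 ->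
  F y = \sum_(l < n) node l y * (F (c l) / node l (c l)).
Proof.
move=> FV y0; set s := - _ in FV *.
have s0 : s != 0 by rewrite oppr_eq0 invr_eq0.
pose S y := \sum_(l < n) node l y * (F (c l) / node l (c l)).
have SV : theta_space p n s S by apply: theta_space_sum => l; exact: node_space.
have gV := theta_space_lin 1 (-1) FV SV.
have bs0 : all (fun b => b != 0) (mkseq c n) by apply/allP => _ /mapP[i _ ->].
have bsp : pairwise (fun b b' => theta p (b / b') != 0) (mkseq c n).
  by apply: (@pairwise_mkseq (fun b b' => theta p (b / b') != 0)) => i j; exact: cd.
have bsz : forall b : CC, b \in mkseq c n -> 1 * F b + -1 * S b = 0.
  move=> b; case/mapP => i; rewrite mem_iota add0n /= => lin ->.
  rewrite /S (bigD1 (Ordinal lin)) //= big1 ?addr0 => [|l li]; last first.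
    by rewrite (@node_other l (Ordinal lin)) ?mul0r // eq_sym.
  have nz := node_self_neq0 (Ordinal lin).
  by rewrite mul1r mulN1r [node _ _ * _]mulrC divfK ?subrr.
have th : theta p (s * \prod_(b <- mkseq c n) b) != 0.
  rewrite big_map -/(index_iota 0 n).
  have -> : \prod_(j <- iota 0 n) c j = \prod_(i < n) c i.
    by rewrite -(big_mkord xpredT) /index_iota subn0.
  by rewrite /s mulNr mulVf // theta_opp1_neq0.
have := theta_space_vanish p01 gV s0 (size_mkseq _ _) bs0 bsp bsz th y0.
by rewrite mul1r mulN1r => /eqP; rewrite subr_eq0 => /eqP.
Qed.

(** The factors with [k != l] are, up to a power of [y], invariant under
    [y -> y^-1]; what remains is the antisymmetrization of the factor [l], which
    is [theta_three_term]. *)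
Lemma antisym_node (l : 'I_n) (y : CC) : y != 0 ->
  antisym (node l) y = (y^-1 * theta (p ^+ 2) (y ^+ 2)) *
    (theta p (-1) * theta (p ^+ 2) (p * c l ^+ 2)) *
    \prod_(k < n | k != l) psi p y (c k).
Proof.
move=> y0.
have n0 : (0 < n)%N by case: (l) => m; exact: leq_ltn_trans.
have refl k : theta p (c k * y^-1) * theta p (y^-1 / c k) =
    y ^- 2 * (theta p (c k * y) * theta p (y / c k)).
  have cy : c k * y != 0 by rewrite mulf_neq0.
  have yc : y / c k != 0 by rewrite mulf_neq0 ?invr_eq0.
  have e : y^-1 / c k = (c k * y)^-1 by rewrite invfM mulrC.
  rewrite -[c k * y^-1]invf_div (thetaV p01 yc) e (thetaV p01 cy).
  by field; rewrite c0 y0.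
have reflN : theta p (c l * y^-1) * theta p (- (y^-1 / c l)) =
    - (y ^- 2 * (theta p (y / c l) * theta p (- (c l * y)))).
  have cy : c l * y != 0 by rewrite mulf_neq0.
  have yc : y / c l != 0 by rewrite mulf_neq0 ?invr_eq0.
  have e : y^-1 / c l = (c l * y)^-1 by rewrite invfM mulrC.
  rewrite -[c l * y^-1]invf_div (thetaV p01 yc) e (thetaVN p01 cy).
  by field; rewrite c0 y0.
rewrite /antisym /node [in X in X * _ - _](bigD1 l) //= [in X in _ - X * _](bigD1 l) //=.
set A1 := \prod_(k < n | k != l) theta p (c k * y).
set A2 := \prod_(k < n | k != l) theta p (c k * y^-1).
rewrite -/(\prod_(k < n | k != l) theta p (y / c k)).
set B1 := \prod_(k < n | k != l) theta p (y / c k).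
set B2 := \prod_(k < n | k != l) theta p (y^-1 / c k).
have AB : A2 * B2 = (y ^- 2) ^+ n.-1 * (A1 * B1).
  rewrite /A2 /B2 /A1 /B1 -!big_split /=; under eq_bigr do rewrite refl.
  by rewrite big_split /= prodr_const cardC1 card_ord.
have PE : \prod_(k < n | k != l) psi p y (c k) = y^-1 ^+ n.-1 * (A1 * B1).
  rewrite /A1 /B1 -big_split /psi /=; under eq_bigr do rewrite -mulrA.
  rewrite big_split /= prodr_const cardC1 card_ord; congr (_ * _).
  by apply: eq_bigr => k _; rewrite (mulrC y (c k)).
rewrite PE.
have T := theta_three_term p01 (c0 l) y0.
have -> : y ^- n = y^-1 * y^-1 ^+ n.-1 by rewrite -exprVn -exprS prednK.
transitivity (y^-1 * y^-1 ^+ n.-1 * (A1 * B1) *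
    (theta p (c l * y) * theta p (- (y / c l))) -
  y ^+ n * (A2 * B2) * (theta p (c l * y^-1) * theta p (- (y^-1 / c l)))).
  by ring.
rewrite AB reflN.
have -> : y ^+ n * ((y ^- 2) ^+ n.-1 * (A1 * B1)) =
    y * y^-1 ^+ n.-1 * (A1 * B1).
  have h : y ^+ n.-1 * y^-1 ^+ n.-1 = 1 by rewrite -exprMn mulfV // expr1n.
  have yn : y ^+ n = y * y ^+ n.-1 by rewrite -exprS prednK.
  rewrite yn -exprVn exprAC.
  transitivity (y * y^-1 ^+ n.-1 * (y ^+ n.-1 * y^-1 ^+ n.-1) * (A1 * B1)); first by ring.
  by rewrite h mulr1.
transitivity (y^-1 * y^-1 ^+ n.-1 * (A1 * B1) *
   (theta p (c l * y) * theta p (- (y / c l)) + theta p (y / c l) * theta p (- (c l * y)))).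
  by field; rewrite y0.
by rewrite T; ring.
Qed.

(** Interpolation at the points [c k] factors the matrix as the matrix of the
    antisymmetrized nodes, whose determinant is given by [det_psi], times the
    matrix of the values at the points [c k], whose determinant is given by
    [det_flag]. *)
Theorem antisym_det_generic (x a : nat -> CC) (P : nat -> CC -> CC) :
  (forall i, x i != 0) -> (forall i, a i != 0) ->
  (forall i m, (i < m < n)%N -> theta p (a m * c i) != 0) ->
  (forall m, (m < n)%N ->
     theta p (- (\prod_(i < n) c i)^-1 * (\prod_(0 <= i < m) c i)
              / \prod_(m <= k < n) a k) != 0) ->
  theta p (- ((\prod_(i < n) c i) * \prod_(i < n) a i)) != 0 ->
  (forall j, (j < n)%N -> theta_space p j.+1
     (- (\prod_(i < n) c i)^-1 / \prod_(j.+1 <= k < n) a k) (P j)) ->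
  \det (\matrix_(i < n, j < n) antisym (flag_fun p n a P j) (x i)) =
  (\prod_(i < n) a i) * (\prod_(i < n) c i) * theta p (- 1)
      / theta p (- ((\prod_(i < n) c i) * \prod_(i < n) a i))
    * (\prod_(i < n) P i (1 / a i))
    * (\prod_(i < n) theta (p ^+ 2) (p * c i ^+ 2))
    * (\prod_(i < n) \prod_(j < n | (i < j)%N) theta p (c i * c j))
    * (\prod_(i < n) ((x i)^-1 * theta (p ^+ 2) (x i ^+ 2)))
    * (\prod_(i < n) \prod_(j < n | (i < j)%N)
         (a j * (x i)^-1 * theta_pm p (x i) (x j))).
Proof.
move=> x0 a0 ac cs t0 PV.
set C := \prod_(i < n) c i; set A := \prod_(i < n) a i in t0 *.
have A0 : A != 0 by apply/prodf_neq0.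
have s0 : - C^-1 != 0 by rewrite oppr_eq0 invr_eq0.
have FV (j : 'I_n) : theta_space p n (- C^-1) (flag_fun p n a P j).
  by apply: flag_fun_space => //; exact: PV.
have -> : \matrix_(i < n, j < n) antisym (flag_fun p n a P j) (x i) =
    (\matrix_(i < n, l < n) ((x i)^-1 * theta (p ^+ 2) (x i ^+ 2) *
      (theta p (-1) * theta (p ^+ 2) (p * c l ^+ 2)) *
      \prod_(k < n | k != l) psi p (x i) (c k))) *m
    (\matrix_(l < n, j < n) ((node l (c l))^-1 * 1 * flag_fun p n a P j (c l))).
  apply/matrixP => i j; rewrite !mxE.
  have xV0 : (x i)^-1 != 0 by rewrite invr_eq0.
  rewrite /antisym (theta_interpolation (FV j) (x0 i)) (theta_interpolation (FV j) xV0).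
  rewrite !mulr_sumr -sumrB; apply: eq_bigr => l _; rewrite !mxE -(antisym_node l (x0 i)).
  by rewrite /antisym; ring.
rewrite det_mulmx !det_scale det_psi // big1_eq mulr1.
have := det_flag p01 s0 a0 c0 PV cd ac cs.
set D := \det _.
have C0 : C != 0 := cprod_neq0.
have CA0 : C * A != 0 by rewrite mulf_neq0.
have e1 : - C^-1 * C = -1 by rewrite mulNr mulVf.
have e2 : - C^-1 / A = - (C * A)^-1 by rewrite invfM mulNr.
rewrite !big_mkord -/C -/A e1 e2 (thetaVN p01 CA0) => DE.
have m10 := theta_opp1_neq0 p01.
have nodeE : \prod_(l < n) (node l (c l))^-1 = (theta p (-1) ^+ n)^-1 *
    \prod_(i < n) \prod_(j < n | (i < j)%N) (theta p (c i / c j) * theta p (c j / c i))^-1.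
  under [X in _ = _ * X]eq_bigr do rewrite prodfV.
  rewrite !prodfV -invfM; congr (_^-1).
  under eq_bigr do rewrite node_self.
  rewrite big_split /= prodr_const card_ord; congr (_ * _).
  exact: (prod_offdiag n (fun i j => theta p (c i / c j))).
have e3 : \prod_(l < n) (theta p (-1) * theta (p ^+ 2) (p * c l ^+ 2)) =
    theta p (-1) ^+ n * \prod_(l < n) theta (p ^+ 2) (p * c l ^+ 2).
  by rewrite big_split /= prodr_const card_ord.
rewrite nodeE e3.
set Xs := \prod_(i < n) (_^-1 * _); set Cs := \prod_(i < n) theta (p ^+ 2) _.
set Px := \prod_(i < n) \prod_(j < n | _) psi p (x i) (x j).
set Pc := \prod_(i < n) \prod_(j < n | _) psi p (c j) (c i).
set Q := \prod_(i < n) \prod_(j < n | _) (_ * _)^-1.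
set V := \prod_(i < n) \prod_(j < n | _) (_ * _ * _) in DE.
set PP := \prod_(i < n) P i _ in DE *.
set R1 := \prod_(i < n) \prod_(j < n | _) theta p (c i * c j).
set R2 := \prod_(i < n) \prod_(j < n | _) (_ * theta_pm _ _ _).
have key : Px * Pc * Q * V = R1 * R2.
  rewrite /Px /Pc /Q /V /R1 /R2 -!big_split; apply: eq_bigr => i _.
  rewrite -!big_split; apply: eq_bigr => j ij /=.
  have d1 : theta p (c i / c j) != 0 by apply: cd; rewrite ij ltn_ord.
  have d2 : theta p (c j / c i) != 0.
    by apply: distinct_sym; rewrite -val_eqE gtn_eqF.
  rewrite /psi /theta_pm (mulrC (c j) (c i)).
  by field; rewrite d1 d2 x0 c0.
set T := theta p (- (C * A)) in t0 DE *.
have D' : D = (C * A) * theta p (-1) / T * (PP * V).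
  have cT : (C * A)^-1 * T != 0 by rewrite mulf_neq0 // invr_eq0.
  by apply: (mulIf cT); rewrite DE; field; rewrite t0 A0 C0.
rewrite D' -[RHS]mulrA.
transitivity (A * C * theta p (-1) / T * PP * Cs * Xs * (Px * Pc * Q * V)).
  field; rewrite t0 expf_neq0 //.
by rewrite key; ring.
Qed.

End GenericFormula.

(** * Removal of the genericity conditions *)

Lemma hol_exp (f : CC -> CC) (k : nat) (x : CC) : hol f x -> hol (fun z => f z ^+ k) x.
Proof.
move=> fx; elim: k => [|k IH].
  rewrite (_ : (fun z => _) = fun=> 1); first exact: hol_cst.
  by apply/funext => z; rewrite expr0.
rewrite (_ : (fun z => _) = fun z => f z * f z ^+ k); first exact: holM.
by apply/funext => z; rewrite exprS.
Qed.

Lemma hol_sum (I : Type) (r : seq I) (F : I -> CC -> CC) (x : CC) :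
  (forall i, hol (F i) x) -> hol (fun z => \sum_(i <- r) F i z) x.
Proof.
move=> H; elim: r => [|i r IH].
  rewrite (_ : (fun z => _) = fun=> 0); first exact: hol_cst.
  by apply/funext => z; rewrite big_nil.
rewrite (_ : (fun z => _) = fun z => F i z + \sum_(j <- r) F j z); first exact: holD.
by apply/funext => z; rewrite big_cons.
Qed.

Lemma hol_det (n : nat) (A : 'I_n -> 'I_n -> CC -> CC) (x : CC) :
  (forall i j, hol (A i j) x) -> hol (fun z => \det (\matrix_(i, j) A i j z)) x.
Proof.
move=> H; rewrite (_ : (fun z => _) = fun z => \sum_(s : {perm 'I_n})
    (-1) ^+ s * \prod_i A i (s i) z).
  apply: hol_sum => s; apply: holM; first exact: hol_cst.
  by apply: hol_prod.
apply/funext => z; rewrite /determinant; apply: eq_bigr => s _.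
by congr (_ * _); apply: eq_bigr => i _; rewrite mxE.
Qed.

Lemma hol_theta (q : CC) (f : CC -> CC) (x : CC) : 0 < `|q| < 1 ->
  hol f x -> f x != 0 -> hol (fun z => theta q (f z)) x.
Proof.
by move=> q01 fx fx0; apply: (@hol_comp (theta q) f) => //; exact: theta_hol.
Qed.

(** If [Phi 1] were not 0, then [Phi] would have no zeros near 1. *)
Lemma hol_zero_right (Phi : CC -> CC) : hol Phi 1 ->
  (\forall z \near (1 : CC), 1 < z -> Phi z = 0)%classic -> Phi 1 = 0.
Proof.
move=> Ph Pz; apply/eqP; apply/negPn/negP => P1.
have Pn := hol_near_neq0 Ph P1.
have [x x1] : exists2 x : RR, 1 < x & (1 < rc x -> False).
  apply: (@near_one_real (fun z => 1 < z -> False)).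
  near=> z => _ z1.
  have h1 : Phi z != 0 by near: z.
  have h2 : Phi z = 0 by move: z1; near: z.
  by rewrite h2 eqxx in h1.
by apply; rewrite -rc1 ltr_rc.
Unshelve. all: by end_near.
Qed.

Lemma near_sub (P Q : CC -> Prop) (x : CC) : (forall z, P z -> Q z) ->
  (\forall z \near x, P z)%classic -> (\forall z \near x, Q z)%classic.
Proof. by move=> PQ; apply: (@filterS _ _ (nbhs_filter x)). Qed.

Lemma near_forall (I : finType) (P : I -> CC -> Prop) (x : CC) :
  (forall i, (\forall z \near x, P i z)%classic) ->
  (\forall z \near x, forall i, P i z)%classic.
Proof. exact: (@filter_forall _ I P _ (nbhs_filter x)). Qed.

Lemma theta_near_curve (q b : CC) (h : CC -> CC) : 0 < `|q| < 1 -> b != 0 ->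
  hol h 1 -> h 1 = 1 -> (forall z, 1 < z -> h z != 1) ->
  (\forall z \near (1 : CC), 1 < z -> theta q (b * h z) != 0)%classic.
Proof.
move=> q01 b0 hh h1 hz; have := theta_near_neq0 q01 b0.
rewrite -{1}h1 => Hn; have := hol_cont hh Hn.
by apply: near_sub => z H z1; apply: H; exact: hz.
Qed.

Section Deformation.
Variable n : nat.

(** For [z > 1] and at least two indices, the factors [twist i z] are pairwise
    distinct and different from 1, their product is 1, and no shorter nonempty
    initial product is 1. The factor 0 compensates the others, so that the first
    [m] factors have as product the inverse of the remaining ones; [twist_exp m]
    is the exponent of the latter. *)
Definition twist_exp (m : nat) : nat := (\sum_(m <= i < n) i)%N.

Definition twist (i : nat) (z : CC) : CC :=
  if i == 0%N then z^-1 ^+ twist_exp 0 else z ^+ i.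

Lemma twist_prod (m : nat) (z : CC) : z != 0 -> (0 < m <= n)%N ->
  \prod_(0 <= i < m) twist i z = z^-1 ^+ twist_exp m.
Proof.
move=> z0; elim: m => // m IH /andP[_ mn].
case: m IH mn => [|m] IH mn.
  by rewrite big_nat1 /twist /= /twist_exp (big_ltn mn) add0n.
rewrite big_nat_recr //= IH /=; last by rewrite ltnW.
rewrite {2}/twist_exp -/(twist_exp m.+2) /twist_exp (big_ltn mn) exprD mulrAC.
by rewrite /twist /= -exprMn mulVf // expr1n mul1r.
Qed.

Lemma twist_prod_full (z : CC) : z != 0 -> \prod_(i < n) twist i z = 1.
Proof.
move=> z0; rewrite -(big_mkord xpredT (fun i => twist i z)).
case: (posnP n) => [->|n0]; first by rewrite big_geq.
by rewrite twist_prod // ?n0 ?leqnn // /twist_exp big_geq.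
Qed.

Lemma twist_at1 (i : nat) : twist i 1 = 1.
Proof. by rewrite /twist invr1 !expr1n if_same. Qed.

Lemma twist_neq0 (i : nat) (z : CC) : z != 0 -> twist i z != 0.
Proof. by move=> z0; rewrite /twist; case: ifP => _; rewrite expf_neq0 ?invr_eq0. Qed.

Lemma twist_hol (i : nat) : hol (twist i) 1.
Proof.
rewrite /twist; case: (i == 0%N); apply: hol_exp; last exact: hol_id.
by apply: holV; [exact: oner_neq0|exact: hol_id].
Qed.

Lemma twist_exp_gt0 (m : nat) : (0 < m < n)%N -> (0 < twist_exp m)%N.
Proof. by case/andP=> m0 mn; rewrite /twist_exp (big_ltn mn) addn_gt0 m0. Qed.

Lemma expr_gt1_neq1 (z : CC) (k : nat) : 1 < z -> (0 < k)%N -> z ^+ k != 1.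
Proof. by move=> z1 k0; rewrite gt_eqF // exprn_egt1 // -lt0n. Qed.

Lemma exprV_gt1_neq1 (z : CC) (k : nat) : 1 < z -> (0 < k)%N -> z^-1 ^+ k != 1.
Proof.
by move=> z1 k0; rewrite exprVn invr_eq1 expr_gt1_neq1.
Qed.

Lemma twist_exp0_gt0 (j : nat) : (0 < j < n)%N -> (0 < twist_exp 0)%N.
Proof.
case/andP=> j0 jn; rewrite /twist_exp (big_ltn (ltn_trans j0 jn)) add0n.
have n1 : (1 < n)%N by apply: leq_ltn_trans jn.
by rewrite (big_ltn n1).
Qed.

Lemma twist_neq1 (i m : nat) (z : CC) : (i < m < n)%N -> 1 < z -> twist i z != 1.
Proof.
case/andP=> im mn z1; rewrite /twist; case: ifP => i0.
  apply: exprV_gt1_neq1 => //; apply: (@twist_exp0_gt0 m).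
  by rewrite mn andbT (leq_ltn_trans _ im).
by apply: expr_gt1_neq1 => //; rewrite lt0n i0.
Qed.

Lemma twist_ratio_neq1 (i j : nat) (z : CC) : (i < j < n)%N -> 1 < z ->
  twist i z / twist j z != 1.
Proof.
case/andP=> ij jn z1; have z0 : z != 0 by rewrite gt_eqF // (lt_trans ltr01).
have j0 : (0 < j)%N by apply: leq_ltn_trans ij.
rewrite /twist [j == 0%N]eqn0Ngt j0 /=; case: ifP => i0.
  rewrite -exprVn -exprD; apply: exprV_gt1_neq1 => //.
  by rewrite addn_gt0 j0 orbT.
rewrite -(subnKC (ltnW ij)) exprD invfM mulrA mulfV ?expf_neq0 // mul1r -exprVn.
by apply: exprV_gt1_neq1 => //; rewrite subn_gt0.
Qed.

Lemma twist_prod_neq1 (m : nat) (z : CC) : (0 < m < n)%N -> 1 < z ->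
  \prod_(0 <= i < m) twist i z != 1.
Proof.
move=> mn z1; have z0 : z != 0 by rewrite gt_eqF // (lt_trans ltr01).
case/andP: (mn) => m0 mn'; rewrite twist_prod ?m0 ?(ltnW mn') //.
by apply: exprV_gt1_neq1 => //; exact: twist_exp_gt0.
Qed.

End Deformation.

Lemma hol_prod_nat (a b : nat) (F : nat -> CC -> CC) (x : CC) :
  (forall i, hol (F i) x) -> hol (fun z => \prod_(a <= i < b) F i z) x.
Proof. by move=> H; apply: hol_prod. Qed.

(** Both sides depend holomorphically on the [c i]. Along the curve
    [c i * twist n i z] the product of the [c i] is constant, so the hypotheses on
    [P] are preserved, and all the conditions of [antisym_det_generic] hold for
    [z > 1] close to 1; hence the difference of the two sides vanishes at
    [z = 1]. *)
Theorem antisym_det (p : CC) (n : nat) (x a c : nat -> CC)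
    (P : nat -> CC -> CC) :
  0 < `|p| < 1 ->
  (forall i, x i != 0) -> (forall i, a i != 0) -> (forall i, c i != 0) ->
  theta p (- ((\prod_(i < n) c i) * \prod_(i < n) a i)) != 0 ->
  (forall j, (j < n)%N -> theta_space p j.+1
     (- (\prod_(i < n) c i)^-1 / \prod_(j.+1 <= k < n) a k) (P j)) ->
  \det (\matrix_(i < n, j < n) antisym p n c (flag_fun p n a P j) (x i)) =
  (\prod_(i < n) a i) * (\prod_(i < n) c i) * theta p (- 1)
      / theta p (- ((\prod_(i < n) c i) * \prod_(i < n) a i))
    * (\prod_(i < n) P i (1 / a i))
    * (\prod_(i < n) theta (p ^+ 2) (p * c i ^+ 2))
    * (\prod_(i < n) \prod_(j < n | (i < j)%N) theta p (c i * c j))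
    * (\prod_(i < n) ((x i)^-1 * theta (p ^+ 2) (x i ^+ 2)))
    * (\prod_(i < n) \prod_(j < n | (i < j)%N)
         (a j * (x i)^-1 * theta_pm p (x i) (x j))).
Proof.
move=> p01 x0 a0 c0 t0 PV.
have p0 : p != 0 by case/andP: p01; rewrite normr_gt0.
have q01 : 0 < `|p ^+ 2| < 1.
  by case/andP: p01 => np p1; rewrite normrX exprn_gt0 // exprn_ilt1.
pose cz (z : CC) (i : nat) := c i * twist n i z.
have czh i : hol (fun z => cz z i) 1.
  by apply: holM; [exact: hol_cst|exact: twist_hol].
have cz1 i : cz 1 i = c i by rewrite /cz twist_at1 mulr1.
have czn0 z i : z != 0 -> cz z i != 0 by move=> z0; rewrite mulf_neq0 ?twist_neq0.
have czP z : z != 0 -> \prod_(i < n) cz z i = \prod_(i < n) c i.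
  by move=> z0; rewrite big_split /= twist_prod_full // mulr1.
pose K := (\prod_(i < n) a i) * (\prod_(i < n) c i) * theta p (- 1)
      / theta p (- ((\prod_(i < n) c i) * \prod_(i < n) a i))
    * (\prod_(i < n) P i (1 / a i)).
pose K' := (\prod_(i < n) ((x i)^-1 * theta (p ^+ 2) (x i ^+ 2)))
    * (\prod_(i < n) \prod_(j < n | (i < j)%N)
         (a j * (x i)^-1 * theta_pm p (x i) (x j))).
pose Phi z :=
  \det (\matrix_(i < n, j < n) antisym p n (cz z) (flag_fun p n a P j) (x i)) -
  K * (\prod_(i < n) theta (p ^+ 2) (p * cz z i ^+ 2)) *
  (\prod_(i < n) \prod_(j < n | (i < j)%N) theta p (cz z i * cz z j)) * K'.
suff P1 : Phi 1 = 0.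
  have czE : cz 1 = c by apply/funext => i; exact: cz1.
  move/eqP: P1; rewrite /Phi czE subr_eq0 => /eqP ->.
  by rewrite /K /K' !mulrA.
have cth b i : b != 0 -> hol (fun z => theta p (cz z i * b)) 1.
  move=> b0; apply: hol_theta => //; last by rewrite cz1 mulf_neq0.
  by apply: holM => //; exact: hol_cst.
apply: hol_zero_right.
  apply: holB.
    apply: hol_det => i j; rewrite /antisym.
    have ent (k y b : CC) : y != 0 ->
        hol (fun z => k * (\prod_(k < n) theta p (cz z k * y)) * b) 1.
      move=> y0; apply: holM; last exact: hol_cst.
      apply: holM; first exact: hol_cst.
      by apply: hol_prod => l _; exact: cth.
    by apply: holB; apply: ent; rewrite ?invr_eq0.
  apply: holM; last exact: hol_cst.
  apply: holM; first apply: holM; first exact: hol_cst.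
    apply: hol_prod => i _; apply: hol_theta => //.
      by apply: holM; [exact: hol_cst|exact: hol_exp].
    by rewrite cz1 mulf_neq0 // expf_neq0.
  apply: hol_prod => i _; apply: hol_prod => j _; apply: hol_theta => //.
    exact: holM.
  by rewrite !cz1 mulf_neq0.
have near1 : (\forall z \near (1 : CC), forall i j : 'I_n, 1 < z -> (i < j)%N ->
    theta p (cz z i / cz z j) != 0)%classic.
  apply: near_forall => i; apply: near_forall => j.
  have [ij|ji] := ltnP i j; last by near=> z.
  have ijn : (i < j < n)%N by rewrite ij /=.
  have cc0 : c i / c j != 0 by rewrite mulf_neq0 ?invr_eq0.
  have hh : hol (fun z => twist n i z / twist n j z) 1.
    apply: holM; first exact: twist_hol.
    by apply: holV; [rewrite twist_at1 oner_neq0|exact: twist_hol].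
  have h1 : twist n i 1 / twist n j 1 = 1 by rewrite !twist_at1 divr1.
  have := theta_near_curve p01 cc0 hh h1 (fun z => twist_ratio_neq1 ijn).
  apply: near_sub => z H z1 _.
  by rewrite /cz invfM mulrACA; exact: H.
have near2 : (\forall z \near (1 : CC), forall i m : 'I_n, 1 < z -> (i < m)%N ->
    theta p (a m * cz z i) != 0)%classic.
  apply: near_forall => i; apply: near_forall => m.
  have [im|mi] := ltnP i m; last by near=> z.
  have imn : (i < m < n)%N by rewrite im /=.
  have ac0 : a m * c i != 0 by rewrite mulf_neq0.
  have := theta_near_curve p01 ac0 (twist_hol n i) (twist_at1 n i) (fun z => twist_neq1 imn).
  apply: near_sub => z H z1 _.
  by rewrite /cz mulrA; exact: H.
have near3 : (\forall z \near (1 : CC), forall m : 'I_n, 1 < z -> (0 < m)%N ->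
    theta p (- (\prod_(i < n) c i)^-1 * (\prod_(0 <= i < m) cz z i)
              / \prod_(m <= k < n) a k) != 0)%classic.
  apply: near_forall => m; case: (posnP m) => [m0|m0]; first by near=> z; rewrite m0.
  have mn : (0 < m < n)%N by rewrite m0 /=.
  have b0 : - (\prod_(i < n) c i)^-1 * (\prod_(0 <= i < m) c i) / \prod_(m <= k < n) a k != 0.
    rewrite mulf_neq0 ?invr_eq0 //; last by rewrite prodf_seq_neq0; apply/allP => k _; exact: a0.
    rewrite mulf_neq0 ?oppr_eq0 ?invr_eq0 //; first by apply/prodf_neq0 => k _.
    by rewrite prodf_seq_neq0; apply/allP => k _; exact: c0.
  have hh : hol (fun z => \prod_(0 <= i < m) twist n i z) 1.
    by apply: hol_prod_nat => i; exact: twist_hol.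
  have h1 : \prod_(0 <= i < m) twist n i 1 = 1.
    by apply: big1 => i _; exact: twist_at1.
  have := theta_near_curve p01 b0 hh h1 (fun z => twist_prod_neq1 mn).
  apply: near_sub => z H z1 _.
  have := H z1; congr (is_true (theta p _ != 0)).
  by rewrite /cz big_split /=; ring.
near=> z => z1; have z0 : z != 0 by rewrite gt_eqF // (lt_trans ltr01).
have N1 : forall i j : 'I_n, 1 < z -> (i < j)%N -> theta p (cz z i / cz z j) != 0 by near: z.
have N2 : forall i m : 'I_n, 1 < z -> (i < m)%N -> theta p (a m * cz z i) != 0 by near: z.
have N3 : forall m : 'I_n, 1 < z -> (0 < m)%N ->
    theta p (- (\prod_(i < n) c i)^-1 * (\prod_(0 <= i < m) cz z i)
              / \prod_(m <= k < n) a k) != 0 by near: z.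
rewrite /Phi (@antisym_det_generic p p01 n (cz z)) ?czP //.
- by rewrite -/K; apply/eqP; rewrite subr_eq0 /K' !mulrA.
- by move=> i; exact: czn0.
- move=> i j /andP[ij jn].
  by have := N1 (Ordinal (ltn_trans ij jn)) (Ordinal jn) z1 ij.
- move=> i m /andP[im mn].
  by have := N2 (Ordinal (ltn_trans im mn)) (Ordinal mn) z1 im.
move=> m mn; case: (posnP m) => [->|m0]; last exact: (N3 (Ordinal mn) z1 m0).
rewrite (big_geq (leqnn 0)) mulr1 big_mkord.
set C := \prod_(i < n) c i; set A := \prod_(i < n) a i.
have C0 : C != 0 by apply/prodf_neq0.
have A0 : A != 0 by apply/prodf_neq0.
have CA0 : C * A != 0 by rewrite mulf_neq0.
have -> : - C^-1 / A = - (C * A)^-1 by rewrite invfM mulNr.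
by rewrite (thetaVN p01 CA0) mulf_neq0 // invr_eq0.
Unshelve. all: by end_near.
Qed.

(** * Families indexed by ordinals *)

(** The induction in [det_flag] passes to the first members of the families,
    which is direct for families over [nat]; a family over ['I_n] is turned into
    one by a default value. *)
Definition extend (T : Type) (d : T) (n : nat) (f : 'I_n -> T) (k : nat) : T :=
  oapp f d (insub k).

Lemma extendE (T : Type) (d : T) (n : nat) (f : 'I_n -> T) (i : 'I_n) :
  extend d f i = f i.
Proof. by rewrite /extend valK. Qed.

Lemma extend_ind (T : Type) (Q : T -> Prop) (d : T) (n : nat) (f : 'I_n -> T) :
  Q d -> (forall i, Q (f i)) -> forall k, Q (extend d f k).
Proof. by move=> Qd Qf k; rewrite /extend; case: (insub k) => [i|] /=. Qed.

Lemma prod_after (n j : nat) (F : nat -> CC) :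
  \prod_(j.+1 <= k < n) F k = \prod_(k < n | (j < k)%N) F k.
Proof.
have [jn|nj] := ltnP j n; last first.
  rewrite big_geq ?(leq_trans nj) // big1 // => k jk.
  by have := ltn_trans jk (ltn_ord k); rewrite ltnNge nj.
by rewrite (big_nat_widenl _ 0) // big_mkord.
Qed.

Lemma A_theta_space (p s : CC) (m : nat) (f : CC -> CC) :
  A_theta p m s f -> theta_space p m s f.
Proof. by case=> _ _ fh fp; split=> // y y0; apply/holP/fh. Qed.

Unset Implicit Arguments.

Theorem corollary4p13 (p : CC) (n : nat) (x a c : 'I_n -> CC)
    (P : 'I_n -> CC -> CC) :
  0 < `|p| < 1 ->
  (forall i, x i != 0) -> (forall i, a i != 0) -> (forall i, c i != 0) ->
  theta p (- ((\prod_(i < n) c i) * \prod_(i < n) a i)) != 0 ->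
  (forall j : 'I_n,
     A_theta p j.+1
       (- ((\prod_(i < n) c i) * \prod_(k < n | (j < k)%N) a k)^-1) (P j)) ->
  \det (\matrix_(i < n, j < n)
      (x i ^- n * (\prod_(k < n) theta p (c k * x i)) * P j (x i)
         * (\prod_(k < n | (j < k)%N) theta p (a k * x i))
       - x i ^+ n * (\prod_(k < n) theta p (c k * (x i)^-1)) * P j (x i)^-1
         * (\prod_(k < n | (j < k)%N) theta p (a k * (x i)^-1))))
  = (\prod_(i < n) a i) * (\prod_(i < n) c i) * theta p (- 1)
      / theta p (- ((\prod_(i < n) c i) * \prod_(i < n) a i))
    * (\prod_(i < n) P i (1 / a i))
    * (\prod_(i < n) theta (p ^+ 2) (p * c i ^+ 2))
    * (\prod_(i < n) \prod_(j < n | (i < j)%N) theta p (c i * c j))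
    * (\prod_(i < n) ((x i)^-1 * theta (p ^+ 2) (x i ^+ 2)))
    * (\prod_(i < n) \prod_(j < n | (i < j)%N)
         (a j * (x i)^-1 * theta_pm p (x i) (x j))).
Proof.
pose X := extend 1 x; pose A := extend 1 a; pose C := extend 1 c.
pose F := extend (fun=> 0) P.
have Xx : x = fun i => X i by apply/funext => i; rewrite /X extendE.
have Aa : a = fun i => A i by apply/funext => i; rewrite /A extendE.
have Cc : c = fun i => C i by apply/funext => i; rewrite /C extendE.
have FP : P = fun i => F i by apply/funext => i; rewrite /F extendE.
have nz (f : 'I_n -> CC) : (forall i, f i != 0) -> forall k, extend 1 f k != 0.
  by apply: (@extend_ind _ (fun y => y != 0)); exact: oner_neq0.
move=> p01 /nz x0 /nz a0 /nz c0; move: x0 a0 c0.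
rewrite -/X -/A -/C Xx Aa Cc FP => x0 a0 c0 t0 PV.
rewrite -(@antisym_det p n X A C F) //.
  congr (\det _); apply/matrixP => i j.
  by rewrite !mxE /antisym /flag_fun !prod_after !mulrA.
move=> j jn; have := A_theta_space (PV (Ordinal jn)).
by rewrite prod_after /= invfM mulNr.
Qed.
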